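(* Let $\alpha$ denote Otter's constant. If $s\in(\sqrt{\alpha},1]$, then there exists $\lambda(s)>0$ such that for all $\lambda\ge\lambda(s)$ a one-sided test exists, i.e. there exist tests $\mathcal{T}_d:\mathcal{X}_d\times\mathcal{X}_d\to\{0,1\}$ with $\mathbb{P}^{(\lambda,0)}_d(\mathcal{T}_d=1)\to0$ as $d\to\infty$ and $\liminf_{d\to\infty}\mathbb{P}^{(\lambda,s)}_d(\mathcal{T}_d=1)>0$.
   Context: Rooted unlabeled trees: $\mathcal{X}_0=\{\bullet\}$ consists of the trivial tree. For $d\ge1$, an element $t\in\mathcal{X}_d$ is a family $t=\{N_\tau\}_{\tau\in\mathcal{X}_{d-1}}$ of non-negative integers with finite support ($N_\tau$ is the number of children of the root whose subtree is $\tau$). Galton–Watson law: for $\mu>0$, $\mathrm{GW}^{(\mu)}_0$ is the Dirac mass at $\bullet$, and for $d\ge1$, $t=\{N_\tau\}\sim \mathrm{GW}^{(\mu)}_d$ means the $N_\tau$ are independent with $N_\tau\sim\mathrm{Poisson}(\mu\,\mathrm{GW}^{(\mu)}_{d-1}(\tau))$. Null model: $\mathbb{P}^{(\lambda,0)}_d=\mathrm{GW}^{(\lambda)}_d\otimes\mathrm{GW}^{(\lambda)}_d$. Correlated model $\mathbb{P}^{(\lambda,s)}_d$ ($\lambda>0$, $s\in[0,1]$): $\mathbb{P}^{(\lambda,s)}_0$ is the Dirac mass at $(\bullet,\bullet)$; for $d\ge1$, $(t,t')=(\{N_\tau\},\{N'_\tau\})\sim\mathbb{P}^{(\lambda,s)}_d$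 is sampled as $N_\tau=\Delta_\tau+\sum_{\tau'\in\mathcal{X}_{d-1}}M_{\tau,\tau'}$, $N'_{\tau'}=\Delta'_{\tau'}+\sum_{\tau\in\mathcal{X}_{d-1}}M_{\tau,\tau'}$, where all $\Delta_\tau,\Delta'_\tau,M_{\tau,\tau'}$ are independent Poisson variables with parameters $\lambda(1-s)\mathrm{GW}^{(\lambda)}_{d-1}(\tau)$ for $\Delta_\tau,\Delta'_\tau$ and $\lambda s\,\mathbb{P}^{(\lambda,s)}_{d-1}(\tau,\tau')$ for $M_{\tau,\tau'}$. Otter's constant $\alpha\approx0.3383219$ is the number such that the number $A_n$ of rooted unlabeled trees with $n$ nodes satisfies $A_n\sim D\,n^{-3/2}\alpha^{-n}$ for some $D>0$. *)

(* Defs.v *)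
From HB Require Import structures.
From mathcomp Require Import all_boot all_order all_algebra.
From mathcomp Require Import finmap.
From mathcomp Require Import all_classical all_reals all_analysis.
Set Implicit Arguments. Unset Strict Implicit. Unset Printing Implicit Defensive.
Import Order.TTheory GRing.Theory Num.Theory numFieldNormedType.Exports.
Local Open Scope ring_scope.
Local Open Scope classical_set_scope.

Fixpoint X (d : nat) : choiceType :=
  match d with
  | 0 => unit
  | d'.+1 => {fsfun X d' -> nat with 0%N}
  end.

Fixpoint nodes (d : nat) : X d -> nat :=
  match d return X d -> nat with
  | 0 => fun _ => 1%N
  | d'.+1 => fun t => (1 + \sum_(tau <- finsupp t) t tau * nodes tau)%N
  end.

Local Open Scope ereal_scope.

(* Probability that independent N_i ~ Poisson(r i) (i ranging over the
   countable type I) take the values N i, where N is supported in the finite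
   set S.  This is the infinite product
     prod_i exp(-r i) (r i)^(N i) / (N i)!
   = exp(- sum_i r i) * prod_(i in S) (r i)^(N i) / (N i)!. *)
Definition indep_poisson_pmf {R : realType} {I : choiceType}
    (r : I -> \bar R) (S : {fset I}) (N : I -> nat) : \bar R :=
  expeR (- \esum_(i in [set: I]) r i) *
  \prod_(i <- S) ((r i) ^+ (N i) * (((N i)`!)%:R^-1)%:E).

Fixpoint GW {R : realType} (mu : R) (d : nat) : X d -> \bar R :=
  match d return X d -> \bar R with
  | 0 => fun _ => 1
  | d'.+1 => fun t : {fsfun X d' -> nat with 0%N} =>
      indep_poisson_pmf (fun tau => mu%:E * @GW R mu d' tau) (finsupp t) t
  end.

Definition null_model {R : realType} (lam : R) (d : nat) (p : X d * X d)
  : \bar R := @GW R lam d p.1 * @GW R lam d p.2.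

Definition rowsum {A B : choiceType}
    (M : {fsfun (A * B)%type -> nat with 0%N}) (a : A) : nat :=
  (\sum_(p <- finsupp M | p.1 == a) M p)%N.
Definition colsum {A B : choiceType}
    (M : {fsfun (A * B)%type -> nat with 0%N}) (b : B) : nat :=
  (\sum_(p <- finsupp M | p.2 == b) M p)%N.

(* Correlated model P^(lambda,s)_d as a probability mass function on
   X d * X d: the law of (t,t') where N_tau = Delta_tau + sum_tau' M_(tau,tau')
   and N'_tau' = Delta'_tau' + sum_tau M_(tau,tau'), obtained by summing over
   all admissible values of the matrix M (then Delta, Delta' are determined). *)
Fixpoint corr_model {R : realType} (lam s : R) (d : nat)
  : X d * X d -> \bar R :=
  match d return X d * X d -> \bar R with
  | 0 => fun _ => 1
  | d'.+1 => fun p : {fsfun X d' -> nat with 0%N} * {fsfun X d' -> nat with 0%N} =>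
      \esum_(M in [set M : {fsfun (X d' * X d')%type -> nat with 0%N} |
                  (forall tau, (rowsum M tau <= p.1 tau)%N) /\
                  (forall tau', (colsum M tau' <= p.2 tau')%N)])
        (indep_poisson_pmf (fun q => (lam * s)%:E * @corr_model R lam s d' q)
            (finsupp M) M *
         indep_poisson_pmf (fun tau => (lam * (1 - s))%:E * @GW R lam d' tau)
            (finsupp p.1) (fun tau => p.1 tau - rowsum M tau)%N *
         indep_poisson_pmf (fun tau' => (lam * (1 - s))%:E * @GW R lam d' tau')
            (finsupp p.2) (fun tau' => p.2 tau' - colsum M tau')%N)
  end.

Definition prob_event {R : realType} {T : choiceType}
    (P : T -> \bar R) (test : T -> bool) : \bar R :=
  \esum_(x in [set x | test x]) P x.

Arguments GW {R} mu d _.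
Arguments null_model {R} lam d p.
Arguments corr_model {R} lam s d _.

Local Close Scope ereal_scope.

(* Otter's constant: alpha > 0 such that the number A_n of rooted unlabeled
   trees with n nodes satisfies A_n ~ D n^(-3/2) alpha^(-n) for some D > 0.
   Rooted unlabeled trees with n >= 1 nodes are exactly the elements of
   X (n-1) with n nodes. *)
Definition is_otter_constant {R : realType} (alpha : R) : Prop :=
  0 < alpha /\
  exists A : nat -> nat,
    (forall n : nat, (0 < n)%N ->
       ([set t : X n.-1 | nodes t = n] #= [set: 'I_(A n)])%card) /\
    exists D : R, 0 < D /\
      ((A n)%:R / (D * (n%:R `^ (-(3/2))) * alpha ^- n) : R)
        @[n --> \oo] --> (1 : R).

(* Main.v *)
(* The children of the root, marked by their subtrees, form a Poisson process, so
   L^2 of the Galton-Watson law of depth d has an explicit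
   orthonormal Fock basis: by recursion on d, the chaoses (Wick products) of the
   basis of depth d-1, indexed by the trees b of depth d. Under the correlated
   law the basis elements of t and t' are still orthogonal, and the covariance of
   the b-th ones is s^(nodes b - 1).

   Base test. With h_b the basis at depth d and y_b the corresponding first chaos
   at depth d+1, put W(t,t') = sum of y_b(t) y_b(t') over the A_n trees b with
   n = d+1 nodes. Then W has second moment A_n under the null law, while under
   the correlated law it has mean A_n s^n and, for large lambda, variance at most
   3 A_n. By Otter's asymptotics A_n s^(2n) is unbounded as soon as s^2 > alpha,
   so for a suitable fixed n and all large lambda, Markov's and Chebyshev's
   inequalities make the null mass of {W >= A_n s^n / 2} small and its correlated
   mass at least 3/4.

   Bootstrap. From a finite set F of pairs at depth d with correlated mass at
   least 1/2 and null mass e, the statistic W(t,t') = sum over (a,b) in F of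
   y_a(t) y_b(t'), y_a now being the centred and normalised number of children of
   type a, has mean s p >= s/2 and variance at most 2 e + 1/lambda under the
   correlated law, and fourth moment at most 9 e^2 + 13 e / lambda under the null
   law. Thresholding at s p / 2 therefore halves the null mass at depth d+1
   while the correlated mass stays above 3/4. *)

(* The base test makes the null mass small only once, whereas at fixed [lam] it must tend to 0 with
   the depth; the bootstrap does this. Under the null law its statistic has second moment [e], so
   Markov's inequality of order 2 would only return a constant multiple of [e]. The fourth moment is
   quadratic in [e] up to a term of order [e / lam], which gives a contraction when [e] is small and
   [lam] large. The two stages need different control of [lam]. The base test lives at one depth, so
   its bounds may depend on that depth in any way as long as they are uniform in [lam]: this is
   [tame]. The bootstrap visits all depths with the same [lam], so its constants must be explicit;
   it uses only indicators, whose products collapse. Both laws are handled through the Mecke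
   identity alone: it identifies the marginals of the correlated law, computes covariances of
   chaoses by integration by parts, and bounds moments. Each bootstrap step first shrinks the test
   to a finite set of pairs, which lowers the correlated mass from 3/4 to 1/2; Chebyshev's
   inequality at the next depth restores 3/4. *)
Require Import Defs.
From HB Require Import structures.
From mathcomp Require Import all_boot all_order all_algebra.
From mathcomp Require Import finmap.
From mathcomp Require Import all_classical all_reals all_analysis.
From mathcomp Require Import ring lra.
Set Implicit Arguments. Unset Strict Implicit. Unset Printing Implicit Defensive.
Import Order.TTheory GRing.Theory Num.Theory numFieldNormedType.Exports.
Local Open Scope ring_scope.
Local Open Scope classical_set_scope.

(** * Absolutely convergent sums *)

Section Sums.
Variable R : realType.
Implicit Types T : choiceType.

Definition psum T (f : T -> R) : \bar R := \esum_(x in [set: T]) (f x)%:E.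
Definition asummable T (f : T -> R) := (psum (fun x => `|f x|%R) < +oo)%E.
(* A junk value when [f] is not absolutely summable. *)
Definition rsum T (f : T -> R) : R :=
  fine (psum (fun x => Num.max (f x) 0)) - fine (psum (fun x => Num.max (- f x) 0)).

Lemma psum_ge0 T (f : T -> R) : (forall x, 0 <= f x) -> (0 <= psum f)%E.
Proof. by move=> f0; apply: esum_ge0 => x _; rewrite lee_fin. Qed.

Lemma le_psum T (f g : T -> R) : (forall x, f x <= g x) -> (psum f <= psum g)%E.
Proof. by move=> fg; apply: le_esum => x _; rewrite lee_fin. Qed.

Lemma eq_psum T (f g : T -> R) : f =1 g -> psum f = psum g.
Proof. by move=> fg; apply: eq_esum => x _; rewrite fg. Qed.

Lemma psumD T (f g : T -> R) : (forall x, 0 <= f x) -> (forall x, 0 <= g x) ->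
  psum (fun x => f x + g x) = (psum f + psum g)%E.
Proof. by move=> f0 g0; rewrite /psum -esumD// => x _; rewrite lee_fin. Qed.

Lemma psum0 T : psum (fun _ : T => 0) = 0%E.
Proof. by rewrite /psum esum1. Qed.

Lemma le_esumZ T (c : R) (g : T -> \bar R) : 0 < c -> (forall x, (0 <= g x)%E) ->
  (c%:E * (\esum_(x in [set: T]) g x) <= \esum_(x in [set: T]) (c%:E * g x))%E.
Proof.
move=> c0 g0; rewrite -lee_pdivlMl//; apply: ge_ereal_sup => /= _ [X [fX _] <-].
rewrite lee_pdivlMl//; apply: esum_ge; exists X => //.
by rewrite !fsbig_finite//= ge0_sume_distrr.
Qed.

(** The inequality missing from [le_esumZ] is [le_esumZ] itself for the constant [c^-1]. *)
Lemma esumZ T (c : R) (g : T -> \bar R) : 0 <= c -> (forall x, (0 <= g x)%E) ->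
  (\esum_(x in [set: T]) (c%:E * g x) = c%:E * (\esum_(x in [set: T]) g x))%E.
Proof.
rewrite le_eqVlt => /orP[/eqP<- g0|c0 g0].
  by rewrite mul0e esum1// => x _; rewrite mul0e.
apply/eqP; rewrite eq_le; apply/andP; split; last exact: le_esumZ.
rewrite -lee_pdivrMl//; apply: le_trans (le_esumZ _ _) _.
- by rewrite invr_gt0.
- by move=> x; rewrite mule_ge0// lee_fin ltW.
- by apply: le_esum => x _; rewrite muleA -EFinM mulVf ?gt_eqF// mul1e.
Qed.

Lemma psumZ T (c : R) (f : T -> R) : 0 <= c -> (forall x, 0 <= f x) ->
  psum (fun x => c * f x) = (c%:E * psum f)%E.
Proof.
move=> c0 f0; rewrite /psum -esumZ//.
Qed.

Lemma psum_pair T1 T2 (f : T1 -> T2 -> R) : (forall x y, 0 <= f x y) ->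
  psum (fun k : T1 * T2 => f k.1 k.2) = (\esum_(x in [set: T1]) psum (f x))%E.
Proof.
move=> f0; rewrite /psum esum_esum//=; last by move=> *; rewrite lee_fin.
by congr (esum _ _); apply/seteqP.
Qed.

Lemma psum_bij T1 T2 (e : T1 -> T2) (f : T2 -> R) : bijective e ->
  psum f = psum (f \o e).
Proof.
by move=> be; rewrite /psum (reindex_esum setT setT e)//; rewrite setTT_bijective.
Qed.

Lemma psum_swap T1 T2 (f : T1 * T2 -> R) :
  psum f = psum (fun k : T2 * T1 => f (k.2, k.1)).
Proof.
rewrite (psum_bij (e := fun k : T2 * T1 => (k.2, k.1)))//.
by exists (fun k => (k.2, k.1)) => -[].
Qed.

Lemma psum_prod T1 T2 (f : T1 -> R) (g : T2 -> R) :
  (forall x, 0 <= f x) -> (forall x, 0 <= g x) -> (psum g < +oo)%E ->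
  psum (fun k : T1 * T2 => f k.1 * g k.2) = (psum f * psum g)%E.
Proof.
move=> f0 g0 goo.
rewrite (psum_pair (f := fun x y => f x * g y)); last by move=> *; rewrite mulr_ge0.
under eq_esum do rewrite psumZ//.
have gf : psum g \is a fin_num by rewrite ge0_fin_numE// psum_ge0.
rewrite -(fineK gf) [RHS]muleC /psum -esumZ//; last 2 first.
- by apply: eq_esum => x _; rewrite muleC.
- by rewrite fine_ge0// psum_ge0.
Qed.

Lemma psum_single T (x0 : T) (f : T -> R) : 0 <= f x0 ->
  (forall x, x != x0 -> f x = 0) -> psum f = (f x0)%:E.
Proof.
move=> f0 fx.
rewrite /psum -[RHS](@esum_set1 _ _ x0 (EFin \o f))// [RHS]esum_mkcond; apply: eq_esum => x _ /=.
by case: ifPn => //; rewrite notin_setE /= => /eqP xx0; rewrite fx.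
Qed.

Lemma psum_fin T (f : T -> R) : (forall x, 0 <= f x) -> (psum f < +oo)%E ->
  psum f = (fine (psum f))%:E.
Proof. by move=> f0 foo; rewrite fineK// ge0_fin_numE// psum_ge0. Qed.

Lemma asummable_ge0 T (f : T -> R) : (forall x, 0 <= f x) -> asummable f = (psum f < +oo)%E :> Prop.
Proof. by move=> f0; rewrite /asummable; congr (is_true (_ < _)%E); apply: eq_psum => x; rewrite ger0_norm. Qed.

Lemma le_asummable T (f g : T -> R) : (forall x, `|f x| <= g x) -> (psum g < +oo)%E -> asummable f.
Proof. by move=> fg; apply: le_lt_trans; exact: le_psum. Qed.

Lemma eq_asummable T (f g : T -> R) : f =1 g -> asummable f -> asummable g.
Proof. by move=> fg; rewrite /asummable (eq_psum (g := fun x => `|g x|))// => x; rewrite fg. Qed.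

Lemma asummableD T (f g : T -> R) : asummable f -> asummable g -> asummable (fun x => f x + g x).
Proof.
move=> fs gs; apply: (le_asummable (g := fun x => `|f x| + `|g x|)).
  by move=> x; exact: ler_normD.
by rewrite psumD// lte_add_pinfty.
Qed.

Lemma asummableZ T c (f : T -> R) : asummable f -> asummable (fun x => c * f x).
Proof.
move=> fs; rewrite /asummable (eq_psum (g := fun x => `|c| * `|f x|)); last by move=> x; rewrite normrM.
rewrite psumZ// (psum_fin _ fs)// -EFinM ltry//.
Qed.

Lemma asummableN T (f : T -> R) : asummable f -> asummable (fun x => - f x).
Proof. by move=> fs; apply: eq_asummable (asummableZ (-1) fs) => x; rewrite mulN1r. Qed.

Lemma asummable0 T : asummable (fun _ : T => 0).
Proof. by rewrite asummable_ge0// psum0. Qed.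

Lemma asummable_sum T J (r : seq J) (Q : pred J) (f : J -> T -> R) :
  (forall j, Q j -> asummable (f j)) -> asummable (fun x => \sum_(j <- r | Q j) f j x).
Proof.
move=> fs; elim: r => [|j r ih].
  by apply: eq_asummable (asummable0 T) => x; rewrite big_nil.
case Qj : (Q j); last by apply: eq_asummable ih => x; rewrite big_cons Qj.
by apply: eq_asummable (asummableD (fs _ Qj) ih) => x; rewrite big_cons Qj.
Qed.

Lemma asummable_prod T1 T2 (f : T1 -> R) (g : T2 -> R) : asummable f -> asummable g ->
  asummable (fun k : T1 * T2 => f k.1 * g k.2).
Proof.
move=> fs gs; rewrite /asummable (eq_psum (g := fun k => `|f k.1| * `|g k.2|)); last first.
  by move=> x; rewrite normrM.
by rewrite (psum_prod (f := fun x => `|f x|) (g := fun x => `|g x|))// (psum_fin _ fs)// (psum_fin _ gs)// -EFinM ltry.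
Qed.

(** Two decompositions of [f] as a difference satisfy [u + b = v + a], so additivity of [psum] makes
    the value independent of the decomposition. Linearity of [rsum] follows from this. *)
Lemma rsum_eq T (a b f : T -> R) : (forall x, 0 <= a x) -> (forall x, 0 <= b x) ->
  (psum a < +oo)%E -> (psum b < +oo)%E -> (forall x, f x = a x - b x) ->
  rsum f = fine (psum a) - fine (psum b).
Proof.
move=> a0 b0 aoo boo fab; rewrite /rsum.
set u := fun x => Num.max (f x) 0; set v := fun x => Num.max (- f x) 0.
have u0 x : 0 <= u x by rewrite /u le_max lexx orbT.
have v0 x : 0 <= v x by rewrite /v le_max lexx orbT.
have uoo : (psum u < +oo)%E.
  apply: le_lt_trans aoo; apply: le_psum => x; rewrite /u ge_max a0 andbT fab.
  by rewrite gerBl.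
have voo : (psum v < +oo)%E.
  apply: le_lt_trans boo; apply: le_psum => x; rewrite /v ge_max b0 andbT fab.
  by rewrite opprB gerBl.
have /eqP : (psum u + psum b = psum v + psum a)%E.
  rewrite -!psumD//; apply: eq_psum => x; rewrite /u /v fab.
  have [h|h] := leP 0 (a x - b x).
    by rewrite max_r ?oppr_le0//; lra.
  by rewrite max_l; lra.
rewrite (psum_fin u0 uoo) (psum_fin v0 voo) (psum_fin a0 aoo) (psum_fin b0 boo) -!EFinD eqe => /eqP.
lra.
Qed.

Definition ppart T (f : T -> R) x := Num.max (f x) 0.
Definition npart T (f : T -> R) x := Num.max (- f x) 0.

Lemma ppart_ge0 T (f : T -> R) x : 0 <= ppart f x.
Proof. by rewrite le_max lexx orbT. Qed.
Lemma npart_ge0 T (f : T -> R) x : 0 <= npart f x.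
Proof. by rewrite le_max lexx orbT. Qed.
Lemma ppart_npart T (f : T -> R) x : f x = ppart f x - npart f x.
Proof.
rewrite /ppart /npart; have [h|h] := leP 0 (f x).
  by rewrite max_r ?oppr_le0// subr0.
by rewrite max_l; lra.
Qed.
Lemma abs_parts T (f : T -> R) x : `|f x| = ppart f x + npart f x.
Proof.
rewrite /ppart /npart; have [h|h] := leP 0 (f x).
  by rewrite max_r ?oppr_le0// addr0 ger0_norm.
by rewrite max_l; rewrite ?ltr0_norm//; lra.
Qed.
Lemma ppart_fin T (f : T -> R) : asummable f -> (psum (ppart f) < +oo)%E.
Proof.
apply: le_lt_trans; apply: le_psum => x; rewrite abs_parts lerDl; exact: npart_ge0.
Qed.
Lemma npart_fin T (f : T -> R) : asummable f -> (psum (npart f) < +oo)%E.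
Proof.
apply: le_lt_trans; apply: le_psum => x; rewrite abs_parts lerDr; exact: ppart_ge0.
Qed.

Lemma rsumE T (f : T -> R) : rsum f = fine (psum (ppart f)) - fine (psum (npart f)).
Proof. by []. Qed.

Lemma eq_rsum T (f g : T -> R) : f =1 g -> rsum f = rsum g.
Proof. by move=> /funext ->. Qed.

Lemma rsum_ge0E T (f : T -> R) : (forall x, 0 <= f x) -> rsum f = fine (psum f).
Proof.
move=> f0; rewrite rsumE (eq_psum (f := npart f) (g := fun=> 0)).
  by rewrite psum0 subr0; congr fine; apply: eq_psum => x; rewrite /ppart max_l.
by move=> x; rewrite /npart max_r// oppr_le0.
Qed.

Lemma rsum_psum T (f : T -> R) : (forall x, 0 <= f x) -> asummable f -> (rsum f)%:E = psum f.
Proof. by move=> f0 fs; rewrite rsum_ge0E// -psum_fin// -asummable_ge0. Qed.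

Lemma rsum_ge0 T (f : T -> R) : (forall x, 0 <= f x) -> 0 <= rsum f.
Proof. by move=> f0; rewrite rsum_ge0E// fine_ge0// psum_ge0. Qed.

Lemma rsumD T (f g : T -> R) : asummable f -> asummable g -> rsum (fun x => f x + g x) = rsum f + rsum g.
Proof.
move=> fs gs.
have [pf nf pg ng] := And4 (ppart_fin fs) (npart_fin fs) (ppart_fin gs) (npart_fin gs).
have pD : (psum (fun x => (ppart f x + ppart g x)%R) = psum (ppart f) + psum (ppart g))%E.
  by rewrite psumD//; exact: ppart_ge0.
have nD : (psum (fun x => (npart f x + npart g x)%R) = psum (npart f) + psum (npart g))%E.
  by rewrite psumD//; exact: npart_ge0.
rewrite (rsum_eq (a := fun x => ppart f x + ppart g x) (b := fun x => npart f x + npart g x)).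
- rewrite pD nD !fineD ?ge0_fin_numE ?psum_ge0// ?rsumE; try by [exact: ppart_ge0|exact: npart_ge0].
  lra.
- by move=> x; rewrite addr_ge0// ppart_ge0.
- by move=> x; rewrite addr_ge0// npart_ge0.
- by rewrite pD lte_add_pinfty.
- by rewrite nD lte_add_pinfty.
- by move=> x; rewrite [f x]ppart_npart [g x]ppart_npart; lra.
Qed.

Lemma rsumN T (f : T -> R) : rsum (fun x => - f x) = - rsum f.
Proof.
rewrite !rsumE opprB; congr (fine _ - fine _); apply: eq_psum => x //.
by rewrite /npart opprK.
Qed.

Lemma rsumZ T c (f : T -> R) : asummable f -> rsum (fun x => c * f x) = c * rsum f.
Proof.
move=> fs.
suff pos (c' : R) : 0 <= c' -> rsum (fun x => c' * f x) = c' * rsum f.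
  have [|/ltW c0] := leP 0 c; first exact: pos.
  rewrite (eq_rsum (g := fun x => - (- c * f x))); last by move=> x; lra.
  by rewrite rsumN pos ?oppr_ge0// mulNr opprK.
move=> c0.
have [pf nf] := conj (ppart_fin fs) (npart_fin fs).
have pE : psum (fun x => c' * ppart f x) = (c' * fine (psum (ppart f)))%:E.
  rewrite psumZ//; [by rewrite [in LHS]psum_fin// => ?; exact: ppart_ge0|exact: ppart_ge0].
have nE : psum (fun x => c' * npart f x) = (c' * fine (psum (npart f)))%:E.
  rewrite psumZ//; [by rewrite [in LHS]psum_fin// => ?; exact: npart_ge0|exact: npart_ge0].
rewrite (rsum_eq (a := fun x => c' * ppart f x) (b := fun x => c' * npart f x)).
- by rewrite pE nE /= rsumE mulrBr.
- by move=> x; rewrite mulr_ge0// ppart_ge0.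
- by move=> x; rewrite mulr_ge0// npart_ge0.
- by rewrite pE ltry.
- by rewrite nE ltry.
- by move=> x; rewrite [f x]ppart_npart mulrBr.
Qed.

Lemma rsumB T (f g : T -> R) : asummable f -> asummable g -> rsum (fun x => f x - g x) = rsum f - rsum g.
Proof. by move=> fs gs; rewrite rsumD ?rsumN//; exact: asummableN. Qed.

Lemma rsum0 T : rsum (fun _ : T => 0) = 0.
Proof. by rewrite rsum_ge0E// psum0. Qed.

Lemma rsum_sum T J (r : seq J) (Q : pred J) (f : J -> T -> R) :
  (forall j, Q j -> asummable (f j)) ->
  rsum (fun x => \sum_(j <- r | Q j) f j x) = \sum_(j <- r | Q j) rsum (f j).
Proof.
move=> fs; elim: r => [|j r ih].
  by rewrite big_nil -[RHS](rsum0 T); apply: eq_rsum => x; rewrite big_nil.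
rewrite big_cons; case: ifPn => Qj; last first.
  by rewrite -ih; apply: eq_rsum => x; rewrite big_cons (negbTE Qj).
rewrite -ih -rsumD//; [|exact: fs|exact: asummable_sum].
by apply: eq_rsum => x; rewrite big_cons Qj.
Qed.

Lemma le_rsum T (f g : T -> R) : asummable f -> asummable g -> (forall x, f x <= g x) -> rsum f <= rsum g.
Proof.
by move=> fs gs fg; rewrite -subr_ge0 -rsumB//; apply: rsum_ge0 => x; rewrite subr_ge0.
Qed.

Lemma abs_rsum T (f : T -> R) : asummable f -> `|rsum f| <= rsum (fun x => `|f x|).
Proof.
move=> fs; have as_ : asummable (fun x => `|f x|) by rewrite asummable_ge0.
rewrite ler_norml -rsumN; apply/andP; split; apply: le_rsum => //; first exact: asummableN.
  by move=> x; rewrite lerNl -normrN ler_norm.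
by move=> x; rewrite ler_norm.
Qed.

Lemma rsum_bij T1 T2 (e : T1 -> T2) (f : T2 -> R) : bijective e -> rsum f = rsum (f \o e).
Proof. by move=> be; rewrite !rsumE (psum_bij (ppart f) be) (psum_bij (npart f) be). Qed.

Lemma rsum_prod T1 T2 (f : T1 -> R) (g : T2 -> R) : asummable f -> asummable g ->
  rsum (fun k : T1 * T2 => f k.1 * g k.2) = rsum f * rsum g.
Proof.
move=> fs gs.
have [pf nf pg ng] := And4 (ppart_fin fs) (npart_fin fs) (ppart_fin gs) (npart_fin gs).
have gen (u : T1 -> R) (v : T2 -> R) : (forall x, 0 <= u x) -> (forall x, 0 <= v x) ->
    (psum u < +oo)%E -> (psum v < +oo)%E ->
    asummable (fun k => u k.1 * v k.2) /\ rsum (fun k : T1 * T2 => u k.1 * v k.2) = rsum u * rsum v.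
  move=> u0 v0 uoo voo; split; first by apply: asummable_prod; rewrite asummable_ge0.
  rewrite !rsum_ge0E//; last by move=> k; rewrite mulr_ge0.
  by rewrite psum_prod// (psum_fin u0 uoo) (psum_fin v0 voo).
have [s1 e1] := gen _ _ (@ppart_ge0 _ f) (@ppart_ge0 _ g) pf pg.
have [s2 e2] := gen _ _ (@ppart_ge0 _ f) (@npart_ge0 _ g) pf ng.
have [s3 e3] := gen _ _ (@npart_ge0 _ f) (@ppart_ge0 _ g) nf pg.
have [s4 e4] := gen _ _ (@npart_ge0 _ f) (@npart_ge0 _ g) nf ng.
rewrite (eq_rsum (g := fun k => (ppart f k.1 * ppart g k.2 - ppart f k.1 * npart g k.2)
   - (npart f k.1 * ppart g k.2 - npart f k.1 * npart g k.2))); last first.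
  by move=> k; rewrite [f k.1]ppart_npart [g k.2]ppart_npart; ring.
rewrite !rsumB//; try exact: asummableD (asummableN _).
rewrite e1 e2 e3 e4 (eq_rsum (ppart_npart f)) (eq_rsum (ppart_npart g)) !rsumB.
- by ring.
- by rewrite asummable_ge0//; exact: ppart_ge0.
- by rewrite asummable_ge0//; exact: npart_ge0.
- by rewrite asummable_ge0//; exact: ppart_ge0.
- by rewrite asummable_ge0//; exact: npart_ge0.
Qed.

End Sums.

(** * Finitely supported counting functions, read as point configurations *)

Notation fs I := {fsfun I -> nat with 0%N}.

Section FsfunOps.
Implicit Types I J : choiceType.

Definition incr I (N : fs I) (x : I) : fs I := [fsfun N with x |-> (N x).+1].
(** Truncated at 0: removing a point that is absent leaves [N] unchanged, hence the positivity
    hypothesis of [decrK]. *)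
Definition decr I (N : fs I) (x : I) : fs I := [fsfun N with x |-> (N x).-1].
Definition addfs I (N N' : fs I) : fs I :=
  [fsfun x in (finsupp N `|` finsupp N')%fset => (N x + N' x)%N].
Definition subfs I (N N' : fs I) : fs I :=
  [fsfun x in finsupp N => (N x - N' x)%N].
(** Image of a configuration under [phi]. For [fst] and [snd] these are the row and column sums of
    the matching matrix. *)
Definition push I J (phi : J -> I) (M : fs J) : fs I :=
  [fsfun x in [fset phi q | q in finsupp M]%fset =>
     (\sum_(q <- finsupp M | phi q == x) M q)%N].

Lemma incrE I (N : fs I) x y : incr N x y = (N y + (y == x))%N.
Proof. by rewrite fsfun_withE; case: eqP => [->|_]; rewrite ?addn1 ?addn0. Qed.

Lemma decrE I (N : fs I) x y : decr N x y = (N y - (y == x))%N.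
Proof. by rewrite fsfun_withE; case: eqP => [->|_]; rewrite ?subn1 ?subn0. Qed.

Lemma addfsE I (N N' : fs I) x : addfs N N' x = (N x + N' x)%N.
Proof.
rewrite fsfunE inE; case: ifPn => //; rewrite negb_or => /andP[h1 h2].
by rewrite (fsfun_dflt h1) (fsfun_dflt h2).
Qed.

Lemma subfsE I (N N' : fs I) x : subfs N N' x = (N x - N' x)%N.
Proof. by rewrite fsfunE; case: ifPn => // h; rewrite (fsfun_dflt h). Qed.

Lemma pushE I J (phi : J -> I) (M : fs J) x :
  push phi M x = (\sum_(q <- finsupp M | phi q == x) M q)%N.
Proof.
rewrite fsfunE; case: ifPn => // h; rewrite big_seq_cond big1// => q /andP[qM /eqP qx].
by case/negP: h; apply/imfsetP; exists q.
Qed.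

Lemma fs_eq0 I (N : fs I) x : (x \notin finsupp N) = (N x == 0%N).
Proof. by rewrite mem_finsupp negbK. Qed.

Lemma big_finsupp (R : Type) (idx : R) (op : Monoid.com_law idx) I (N : fs I) (A : {fset I}) (F : I -> R) :
  (finsupp N `<=` A)%fset -> (forall x, N x = 0%N -> F x = idx) ->
  \big[op/idx]_(x <- finsupp N) F x = \big[op/idx]_(x <- A) F x.
Proof.
move=> NA F0; apply: big_fset_incl => // x _; rewrite fs_eq0 => /eqP; exact: F0.
Qed.

Lemma incrK I (N : fs I) x : decr (incr N x) x = N.
Proof. by apply/fsfunP => y; rewrite decrE incrE addnK. Qed.

Lemma decrK I (N : fs I) x : (0 < N x)%N -> incr (decr N x) x = N.
Proof.
move=> Nx; apply/fsfunP => y; rewrite incrE decrE; case: eqP => [->|_]; last by rewrite subn0 addn0.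
by rewrite subnK.
Qed.

Lemma incr_decr I (N : fs I) x y : (0 < N y)%N -> decr (incr N x) y = incr (decr N y) x.
Proof.
move=> Ny; apply/fsfunP => z; rewrite !(incrE, decrE).
by case: (z =P y) => [->|_]; rewrite ?subn0//= addnBAC.
Qed.

Lemma addfs_incrl I (N N' : fs I) x : addfs (incr N x) N' = incr (addfs N N') x.
Proof. by apply/fsfunP => z; rewrite !(addfsE, incrE) addnAC. Qed.

Lemma addfs_incrr I (N N' : fs I) x : addfs N (incr N' x) = incr (addfs N N') x.
Proof. by apply/fsfunP => z; rewrite !(addfsE, incrE) addnA. Qed.

(** Stated with [*+] in an arbitrary [nmodType] so as to serve both for counts in [nat] and for real
    linear statistics. *)
Lemma sum_incr (V : nmodType) I (N : fs I) x (F : I -> V) :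
  \sum_(y <- finsupp (incr N x)) F y *+ incr N x y = \sum_(y <- finsupp N) F y *+ N y + F x.
Proof.
pose A := (finsupp (incr N x) `|` finsupp N `|` [fset x])%fset.
rewrite (@big_finsupp _ _ _ _ _ A)/=; last 2 first.
- by rewrite /A -fsetUA fsubsetUl.
- by move=> y ->; rewrite mulr0n.
rewrite (@big_finsupp _ _ _ _ N A)/=; last 2 first.
- by rewrite fsubsetU// fsubsetUr.
- by move=> y ->; rewrite mulr0n.
under eq_bigr do rewrite incrE mulrnDr.
rewrite big_split/=; congr (_ + _).
rewrite (big_fsetD1 x)/=; last by rewrite !inE eqxx !orbT.
rewrite eqxx mulr1n big1_fset ?addr0// => y; rewrite !inE => /andP[/negbTE -> _] _.
by rewrite mulr0n.
Qed.

Lemma finsupp_incr I (N : fs I) x : finsupp (incr N x) = (x |` finsupp N)%fset.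
Proof.
apply/fsetP => y; rewrite mem_finsupp incrE !inE mem_finsupp addn_eq0 negb_and.
by case: (y =P x) => [->|_]; rewrite ?orbT ?orbF.
Qed.

Lemma push_incr I J (phi : J -> I) (M : fs J) q : push phi (incr M q) = incr (push phi M) (phi q).
Proof.
apply/fsfunP => x; rewrite incrE !pushE big_mkcond [in RHS]big_mkcond.
have e (N : fs J) : (\sum_(i <- finsupp N) (if phi i == x then N i else 0) =
    \sum_(i <- finsupp N) ((phi i == x) : nat) *+ N i)%N.
  apply: eq_bigr => i _; case: eqP => _; last by rewrite mul0rn.
  by rewrite -[RHS]mulr_natr mul1r natn.
by rewrite !e [LHS]sum_incr eq_sym.
Qed.

Lemma sum_push (V : nmodType) I J (phi : J -> I) (M : fs J) (F : I -> V) (A : {fset I}) :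
  (finsupp (push phi M) `<=` A)%fset ->
  \sum_(x <- A) F x *+ push phi M x = \sum_(q <- finsupp M) F (phi q) *+ M q.
Proof.
move=> sA; rewrite -(@big_finsupp _ _ _ _ (push phi M))//; last by move=> x ->; rewrite mulr0n.
pose B := [fset phi q | q in finsupp M]%fset.
have sB : (finsupp (push phi M) `<=` B)%fset by exact: finsupp_sub.
rewrite (@big_finsupp _ _ _ _ (push phi M) B)//; last by move=> x ->; rewrite mulr0n.
under eq_bigr do rewrite pushE big_mkcond -sumrMnr.
rewrite exchange_big/= big_seq [RHS]big_seq; apply: eq_bigr => q qM.
have qB : phi q \in B by apply/imfsetP; exists q.
rewrite (big_fsetD1 _ qB)/= eqxx big1_fset ?addr0// => y; rewrite !inE => /andP[yq _] _.
by rewrite eq_sym (negbTE yq) mulr0n.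
Qed.

(** Induction on the total number of points: every configuration is built from the empty one by
    adding points one at a time. *)
Lemma fs_ind I (P : fs I -> Prop) : P [fsfun] -> (forall N x, P N -> P (incr N x)) -> forall N, P N.
Proof.
move=> P0 Pi N.
have [n] := ubnP (\sum_(x <- finsupp N) N x); elim: n N => // n ih N hN.
have [e|/fset0Pn [x xN]] := eqVneq (finsupp N) fset0.
  suff -> : N = [fsfun] by [].
  by apply/fsfunP => x; rewrite fsfun0E fsfun_dflt// e.
have Nx : (0 < N x)%N by rewrite lt0n -mem_finsupp.
rewrite -(decrK Nx); apply/Pi/ih.
move: hN; rewrite -{1 2}(decrK Nx).
have := @sum_incr nat _ (decr N x) x (fun=> 1%N).
have e (N' : fs I) : \sum_(y <- finsupp N') (1%N : nat) *+ N' y = (\sum_(y <- finsupp N') N' y)%N.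
  by apply: eq_bigr => y _; rewrite -[LHS]mulr_natr mul1r natn.
by rewrite !e => ->; rewrite -[(_ + _)%R]/(_ + _)%N addn1 ltnS.
Qed.

End FsfunOps.

(** * Poisson families and the Mecke identity *)

Section Poisson.
Variables (R : realType) (I : choiceType).
Implicit Types (r : I -> R) (N : fs I).

(* Unnormalised: its total mass is [exp (sum r)]. *)
Definition upois r N : R := \prod_(x <- finsupp N) (r x ^+ N x / (N x)`!%:R).
Definition pois r N : R := expR (- rsum r) * upois r N.

Lemma upois_sub r N (A : {fset I}) : (finsupp N `<=` A)%fset ->
  upois r N = \prod_(x <- A) (r x ^+ N x / (N x)`!%:R).
Proof.
by move=> NA; rewrite /upois (big_finsupp _ NA)// => x ->; rewrite expr0 fact0 divr1.
Qed.

(** Ratio of neighbouring weights, from [r^(n+1) / (n+1)! * (n+1) = r * r^n / n!] in the coordinate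
    [x]. This is the only property of the Poisson weights behind the Mecke identity. *)
Lemma upois_incr r N x : upois r (incr N x) * (N x).+1%:R = r x * upois r N.
Proof.
rewrite (@upois_sub _ (incr N x) (x |` finsupp N)%fset) ?finsupp_incr//.
rewrite (@upois_sub _ N (x |` finsupp N)%fset) ?fsubsetUr//.
have xA : x \in (x |` finsupp N)%fset by rewrite !inE eqxx.
rewrite (big_fsetD1 _ xA)/= [in RHS](big_fsetD1 _ xA)/= incrE eqxx addn1 factS exprS natrM.
rewrite (eq_big_seq (fun y => r y ^+ N y / (N y)`!%:R)); last first.
  by move=> y; rewrite !inE => /andP[/negbTE yx _]; rewrite incrE yx addn0.
have : (N x).+1%:R != 0 :> R by rewrite pnatr_eq0.
have : (N x)`!%:R != 0 :> R by rewrite pnatr_eq0 -lt0n fact_gt0.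
move: (\prod_(_ <- _) _) (r x ^+ N x) ((N x)`!%:R) ((N x).+1%:R) => b p c d c0 d0.
by field; rewrite c0 d0.
Qed.

Lemma upois_ge0 r N : (forall x, 0 <= r x) -> 0 <= upois r N.
Proof. by move=> r0; rewrite prodr_ge0// => x _; rewrite divr_ge0// exprn_ge0. Qed.

Lemma pois_ge0 r N : (forall x, 0 <= r x) -> 0 <= pois r N.
Proof. by move=> r0; rewrite mulr_ge0 ?expR_ge0 ?upois_ge0. Qed.

Lemma psum_fset (T : choiceType) (A : {fset T}) (f : T -> R) :
  (forall x, 0 <= f x) -> (forall x, x \notin A -> f x = 0) ->
  psum f = (\sum_(x <- A) f x)%:E.
Proof.
move=> f0 fA; transitivity (\esum_(x in [set` A]) (f x)%:E).
  rewrite [RHS]esum_mkcond; apply: eq_esum => x _; case: ifPn => //.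
  by rewrite notin_setE /= => /negP xA; rewrite fA.
rewrite -(set_mem_set [set` A]) esum_fset//; last by move=> i _; rewrite lee_fin.
  have -> : [set` [set` A]] = [set` A] by rewrite set_mem_set.
  by rewrite fsbig_finite// set_fsetK sumEFin.
by rewrite set_mem_set; exact: finite_fset.
Qed.

(** A configuration with a marked point is a point together with an arbitrary configuration, through
    [incr]; [upois_incr] matches the weights on the two sides of this bijection. *)
Lemma upois_mecke r (Phi : I -> fs I -> fs I -> R) :
  (forall x, 0 <= r x) -> (forall x N N', 0 <= Phi x N N') ->
  psum (fun N => upois r N * \sum_(x <- finsupp N) (N x)%:R * Phi x (decr N x) N) =
  psum (fun k : I * fs I => r k.1 * upois r k.2 * Phi k.1 k.2 (incr k.2 k.1)).
Proof.
move=> r0 P0.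
pose f N x := upois r N * ((N x)%:R * Phi x (decr N x) N).
have f0 N x : 0 <= f N x by rewrite !mulr_ge0// upois_ge0.
transitivity (\esum_(N in [set: fs I]) psum (f N)).
  apply: eq_esum => N _; rewrite (@psum_fset _ (finsupp N))//; last first.
    by move=> x; rewrite fs_eq0 /f => /eqP ->; rewrite mul0r mulr0.
  by rewrite mulr_sumr.
rewrite -psum_pair// psum_swap.
transitivity (\esum_(k in [set k : I * fs I | (0 < k.2 k.1)%N]) (f k.2 k.1)%:E).
  rewrite [RHS]esum_mkcond; apply: eq_esum => -[x N] _ /=; case: ifPn => //.
  rewrite notin_setE /= => /negP; rewrite -eqn0Ngt => /eqP Nx.
  by rewrite /f Nx mul0r mulr0.
rewrite (reindex_esum setT _ (fun k : I * fs I => (k.1, incr k.2 k.1))).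
  apply: eq_esum => -[x N] _ /=; rewrite /f incrK incrE eqxx addn1 mulrA upois_incr//.
split.
- by move=> [x N] _ /=; rewrite incrE eqxx addn1.
- by move=> [x N] [y N'] _ _ /= [-> e]; rewrite -(incrK N y) e incrK.
- by move=> [x N] /= Nx; exists (x, decr N x) => //=; rewrite decrK.
Qed.

Definition fsize N : nat := (\sum_(x <- finsupp N) N x)%N.

Lemma fsize_incr N x : fsize (incr N x) = (fsize N).+1.
Proof.
have := @sum_incr nat _ N x (fun=> 1%N).
have e (N' : fs I) : \sum_(y <- finsupp N') (1%N : nat) *+ N' y = (\sum_(y <- finsupp N') N' y)%N.
  by apply: eq_bigr => y _; rewrite -[LHS]mulr_natr mul1r natn.
by rewrite !e -[_ + 1%N]/(_ + 1)%N addn1.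
Qed.

Lemma fsize_eq0 N : (fsize N == 0%N) = (N == [fsfun]).
Proof.
apply/idP/eqP => [|->]; last first.
  by rewrite /fsize finsupp0 big_seq_fset0.
rewrite sum_nat_seq_eq0 => /allP h; apply/fsfunP => x; rewrite fsfun0E.
by apply/eqP; case: (boolP (x \in finsupp N)) => [/h//|]; rewrite fs_eq0.
Qed.

(** Mecke's identity for the event of having [n+1] points gives [n+1] times the mass of level [n+1]
    on one side and [rho] times the mass of level [n] on the other. The multinomial formula is
    thereby avoided. *)
Lemma upois_level r (rho : R) n : (forall x, 0 <= r x) -> psum r = rho%:E ->
  psum (fun N => upois r N * (fsize N == n)%:R) = (rho ^+ n / n`!%:R)%:E.
Proof.
move=> r0 er; have rho0 : 0 <= rho by rewrite -lee_fin -er psum_ge0.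
elim: n => [|n ih].
  rewrite (@psum_single _ _ [fsfun]); last 2 first.
  - by rewrite mulr_ge0 ?upois_ge0.
  - by move=> N /negbTE; rewrite fsize_eq0 => ->; rewrite mulr0.
  by rewrite fsize_eq0 eqxx mulr1 /upois finsupp0 big_seq_fset0 expr0 fact0 divr1.
have := @upois_mecke r (fun _ _ N => (fsize N == n.+1)%:R) r0.
move=> /(_ _)/wrap[]; first by move=> *; exact: ler0n.
rewrite (@eq_psum _ _ _ (fun N => n.+1%:R * (upois r N * (fsize N == n.+1)%:R))); last first.
  move=> N; rewrite -mulr_suml -natr_sum -/(fsize N).
  by case: eqP => [->|_]; rewrite ?mulr0//; ring.
rewrite psumZ//; last by move=> N; rewrite mulr_ge0 ?upois_ge0.
rewrite (@eq_psum _ _ _ (fun k : I * fs I => r k.1 * (upois r k.2 * (fsize k.2 == n)%:R))); last first.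
  by move=> k; rewrite fsize_incr eqSS mulrA.
rewrite (psum_prod (f := r) (g := fun N => upois r N * (fsize N == n)%:R))//; last 2 first.
- by move=> N; rewrite mulr_ge0 ?upois_ge0.
- by rewrite ih ltry.
rewrite ih er -EFinM => h.
have {h} : ((n.+1%:R)^-1%:E * (n.+1%:R%:E * psum (fun x => (upois r x * (fsize x == n.+1)%:R)%R)) =
  (n.+1%:R)^-1%:E * (rho * (rho ^+ n / n`!%:R))%:E)%E by rewrite h.
rewrite muleA -!EFinM mulVf ?pnatr_eq0// mul1e => ->.
congr EFin; rewrite factS natrM exprS.
have : n.+1%:R != 0 :> R by rewrite pnatr_eq0.
have : n`!%:R != 0 :> R by rewrite pnatr_eq0 -lt0n fact_gt0.
by move: (n.+1%:R : R) (n`!%:R : R) => c d c0 d0; field; rewrite c0 d0.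
Qed.

(** The masses of the levels are the terms of the exponential series of [rho]. *)
Lemma upois_total r (rho : R) : (forall x, 0 <= r x) -> psum r = rho%:E ->
  psum (upois r) = (expR rho)%:E.
Proof.
move=> r0 er; have rho0 : 0 <= rho by rewrite -lee_fin -er psum_ge0.
transitivity (psum (fun k : nat * fs I => upois r k.2 * (fsize k.2 == k.1)%:R)).
  rewrite psum_swap (psum_pair (f := fun N n => upois r N * (fsize N == n)%:R)); last first.
    by move=> *; rewrite mulr_ge0 ?upois_ge0.
  apply: eq_esum => N _; rewrite (@psum_single _ _ (fsize N)).
  - by rewrite eqxx mulr1.
  - by rewrite mulr_ge0 ?upois_ge0.
  - by move=> n; rewrite eq_sym => /negbTE ->; rewrite mulr0.
rewrite (psum_pair (f := fun n N => upois r N * (fsize N == n)%:R)); last first.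
  by move=> *; rewrite mulr_ge0 ?upois_ge0.
under eq_esum do rewrite (upois_level _ r0 er).
rewrite -nneseries_esumT; last first.
  by move=> n; rewrite lee_fin divr_ge0// exprn_ge0.
rewrite /expR -EFin_lim; last exact: is_cvg_series_exp_coeff.
congr (limn _); apply/funext => n /=; rewrite /series/= sumEFin//.
Qed.

Lemma psum_pois r : (forall x, 0 <= r x) -> (psum r < +oo)%E -> psum (pois r) = 1%E.
Proof.
move=> r0 roo; rewrite psumZ ?expR_ge0//; last by move=> N; exact: upois_ge0.
rewrite (upois_total r0 (psum_fin r0 roo)) rsum_ge0E// -EFinM -expRD addNr expR0//.
Qed.

Lemma pois_mecke r (Phi : I -> fs I -> fs I -> R) :
  (forall x, 0 <= r x) -> (forall x N N', 0 <= Phi x N N') ->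
  psum (fun N => pois r N * \sum_(x <- finsupp N) (N x)%:R * Phi x (decr N x) N) =
  psum (fun k : I * fs I => r k.1 * pois r k.2 * Phi k.1 k.2 (incr k.2 k.1)).
Proof.
move=> r0 P0; under eq_psum do rewrite /pois -mulrA.
rewrite psumZ ?expR_ge0//; last first.
  move=> N; rewrite mulr_ge0 ?upois_ge0// sumr_ge0// => x _; exact: mulr_ge0.
rewrite upois_mecke// -psumZ ?expR_ge0//; last by move=> k; rewrite !mulr_ge0// upois_ge0.
by apply: eq_psum => k; rewrite /pois; ring.
Qed.

(** The ratio recursion determines [Q] from its value at the empty configuration, and the total mass
    1 fixes that value. This is how an unknown marginal is recognised as Poisson. *)
Lemma pois_unique r (Q : fs I -> R) : (forall x, 0 <= r x) -> (psum r < +oo)%E ->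
  psum Q = 1%E -> (forall N x, Q (incr N x) * (N x).+1%:R = r x * Q N) -> Q =1 pois r.
Proof.
move=> r0 roo Q1 Qi.
have QE N : Q N = Q [fsfun] * upois r N.
  elim/fs_ind: N => [|N x ih].
    by rewrite /upois finsupp0 big_seq_fset0 mulr1.
  have s0 : (N x).+1%:R != 0 :> R by rewrite pnatr_eq0.
  by apply: (mulIf s0); rewrite Qi ih -mulrA upois_incr mulrCA.
have p1 := psum_pois r0 roo.
(* The sign of [Q] is not given: a negative value at the empty configuration would make all of [Q]
   nonpositive, against total mass 1. *)
have c0 : 0 <= Q [fsfun].
  rewrite leNgt; apply/negP => c0.
  suff : (psum Q <= 0)%E by rewrite Q1 lee_fin ler10.
  rewrite -(psum0 R (fs I)); apply: le_psum => N; rewrite QE mulr_le0_ge0 ?upois_ge0// ltW//.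
have : psum Q = (Q [fsfun] * expR (rsum r))%:E.
  rewrite (eq_psum QE) psumZ//; last by move=> N; exact: upois_ge0.
  by rewrite (upois_total r0 (psum_fin r0 roo)) rsum_ge0E.
rewrite Q1 => -[e] N; rewrite QE /pois expRN; congr (_ * _).
by rewrite -[RHS]mul1r e mulfK// gt_eqF// expR_gt0.
Qed.

End Poisson.

(** * The Mecke identity for a pair of configurations *)

Section Mecke.
Variable R : realType.
Implicit Types I J T U V Omega : choiceType.

(** Applies a family of identities in the presence of a spectator variable [t], fibre by fibre. *)
Lemma psum_subst T U V (c : T -> R) (f : T -> U -> R) (g : T -> V -> R) :
  (forall t, 0 <= c t) -> (forall t u, 0 <= f t u) -> (forall t v, 0 <= g t v) ->
  (forall t, psum (f t) = psum (g t)) ->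
  psum (fun k : T * U => c k.1 * f k.1 k.2) = psum (fun k : T * V => c k.1 * g k.1 k.2).
Proof.
move=> c0 f0 g0 fg.
rewrite (psum_pair (f := fun t u => c t * f t u)); last by move=> *; rewrite mulr_ge0.
rewrite (psum_pair (f := fun t u => c t * g t u)); last by move=> *; rewrite mulr_ge0.
by apply: eq_esum => t _; rewrite !psumZ// fg.
Qed.

Lemma psum_dirac T U (t0 : T) (f : T -> U -> R) : (forall t u, 0 <= f t u) ->
  psum (fun k : T * U => (k.1 == t0)%:R * f k.1 k.2) = psum (f t0).
Proof.
move=> f0.
rewrite psum_swap (psum_pair (f := fun u t => (t == t0)%:R * f t u)); last first.
  by move=> *; rewrite mulr_ge0.
apply: eq_esum => u _; rewrite (@psum_single _ _ t0); last 2 first.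
- by rewrite mulr_ge0.
- by move=> t /negbTE ->; rewrite mul0r.
by rewrite eqxx mul1r.
Qed.

(** Change of variables for the image of the law [w] under [psi], by exchanging the two
    summations. *)
Lemma psum_fibers T U (psi : T -> U) (w : T -> R) (F : U -> R) :
  (forall t, 0 <= w t) -> (forall u, 0 <= F u) -> (psum w < +oo)%E ->
  psum (fun u => rsum (fun t => w t * (psi t == u)%:R) * F u) = psum (fun t => w t * F (psi t)).
Proof.
move=> w0 F0 woo.
have h u : asummable (fun t => w t * (psi t == u)%:R).
  apply: le_asummable woo => t; rewrite ger0_norm ?mulr_ge0//.
  by rewrite ler_piMr// lern1 leq_b1.
transitivity (psum (fun k : U * T => w k.2 * (psi k.2 == k.1)%:R * F k.1)).
  rewrite (psum_pair (f := fun u t => w t * (psi t == u)%:R * F u)); last first.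
    by move=> *; rewrite !mulr_ge0.
  apply: eq_esum => u _.
  rewrite (eq_psum (g := fun t => F u * (w t * (psi t == u)%:R))); last by move=> t; rewrite mulrC.
  have h0 t : 0 <= w t * (psi t == u)%:R by rewrite mulr_ge0.
  by rewrite psumZ// -rsum_psum// -EFinM mulrC.
rewrite psum_swap (psum_pair (f := fun t u => w t * (psi t == u)%:R * F u)); last first.
  by move=> *; rewrite !mulr_ge0.
apply: eq_esum => t _; rewrite (@psum_single _ _ (psi t)).
- by rewrite eqxx mulr1.
- by rewrite !mulr_ge0.
- by move=> u; rewrite eq_sym => /negbTE ->; rewrite mulr0 mul0r.
Qed.

(* The Mecke identity for a pair of correlated point configurations: a point of
   [n1] is either unmatched, with intensity [a], or matched by [j : J], with
   intensity [q], in which case it has type [f1 j] and comes with a point of type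
   [f2 j] of [n2]. A single configuration is the case [n1 = n2], [f1 = f2], [a = 0]. *)
Definition mecke I J Omega (P : Omega -> R) (n1 n2 : Omega -> fs I)
    (a : I -> R) (f1 f2 : J -> I) (q : J -> R) := forall Phi : I -> fs I -> fs I -> R,
  (forall x N N', 0 <= Phi x N N') ->
  (psum (fun o => (P o * \sum_(x <- finsupp (n1 o)) (n1 o x)%:R * Phi x (decr (n1 o) x) (n2 o))%R) =
   psum (fun k : I * Omega => (a k.1 * P k.2 * Phi k.1 (n1 k.2) (n2 k.2))%R) +
   psum (fun k : J * Omega =>
         (q k.1 * P k.2 * Phi (f1 k.1) (n1 k.2) (incr (n2 k.2) (f2 k.1)))%R))%E.

Lemma mecke_pois I (r : I -> R) : (forall x, 0 <= r x) ->
  mecke (pois r) id id (fun=> 0) id id r.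
Proof.
move=> r0 Phi Phi0; rewrite pois_mecke// (eq_psum (f := fun k => 0 * _ * _) (g := fun=> 0)); last first.
  by move=> k; rewrite !mul0r.
by rewrite psum0 add0e.
Qed.

(** Testing the Mecke identity on the indicator of [y = x] and [M = N] turns it into the ratio
    recursion of [pois_unique] for the law of [n1]. The rate [r] collects the unmatched points and
    the matched ones. *)
Lemma mecke_marg I J Omega (P : Omega -> R) (n1 n2 : Omega -> fs I) a (f1 f2 : J -> I) q (r : I -> R) :
  (forall o, 0 <= P o) -> psum P = 1%E -> (forall x, 0 <= a x) -> (forall k, 0 <= q k) ->
  (psum r < +oo)%E ->
  (forall x, (r x)%:E = (a x)%:E + psum (fun j => (q j * (f1 j == x)%:R)%R))%E ->
  mecke P n1 n2 a f1 f2 q ->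
  forall N, rsum (fun o => P o * (n1 o == N)%:R) = pois r N.
Proof.
move=> P0 P1 a0 q0 roo rE mk.
have r0 x : 0 <= r x.
  by rewrite -lee_fin rE adde_ge0 ?lee_fin// psum_ge0// => j; rewrite mulr_ge0.
have Psm N : asummable (fun o => P o * (n1 o == N)%:R).
  apply: (le_asummable (g := P)); last by rewrite P1 ltry.
  by move=> o; rewrite ger0_norm ?mulr_ge0// ler_piMr// lern1 leq_b1.
have PQ0 N : forall o, 0 <= P o * (n1 o == N)%:R by move=> o; rewrite mulr_ge0.
apply: pois_unique => // [|N x].
  rewrite (eq_psum (g := fun N => rsum (fun o => P o * (n1 o == N)%:R) * 1)).
    rewrite (psum_fibers n1 (F := fun=> 1))// ?P1 ?ltry// -P1.
    by apply: eq_psum => o; rewrite mulr1.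
  by move=> N; rewrite mulr1.
have := mk (fun y M _ => (y == x)%:R * (M == N)%:R).
move=> /(_ _)/wrap[]; first by move=> *; rewrite mulr_ge0.
(* Only the letter [x] survives in the inner sum, and removing it leaves [N] exactly when [n1 o] is
   [incr N x], which has [N x + 1] points at [x]. *)
rewrite (eq_psum (g := fun o => (N x).+1%:R * (P o * (n1 o == incr N x)%:R))); last first.
  move=> o; rewrite mulrCA; congr (_ * _).
  transitivity ((n1 o x)%:R * ((0 < n1 o x)%N && (decr (n1 o) x == N))%:R : R).
    have [xN|] := boolP (x \in finsupp (n1 o)).
      rewrite (big_fsetD1 _ xN)/= eqxx mul1r big1_fset ?addr0.
        by rewrite lt0n -mem_finsupp xN.
      by move=> y; rewrite !inE => /andP[/negbTE -> _] _; rewrite mul0r mulr0.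
    move=> xN; rewrite big_seq big1.
      by move: xN; rewrite fs_eq0 => /eqP ->; rewrite mul0r.
    move=> y yN; case: eqP => [e|_]; last by rewrite mul0r mulr0.
    by rewrite -e yN in xN.
  have [->|ne] := eqVneq (n1 o) (incr N x).
    by rewrite incrE eqxx addn1 incrK eqxx.
  rewrite mulr0; case: ltnP => /= [n0|_]; last by rewrite mulr0.
  case: eqP => [e|]; last by rewrite mulr0.
  by case/eqP: ne; rewrite -e decrK.
rewrite psumZ// -(rsum_psum (PQ0 _) (Psm _)).
pose G o := P o * (n1 o == N)%:R.
rewrite (eq_psum (f := fun k : I * Omega => _) (g := fun k => (k.1 == x)%:R * (a k.1 * G k.2))); last first.
  by move=> k; rewrite /G; ring.
rewrite (psum_dirac x (f := fun y o => a y * G o)); last by move=> *; rewrite mulr_ge0// PQ0.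
rewrite psumZ//; last exact: PQ0.
rewrite (eq_psum (f := fun k : J * Omega => _) (g := fun k => (q k.1 * (f1 k.1 == x)%:R) * G k.2)); last first.
  by move=> k; rewrite /G; ring.
rewrite (psum_prod (f := fun j => q j * (f1 j == x)%:R) (g := G)); last 3 first.
- by move=> k; rewrite mulr_ge0.
- exact: PQ0.
- by rewrite -(rsum_psum (PQ0 _) (Psm _)) ltry.
rewrite -(rsum_psum (PQ0 _) (Psm _)) -ge0_muleDl ?lee_fin//; last first.
  by apply: psum_ge0 => j; rewrite mulr_ge0.
rewrite -rE -!EFinM mulrC => -[]//.
Qed.

End Mecke.

Section CorrLevel.
Variables (R : realType) (I : choiceType).

Lemma addfs_decrl (D P : fs I) x : (0 < D x)%N -> decr (addfs D P) x = addfs (decr D x) P.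
Proof. by move=> Dx; rewrite -{1}(decrK Dx) addfs_incrl incrK. Qed.

Lemma addfs_decr_push (J : choiceType) (phi : J -> I) (D : fs I) (M : fs J) j : (0 < M j)%N ->
  decr (addfs D (push phi M)) (phi j) = addfs D (push phi (decr M j)).
Proof. by move=> Mj; rewrite -{1}(decrK Mj) push_incr addfs_incrr incrK. Qed.

Lemma sum_addfs_push (J : choiceType) (phi : J -> I) (D : fs I) (M : fs J) (g : I -> R) :
  let N := addfs D (push phi M) in
  \sum_(x <- finsupp N) (N x)%:R * g x =
  \sum_(x <- finsupp D) (D x)%:R * g x + \sum_(j <- finsupp M) (M j)%:R * g (phi j).
Proof.
move=> N.
have e (L : fs I) (A : {fset I}) : \sum_(x <- A) (L x)%:R * g x = \sum_(x <- A) g x *+ L x.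
  by apply: eq_bigr => x _; rewrite mulr_natl.
pose C := (finsupp N `|` finsupp D `|` finsupp (push phi M))%fset.
rewrite !e (@big_finsupp _ _ _ _ N C)/=; last 2 first.
- by rewrite /C -fsetUA fsubsetUl.
- by move=> x ->; rewrite mulr0n.
rewrite (@big_finsupp _ _ _ _ D C)/=; last 2 first.
- by rewrite /C fsubsetU// fsubsetUr.
- by move=> x ->; rewrite mulr0n.
under eq_bigr do rewrite addfsE mulrnDr.
rewrite big_split/= (@sum_push _ _ _ phi M g C); last by rewrite /C fsubsetUr.
by congr (_ + _); apply: eq_bigr => j _; rewrite mulr_natl.
Qed.

Variable J : choiceType.
Variables (a : I -> R) (q : J -> R).
Hypotheses (a0 : forall x, 0 <= a x) (aoo : (psum a < +oo)%E).
Hypotheses (q0 : forall j, 0 <= q j) (qoo : (psum q < +oo)%E).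

Let K : choiceType := (fs J * (fs I * fs I))%type.
(** Joint law of the matching matrix [k.1] and of the unmatched children [k.2.1], [k.2.2] of the two
    roots. *)
Definition wt (k : K) : R := pois q k.1 * (pois a k.2.1 * pois a k.2.2).

Lemma wt_ge0 k : 0 <= wt k.
Proof. by rewrite mulr_ge0 ?pois_ge0// mulr_ge0 ?pois_ge0. Qed.

Lemma psum_wt : psum wt = 1%E.
Proof.
have ea := psum_pois a0 aoo; have eq_ := psum_pois q0 qoo.
have e2 : psum (fun k : fs I * fs I => pois a k.1 * pois a k.2) = 1%E.
  rewrite (psum_prod (f := pois a) (g := pois a)) ?ea ?mule1 ?ltry// => x; exact: pois_ge0.
rewrite /wt (psum_prod (f := pois q) (g := fun k : fs I * fs I => pois a k.1 * pois a k.2)).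
- by rewrite e2 eq_ mule1.
- by move=> x; exact: pois_ge0.
- by move=> x; rewrite mulr_ge0// pois_ge0.
- by rewrite e2 ltry.
Qed.

(** A point of the first configuration comes either from the unmatched part, and removing it does
    not affect the second one, or from the matching, and then both lose a point. Each case is
    [pois_mecke] for one Poisson family, the others being spectators. The maps [f1], [f2] stay
    arbitrary so that the two trees can be exchanged. *)
Lemma wt_mecke (f1 f2 : J -> I) (Phi : I -> fs I -> fs I -> R) :
  (forall x N N', 0 <= Phi x N N') ->
  let N1 (k : K) := addfs k.2.1 (push f1 k.1) in
  let N2 (k : K) := addfs k.2.2 (push f2 k.1) in
  (psum (fun k => (wt k * \sum_(x <- finsupp (N1 k)) (N1 k x)%:R * Phi x (decr (N1 k) x) (N2 k))%R) =
   psum (fun k : I * K => (a k.1 * wt k.2 * Phi k.1 (N1 k.2) (N2 k.2))%R) +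
   psum (fun k : J * K => (q k.1 * wt k.2 * Phi (f1 k.1) (N1 k.2) (incr (N2 k.2) (f2 k.1)))%R))%E.
Proof.
move=> P0 N1 N2.
pose A (k : K) := \sum_(x <- finsupp k.2.1) (k.2.1 x)%:R *
   Phi x (addfs (decr k.2.1 x) (push f1 k.1)) (N2 k).
pose B (k : K) := \sum_(j <- finsupp k.1) (k.1 j)%:R *
   Phi (f1 j) (addfs k.2.1 (push f1 (decr k.1 j))) (N2 k).
have A0 k : 0 <= A k by rewrite sumr_ge0// => x _; rewrite mulr_ge0.
have B0 k : 0 <= B k by rewrite sumr_ge0// => x _; rewrite mulr_ge0.
rewrite (eq_psum (g := fun k => wt k * A k + wt k * B k)); last first.
  move=> k; rewrite -mulrDr; congr (_ * _).
  rewrite (sum_addfs_push f1 k.2.1 k.1 (fun x => Phi x (decr (N1 k) x) (N2 k))).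
  congr (_ + _); rewrite [LHS]big_seq [RHS]big_seq; apply: eq_bigr => x; rewrite mem_finsupp -lt0n => xN.
    by rewrite /N1 addfs_decrl.
  by rewrite /N1 addfs_decr_push.
rewrite psumD; last 2 first.
- by move=> k; rewrite mulr_ge0// wt_ge0.
- by move=> k; rewrite mulr_ge0// wt_ge0.
congr (_ + _)%E.
- pose T : choiceType := (fs J * fs I)%type.
  pose c (t : T) := pois q t.1 * pois a t.2.
  have c0 t : 0 <= c t by rewrite mulr_ge0 ?pois_ge0.
  pose Ph (t : T) x N (N' : fs I) := Phi x (addfs N (push f1 t.1)) (addfs t.2 (push f2 t.1)).
  rewrite (psum_bij _ (e := fun k : T * fs I => (k.1.1, (k.2, k.1.2)))); last first.
    by exists (fun k : K => (k.1, k.2.2, k.2.1)) => [[[]]|[? []]].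
  rewrite [RHS](psum_bij _ (e := fun k : T * (I * fs I) => (k.2.1, (k.1.1, (k.2.2, k.1.2))))); last first.
    by exists (fun k : I * K => (k.2.1, k.2.2.2, (k.1, k.2.2.1))) => [[[? ?] []]|[? [? []]]].
  transitivity (psum (fun k : T * fs I => c k.1 * (pois a k.2 *
     \sum_(x <- finsupp k.2) (k.2 x)%:R * Ph k.1 x (decr k.2 x) k.2))).
    apply: eq_psum => k; rewrite [RHS]mulrA; congr (_ * _); rewrite /wt /c /=; ring.
  rewrite (psum_subst (f := fun t N => pois a N * \sum_(x <- finsupp N) (N x)%:R * Ph t x (decr N x) N)
    (g := fun t k => a k.1 * pois a k.2 * Ph t k.1 k.2 (incr k.2 k.1)))//.
  + by apply: eq_psum => k; rewrite /wt /c /Ph /N1 /N2 /=; ring.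
  + by move=> t N; rewrite mulr_ge0 ?pois_ge0// sumr_ge0// => x _; rewrite mulr_ge0// P0.
  + by move=> t N; rewrite mulr_ge0 ?P0// mulr_ge0 ?pois_ge0.
  + by move=> t; apply: pois_mecke => // *; exact: P0.
- pose T : choiceType := (fs I * fs I)%type.
  pose c (t : T) := pois a t.1 * pois a t.2.
  have c0 t : 0 <= c t by rewrite mulr_ge0 ?pois_ge0.
  pose Ph (t : T) j M (M' : fs J) := Phi (f1 j) (addfs t.1 (push f1 M)) (addfs t.2 (push f2 M')).
  rewrite (psum_bij _ (e := fun k : T * fs J => (k.2, k.1))); last first.
    by exists (fun k : K => (k.2, k.1)) => [[]|[]].
  rewrite [RHS](psum_bij _ (e := fun k : T * (J * fs J) => (k.2.1, (k.2.2, k.1)))); last first.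
    by exists (fun k : J * K => (k.2.2, (k.1, k.2.1))) => [[? []]|[? []]].
  transitivity (psum (fun k : T * fs J => c k.1 * (pois q k.2 *
     \sum_(x <- finsupp k.2) (k.2 x)%:R * Ph k.1 x (decr k.2 x) k.2))).
    apply: eq_psum => k; rewrite [RHS]mulrA; congr (_ * _); rewrite /wt /c /=; ring.
  rewrite (psum_subst (f := fun t N => pois q N * \sum_(x <- finsupp N) (N x)%:R * Ph t x (decr N x) N)
    (g := fun t k => q k.1 * pois q k.2 * Ph t k.1 k.2 (incr k.2 k.1)))//.
  + apply: eq_psum => k; rewrite /wt /c /Ph /N1 /N2 /= push_incr addfs_incrr; ring.
  + by move=> t N; rewrite mulr_ge0 ?pois_ge0// sumr_ge0// => x _; rewrite mulr_ge0// P0.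
  + by move=> t N; rewrite mulr_ge0 ?P0// mulr_ge0 ?pois_ge0.
  + by move=> t; apply: pois_mecke => // *; exact: P0.
Qed.

End CorrLevel.

Section CorrPmf.
Variables (R : realType) (I : choiceType).
Variables (a : I -> R) (q : I * I -> R).
Hypotheses (a0 : forall x, 0 <= a x) (aoo : (psum a < +oo)%E).
Hypotheses (q0 : forall j, 0 <= q j) (qoo : (psum q < +oo)%E).

Let K : choiceType := (fs (I * I)%type * (fs I * fs I))%type.
Definition cN1 (k : K) := addfs k.2.1 (push fst k.1).
Definition cN2 (k : K) := addfs k.2.2 (push snd k.1).
(** Defined as an image law over all triples, for which Mecke's identity is direct; [corrE] reduces
    it to the sum over admissible matrices. *)
Definition cpmf (t : fs I * fs I) : R := rsum (fun k => wt a q k * ((cN1 k, cN2 k) == t)%:R).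

Lemma cpmf_ge0 t : 0 <= cpmf t.
Proof. by apply: rsum_ge0 => k; rewrite mulr_ge0// wt_ge0. Qed.

Lemma psum_cpmfM (F : fs I * fs I -> R) : (forall t, 0 <= F t) ->
  psum (fun t => cpmf t * F t) = psum (fun k => wt a q k * F (cN1 k, cN2 k)).
Proof.
move=> F0; apply: (psum_fibers (fun k => (cN1 k, cN2 k))) => //; first exact: wt_ge0.
by rewrite psum_wt// ltry.
Qed.

Lemma psum_cpmf : psum cpmf = 1%E.
Proof.
rewrite (eq_psum (g := fun t => cpmf t * 1)); last by move=> t; rewrite mulr1.
by rewrite psum_cpmfM// -(psum_wt a0 aoo q0 qoo); apply: eq_psum => k; rewrite mulr1.
Qed.

Lemma psum_cpmfM2 (T : choiceType) (c : T -> R) (F : T -> fs I * fs I -> R) : (forall x, 0 <= c x) ->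
  (forall x t, 0 <= F x t) ->
  psum (fun k : T * (fs I * fs I) => c k.1 * cpmf k.2 * F k.1 k.2) =
  psum (fun k : T * K => c k.1 * wt a q k.2 * F k.1 (cN1 k.2, cN2 k.2)).
Proof.
move=> c0 F0.
transitivity (psum (fun k : T * (fs I * fs I) => c k.1 * (cpmf k.2 * F k.1 k.2))).
  by apply: eq_psum => k; rewrite mulrA.
rewrite (psum_subst (f := fun x t => cpmf t * F x t)
   (g := fun x k => wt a q k * F x (cN1 k, cN2 k)))//.
- by apply: eq_psum => k; rewrite mulrA.
- by move=> *; rewrite mulr_ge0// cpmf_ge0.
- by move=> *; rewrite mulr_ge0// wt_ge0.
- by move=> x; exact: psum_cpmfM.
Qed.

Lemma cpmf_mecke1 : mecke cpmf fst snd a fst snd q.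
Proof.
move=> Phi P0.
rewrite (psum_cpmfM (F := fun t => \sum_(x <- finsupp t.1) (t.1 x)%:R * Phi x (decr t.1 x) t.2)); last first.
  by move=> t; rewrite sumr_ge0// => x _; rewrite mulr_ge0.
rewrite (psum_cpmfM2 (F := fun x t => Phi x t.1 t.2))//.
rewrite (psum_cpmfM2 (F := fun x t => Phi x.1 t.1 (incr t.2 x.2)))//.
exact: (wt_mecke a0 q0 fst snd).
Qed.

Lemma cpmf_mecke2 : mecke cpmf snd fst a snd fst q.
Proof.
move=> Phi P0.
rewrite (psum_cpmfM (F := fun t => \sum_(x <- finsupp t.2) (t.2 x)%:R * Phi x (decr t.2 x) t.1)); last first.
  by move=> t; rewrite sumr_ge0// => x _; rewrite mulr_ge0.
rewrite (psum_cpmfM2 (F := fun x t => Phi x t.2 t.1))//.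
rewrite (psum_cpmfM2 (F := fun x t => Phi x.2 t.2 (incr t.1 x.1)))//.
(* Exchanging the two unmatched parts preserves [wt] and turns this identity into [wt_mecke] with
   [fst] and [snd] exchanged. *)
pose sw (k : K) : K := (k.1, (k.2.2, k.2.1)).
have swE k : wt a q (sw k) = wt a q k by rewrite /wt /=; ring.
have bsw : bijective sw by exists sw => -[? []].
rewrite (psum_bij _ bsw).
rewrite [X in (X + _)%E](psum_bij _ (e := fun k => (k.1, sw k.2))); last first.
  by exists (fun k => (k.1, sw k.2)) => -[? [? []]].
rewrite [X in (_ + X)%E](psum_bij _ (e := fun k => (k.1, sw k.2))); last first.
  by exists (fun k => (k.1, sw k.2)) => -[? [? []]].
have := wt_mecke a0 q0 snd fst P0; rewrite /=.
rewrite (eq_psum (f := fun k => wt a q k * _) (g := (fun k => wt a q k *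
  (\sum_(x <- finsupp (cN1 k, cN2 k).2) ((cN1 k, cN2 k).2 x)%:R *
    Phi x (decr (cN1 k, cN2 k).2 x) (cN1 k, cN2 k).1)) \o sw)); last first.
  by move=> k /=; rewrite swE.
move=> ->; congr (_ + _)%E; by apply: eq_psum => -[x k] /=; rewrite swE.
Qed.

End CorrPmf.

(** * Real-valued versions of the two laws, their marginals and their agreement with the models *)

Section Models.
Variable R : realType.
Variables (lam s : R).

Fixpoint gw (d : nat) : X d -> R :=
  match d return X d -> R with
  | 0 => fun _ => 1
  | d'.+1 => pois (fun tau => lam * gw tau)
  end.

Fixpoint cm (d : nat) : X d * X d -> R :=
  match d return X d * X d -> R with
  | 0 => fun _ => 1
  | d'.+1 => cpmf (fun tau => lam * (1 - s) * gw tau) (fun k => lam * s * @cm d' k)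
  end.

(** [A] has only to contain the support of [N]: for the unmatched children, the product runs over
    the support of the whole tree, where the difference may vanish. *)
Lemma indep_poissonE (I : choiceType) (r : I -> R) (A : {fset I}) (N : I -> nat) (N' : fs I) :
  (forall x, 0 <= r x) -> (psum r < +oo)%E ->
  (forall x, x \notin A -> N x = 0%N) -> (forall x, N' x = N x) ->
  indep_poisson_pmf (fun x => (r x)%:E) A N = (pois r N')%:E.
Proof.
move=> r0 roo NA NN'; rewrite /indep_poisson_pmf -/(psum r) (psum_fin r0 roo) -EFinN /=.
rewrite /pois rsum_ge0E// EFinM; congr (_ * _)%E.
rewrite (@upois_sub _ _ _ _ A); last first.
  apply/fsubsetP => x; rewrite mem_finsupp NN'; apply: contra_neqT; exact: NA.
rewrite -prodEFin; apply: eq_bigr => x _; rewrite EFinM EFin_expe NN' //.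
Qed.

Hypothesis lam0 : 0 < lam.

Lemma gw_facts d : (forall t : X d, 0 <= gw t) /\ psum (@gw d) = 1%E.
Proof.
elim: d => [|d [g0 g1]].
  split => //=; rewrite (@psum_single _ _ tt)//; by case.
have r0 t : 0 <= lam * @gw d t by rewrite mulr_ge0// ltW.
split; first by move=> t; exact: pois_ge0.
by apply: psum_pois => //; rewrite psumZ ?ltW// g1 mule1 ltry.
Qed.

Lemma gw_ge0 d (t : X d) : 0 <= gw t. Proof. by have [] := gw_facts d. Qed.
Lemma psum_gw d : psum (@gw d) = 1%E. Proof. by have [] := gw_facts d. Qed.

Lemma psum_rate (c : R) d : 0 <= c -> psum (fun t : X d => c * gw t) = c%:E.
Proof. by move=> c0; rewrite psumZ// ?psum_gw ?mule1// => t; exact: gw_ge0. Qed.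

Lemma gwE d (t : X d) : GW lam d t = (gw t)%:E.
Proof.
elim: d t => [//|d ih] t /=.
rewrite (_ : (fun tau => _) = fun tau => (lam * gw tau)%:E); last first.
  by apply/funext => tau; rewrite ih.
apply: indep_poissonE => //.
- by move=> x; rewrite mulr_ge0 ?gw_ge0// ltW.
- by rewrite psum_rate ?ltry// ltW.
- by move=> x; exact: fsfun_dflt.
Qed.

Lemma gw_mecke d : mecke (@gw d.+1) id id (fun=> 0) id id (fun x => lam * gw x).
Proof. by apply: mecke_pois => x; rewrite mulr_ge0 ?gw_ge0// ltW. Qed.

Hypotheses (s0 : 0 <= s) (s1 : s <= 1).

Lemma psum_delta1 (T U : choiceType) (P : T * U -> R) x : (forall k, 0 <= P k) ->
  psum (fun k => P k * (k.1 == x)%:R) = psum (fun y => P (x, y)).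
Proof.
move=> P0; rewrite (eq_psum (g := fun k => (k.1 == x)%:R * P (k.1, k.2))).
  exact: (psum_dirac x (f := fun x y => P (x, y))).
by case=> u v /=; rewrite mulrC.
Qed.

Lemma psum_delta2 (T U : choiceType) (P : T * U -> R) y : (forall k, 0 <= P k) ->
  psum (fun k => P k * (k.2 == y)%:R) = psum (fun x => P (x, y)).
Proof. by move=> P0; rewrite psum_swap (psum_delta1 (P := fun k => P (k.2, k.1))). Qed.

Lemma rsum_delta1 (T U : choiceType) (P : T * U -> R) x : (forall k, 0 <= P k) ->
  (psum P < +oo)%E -> (rsum (fun k => P k * (k.1 == x)%:R))%:E = psum (fun y => P (x, y)).
Proof.
move=> P0 Poo; rewrite rsum_psum; last 2 first.
- by move=> k; rewrite mulr_ge0.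
- apply: le_asummable Poo => k; rewrite ger0_norm ?mulr_ge0//.
  by rewrite ler_piMr// lern1 leq_b1.
exact: psum_delta1.
Qed.

Lemma rsum_delta2 (T U : choiceType) (P : T * U -> R) y : (forall k, 0 <= P k) ->
  (psum P < +oo)%E -> (rsum (fun k => P k * (k.2 == y)%:R))%:E = psum (fun x => P (x, y)).
Proof.
move=> P0 Poo; have := @rsum_delta1 _ _ (fun k => P (k.2, k.1)) y.
move=> <-//; last by rewrite -psum_swap.
rewrite (rsum_bij _ (e := fun k : U * T => (k.2, k.1)))//.
by exists (fun k => (k.2, k.1)) => -[].
Qed.

Let a d (t : X d) := lam * (1 - s) * gw t.
Let q d (k : X d * X d) := lam * s * cm k.

Lemma a_ge0 d (t : X d) : 0 <= a t.
Proof. by rewrite mulr_ge0 ?gw_ge0// mulr_ge0 ?subr_ge0// ltW. Qed.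

Lemma a_fin d : (psum (@a d) < +oo)%E.
Proof. by rewrite psum_rate ?ltry// mulr_ge0 ?subr_ge0// ltW. Qed.

(** One joint induction: with marginals [gw] at depth [d], the matched rate [lam * s * gw] and the
    unmatched rate [lam * (1 - s) * gw] add up to [lam * gw], so [mecke_marg] gives the marginals at
    depth [d+1]. *)
Lemma cm_facts d : [/\ forall k : X d * X d, 0 <= cm k, psum (@cm d) = 1%E,
  (forall x, psum (fun y => @cm d (x, y)) = (gw x)%:E) &
  (forall y, psum (fun x => @cm d (x, y)) = (gw y)%:E)].
Proof.
elim: d => [|d [c0 c1 m1 m2]].
  split => //=.
  - by rewrite (@psum_single _ _ (tt, tt))//; case=> -[] [].
  - by move=> x; rewrite (@psum_single _ _ tt)//; case.
  - by move=> x; rewrite (@psum_single _ _ tt)//; case.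
have ls0 : 0 <= lam * s by rewrite mulr_ge0// ltW.
have q0 (k : X d * X d) : 0 <= q k by rewrite mulr_ge0.
have qoo : (psum (@q d) < +oo)%E by rewrite psumZ// c1 mule1 ltry.
have C1 : psum (@cm d.+1) = 1%E by apply: psum_cpmf => //; [exact: a_ge0|exact: a_fin].
have C0 (k : X d.+1 * X d.+1) : 0 <= cm k by apply: cpmf_ge0 => //; exact: a_ge0.
have lg x : (lam * @gw d x)%:E = (a x + lam * s * gw x)%:E.
  by congr EFin; rewrite /a; ring.
split => //.
- move=> N; rewrite -rsum_delta1 ?C1 ?ltry//; congr EFin.
  apply: (mecke_marg (a := @a d) (q := @q d) (f1 := fst) (f2 := snd) (n2 := snd) (r := fun x => lam * @gw d x)) => //.
  + exact: a_ge0.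
  + by rewrite psum_rate ?ltry// ltW.
  + by move=> x; rewrite lg EFinD; congr (_ + _)%E; rewrite psum_delta1// /q psumZ// m1.
  + by apply: cpmf_mecke1 => //; [exact: a_ge0|exact: a_fin].
- move=> N; rewrite -rsum_delta2 ?C1 ?ltry//; congr EFin.
  apply: (mecke_marg (a := @a d) (q := @q d) (f1 := snd) (f2 := fst) (n2 := fst) (r := fun x => lam * @gw d x)) => //.
  + exact: a_ge0.
  + by rewrite psum_rate ?ltry// ltW.
  + by move=> x; rewrite lg EFinD; congr (_ + _)%E; rewrite psum_delta2// /q psumZ// m2.
  + by apply: cpmf_mecke2 => //; [exact: a_ge0|exact: a_fin].
Qed.

Lemma cm_ge0 d (k : X d * X d) : 0 <= cm k. Proof. by have [] := cm_facts d. Qed.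
Lemma psum_cm d : psum (@cm d) = 1%E. Proof. by have [] := cm_facts d. Qed.

Lemma psum_cm_fst d (f : X d -> R) : (forall t, 0 <= f t) ->
  psum (fun k => cm k * f k.1) = psum (fun t => gw t * f t).
Proof.
move=> f0; have [c0 c1 m1 m2] := cm_facts d.
rewrite (eq_psum (g := fun k => f k.1 * cm (k.1, k.2))); last by case=> x y /=; rewrite mulrC.
rewrite (psum_pair (f := fun x y => f x * cm (x, y))); last by move=> *; rewrite mulr_ge0.
by apply: eq_esum => x _; rewrite psumZ// m1 -EFinM mulrC.
Qed.

Lemma psum_cm_snd d (f : X d -> R) : (forall t, 0 <= f t) ->
  psum (fun k => cm k * f k.2) = psum (fun t => gw t * f t).
Proof.
move=> f0; have [c0 c1 m1 m2] := cm_facts d.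
rewrite psum_swap (psum_pair (f := fun y x => cm (x, y) * f y)); last by move=> *; rewrite mulr_ge0.
apply: eq_esum => x _; rewrite (eq_psum (g := fun y => f x * cm (y, x))); last by move=> y; rewrite mulrC.
by rewrite psumZ// m2 -EFinM mulrC.
Qed.

Lemma cm_mecke1 d : mecke (@cm d.+1) fst snd (fun t => lam * (1 - s) * gw t) fst snd (fun k => lam * s * cm k).
Proof.
apply: cpmf_mecke1; [exact: a_ge0|exact: a_fin| |].
- by move=> k; rewrite !mulr_ge0 ?cm_ge0// ltW.
- rewrite psumZ ?psum_cm ?mule1 ?ltry// ?mulr_ge0// ?ltW// => k; exact: cm_ge0.
Qed.

(** In the fibre over [(t, t')] the unmatched parts are determined by the matrix [M], and they exist
    exactly when the row and column sums of [M] are bounded by [t] and [t']; this makes the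
    truncated subtractions exact. *)
Lemma corrE d (k : X d * X d) : corr_model lam s d k = (cm k)%:E.
Proof.
elim: d k => [//|d ih] -[t t'] /=.
have ls0 : 0 <= lam * s by rewrite mulr_ge0// ltW.
have q0 (k : X d * X d) : 0 <= q k by rewrite mulr_ge0 ?cm_ge0.
have qoo : (psum (@q d) < +oo)%E.
  by rewrite psumZ ?psum_cm ?mule1 ?ltry// => k; exact: cm_ge0.
have w0 := wt_ge0 (@a_ge0 d) q0.
have wd0 k b : 0 <= wt (@a d) (@q d) k * (b : bool)%:R.
  by apply: mulr_ge0 => //; exact: w0.
rewrite /cpmf rsum_psum; last 2 first.
- by move=> k; exact: wd0.
- apply: (le_asummable (g := wt (@a d) (@q d))); last by rewrite psum_wt ?ltry//; [exact: a_ge0|exact: a_fin].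
  move=> k; rewrite ger0_norm; last exact: wd0.
  by rewrite ler_piMr ?w0// lern1 leq_b1.
transitivity (\esum_(k in [set k | (cN1 k, cN2 k) = (t, t')]) (wt (@a d) (@q d) k)%:E); last first.
  rewrite esum_mkcond; apply: eq_esum => k _; case: ifPn => [|].
    by rewrite inE /= => ->; rewrite eqxx mulr1.
  by rewrite notin_setE /= => /eqP/negbTE ->; rewrite mulr0.
rewrite [RHS](reindex_esum
  [set M : fs (X d * X d)%type | (forall x, (rowsum M x <= t x)%N) /\ (forall x, (colsum M x <= t' x)%N)]
  _ (fun M => (M, (subfs t (push fst M), subfs t' (push snd M))))).
  apply: eq_esum => M _.
  have ea (t0 : fs (X d)) (P : fs (X d)) : indep_poisson_pmf
      (fun tau => (lam * (1 - s))%:E * GW lam d tau)%E (finsupp t0)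
      (fun tau => (t0 tau - P tau)%N) = (pois (@a d) (subfs t0 P))%:E.
    rewrite (_ : (fun tau => _) = fun x => (@a d x)%:E); last first.
      by apply/funext => x; rewrite gwE.
    apply: indep_poissonE; [exact: a_ge0|exact: a_fin| |].
      by move=> x; rewrite fs_eq0 => /eqP ->; rewrite sub0n.
    by move=> x; rewrite subfsE.
  have eM : indep_poisson_pmf (fun q => (lam * s)%:E * corr_model lam s d q)%E
      (finsupp M) M = (pois (@q d) M)%:E.
    rewrite (_ : (fun q => _) = fun k => (@q d k)%:E); last by apply/funext => k; rewrite ih.
    by apply: indep_poissonE => // x; exact: fsfun_dflt.
  rewrite eM.
  rewrite (_ : (fun tau => t tau - rowsum M tau)%N = fun x => (t x - push fst M x)%N); last first.
    by apply/funext => x; rewrite pushE.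
  rewrite (_ : (fun tau => t' tau - colsum M tau)%N = fun x => (t' x - push snd M x)%N); last first.
    by apply/funext => x; rewrite pushE.
  by rewrite !ea -!EFinM /wt /= mulrA.
split.
- move=> M /= [h1 h2]; congr pair; apply/fsfunP => x; rewrite addfsE subfsE subnK// pushE.
    exact: h1.
  exact: h2.
- by move=> M M' _ _ [].
- move=> [M [D D']] /= [e1 e2]; exists M.
    by split => x; rewrite -?e1 -?e2 addfsE pushE leq_addl.
  congr (_, (_, _)); apply/fsfunP => x; rewrite subfsE -?e1 -?e2 addfsE addnK//.
Qed.

End Models.

(** A [Prop]-valued [all], for words whose letters are functions and for properties such as
    [tame]. *)
Fixpoint Pall (T : Type) (Q : T -> Prop) (r : seq T) : Prop :=
  if r is x :: r' then Q x /\ Pall Q r' else True.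

(** * Poisson chaoses *)

Section ChaosAlgebra.
Variables (R : realType) (I : choiceType).
Variables (lam : R) (pi : I -> R).

Definition mean (h : I -> R) : R := rsum (fun x => pi x * h x).
(* The creation operator: the Mecke-compensated sum of [h] over the points. *)
Definition creat (h : I -> R) (F : fs I -> R) (N : fs I) : R :=
  (\sum_(x <- finsupp N) (N x)%:R * (h x * F (decr N x)) - lam * mean h * F N) / Num.sqrt lam.
(** The multiple compensated Poisson integral of the tensor product of the letters, scaled by
    [lam^(-1/2)] for each letter. *)
Fixpoint wick (w : seq (I -> R)) : fs I -> R :=
  if w is h :: w' then creat h (wick w') else fun=> 1.

(** All ways of taking one letter out of a word: the index set of the Leibniz rule for the
    annihilation operator. *)
Fixpoint splits (T : Type) (w : seq T) : seq (T * seq T) :=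
  if w is a :: w' then (a, w') :: [seq (p.1, a :: p.2) | p <- splits w'] else [::].

Lemma lin_incr (N : fs I) x (g : I -> R) :
  \sum_(y <- finsupp (incr N x)) (incr N x y)%:R * g y =
  \sum_(y <- finsupp N) (N y)%:R * g y + g x.
Proof.
have e (M : fs I) : \sum_(y <- finsupp M) (M y)%:R * g y = \sum_(y <- finsupp M) g y *+ M y.
  by apply: eq_bigr => y _; rewrite mulr_natl.
by rewrite !e sum_incr.
Qed.

Let sg := Num.sqrt lam.

(** Adding a point acts on chaoses as annihilation. In the induction, the term of the first letter
    arises when the creation operator picks the new point itself; the other terms come from
    commuting the increment with that operator. *)
Lemma wick_incr w N x :
  wick w (incr N x) = wick w N + sg^-1 * \sum_(p <- splits w) p.1 x * wick p.2 N.
Proof.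
elim: w N => [|h w ih] N /=; first by rewrite big_nil mulr0 addr0.
rewrite /creat -/sg (lin_incr N x (fun y => h y * wick w (decr (incr N x) y))) incrK ih.
rewrite big_seq.
under eq_bigr => y yN.
  rewrite incr_decr; last by rewrite lt0n -mem_finsupp.
  rewrite ih [h y * _]mulrDr mulrDr.
  over.
rewrite -big_seq big_split/= big_cons big_map /=.
under [X in _ = _ + _ * (_ + X)]eq_bigr do rewrite /creat -/sg mulrA mulrBr mulrBl.
rewrite big_split/= sumrN.
set A := \sum_(x0 <- finsupp N) _; set B := \sum_(x0 <- finsupp N) _; set C := \sum_(p <- splits w) _.
rewrite (_ : B = sg^-1 * \sum_(p <- splits w) p.1 x * \sum_(y <- finsupp N) (N y)%:R * (h y * wick p.2 (decr N y))); last first.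
  rewrite /B mulr_sumr.
  under [RHS]eq_bigr do rewrite mulr_sumr mulr_sumr.
  rewrite exchange_big/=; apply: eq_bigr => y _; rewrite !mulr_sumr.
  by apply: eq_bigr => p _; ring.
rewrite -mulr_suml.
rewrite (_ : \sum_(i <- splits w) i.1 x * (lam * mean h * wick i.2 N) / sg = lam * mean h / sg * C); last first.
  by rewrite /C mulr_sumr; apply: eq_bigr => p _; ring.
ring.
Qed.

Lemma wick1E h N : wick [:: h] N = (\sum_(x <- finsupp N) (N x)%:R * h x - lam * mean h) / sg.
Proof.
rewrite /= /creat mulr1; congr ((_ - _) / _).
by apply: eq_bigr => x _; rewrite mulr1.
Qed.

Hypothesis lam0 : 0 < lam.

Lemma sg_gt0 : 0 < sg. Proof. by rewrite sqrtr_gt0. Qed.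
Lemma sg_neq0 : sg != 0. Proof. by rewrite gt_eqF// sg_gt0. Qed.
Lemma sg_sqr : sg * sg = lam. Proof. by rewrite -expr2 sqr_sqrtr// ltW. Qed.

(* Expresses the product [wick [:: h] * wick w] through chaoses, the collisions
   of the new point with the points of [w] producing the correction terms. *)
Lemma wick_cons h w N :
  wick (h :: w) N = wick [:: h] N * wick w N - sg^-1 * \sum_(p <- splits w)
    (wick ((fun x => h x * p.1 x) :: p.2) N + sg * mean (fun x => h x * p.1 x) * wick p.2 N).
Proof.
rewrite wick1E [LHS]/= /creat -/sg.
have -> : \sum_(x <- finsupp N) (N x)%:R * (h x * wick w (decr N x)) =
    (\sum_(x <- finsupp N) (N x)%:R * h x) * wick w N -
    \sum_(p <- splits w) sg^-1 * \sum_(x <- finsupp N) (N x)%:R * (h x * p.1 x * wick p.2 (decr N x)).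
  rewrite mulr_suml; under [X in _ - X]eq_bigr do rewrite mulr_sumr.
  rewrite exchange_big/= -sumrB big_seq [RHS]big_seq; apply: eq_bigr => x xN.
  have := wick_incr w (decr N x) x; rewrite decrK; last by rewrite lt0n -mem_finsupp.
  move=> ->; set Z := \sum_(p <- splits w) p.1 x * _.
  rewrite (_ : \sum_(i <- splits w) _ = (N x)%:R * h x * (sg^-1 * Z)); first by ring.
  by rewrite !mulr_sumr; apply: eq_bigr => p _; ring.
have -> : \sum_(p <- splits w) (wick ((fun x => h x * p.1 x) :: p.2) N +
      sg * mean (fun x => h x * p.1 x) * wick p.2 N) =
   \sum_(p <- splits w) sg^-1 * \sum_(x <- finsupp N) (N x)%:R * (h x * p.1 x * wick p.2 (decr N x)).
  apply: eq_bigr => p _; rewrite /= /creat -/sg -{1}sg_sqr.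
  by have := sg_neq0; move: (\sum_(_ <- _) _) (mean _) => a b s0; field.
by ring.
Qed.

(** The product formula for two first chaoses: orders 2, 1 and 0, the last two coming from both
    letters falling on the same point. *)
Lemma wick_pair_prod h g N : wick [:: h] N * wick [:: g] N =
  wick [:: h; g] N + sg^-1 * wick [:: fun x => h x * g x] N + mean (fun x => h x * g x).
Proof.
rewrite (wick_cons h [:: g]) big_cons big_nil /= -[creat h (fun=> 1) N]/(wick [:: h] N) -[creat g _ N]/(wick [:: g] N) -[creat _ (fun=> 1) N]/(wick [:: fun x => h x * g x] N).
by have := sg_neq0; move: (wick _ _) (wick _ _) (wick _ _) (mean _) => a b c e s0; field.
Qed.

Variables (Omega : choiceType) (P : Omega -> R) (n1 n2 : Omega -> fs I).
Variables (a : I -> R) (J : choiceType) (f1 f2 : J -> I) (q : J -> R).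
Hypotheses (P0 : forall o, 0 <= P o) (a0 : forall x, 0 <= a x) (q0 : forall k, 0 <= q k).
Hypothesis mk : mecke P n1 n2 a f1 f2 q.

(** Mecke's identity for signed [Phi], by applying it to the positive and negative parts; the two
    summability hypotheses exclude infinite differences. *)
Lemma mecke_rsum (Phi : I -> fs I -> fs I -> R) :
  asummable (fun k : I * Omega => a k.1 * P k.2 * Phi k.1 (n1 k.2) (n2 k.2)) ->
  asummable (fun k : J * Omega => q k.1 * P k.2 * Phi (f1 k.1) (n1 k.2) (incr (n2 k.2) (f2 k.1))) ->
  let F o := \sum_(x <- finsupp (n1 o)) (n1 o x)%:R * Phi x (decr (n1 o) x) (n2 o) in
  asummable (fun o => P o * F o) /\
  rsum (fun o => P o * F o) =
  rsum (fun k : I * Omega => a k.1 * P k.2 * Phi k.1 (n1 k.2) (n2 k.2)) +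
  rsum (fun k : J * Omega => q k.1 * P k.2 * Phi (f1 k.1) (n1 k.2) (incr (n2 k.2) (f2 k.1))).
Proof.
move=> s1 s2 F.
pose Pp x N N' := Num.max (Phi x N N') 0.
pose Pn x N N' := Num.max (- Phi x N N') 0.
have Pp0 x N N' : 0 <= Pp x N N' by rewrite le_max lexx orbT.
have Pn0 x N N' : 0 <= Pn x N N' by rewrite le_max lexx orbT.
have PB x N N' : Phi x N N' = Pp x N N' - Pn x N N'.
  by rewrite /Pp /Pn; case: (leP 0 (Phi x N N')) => h; [rewrite max_r|rewrite max_l]; lra.
have Ppl x N N' : Pp x N N' <= `|Phi x N N'| by rewrite ge_max ler_norm normr_ge0.
have Pnl x N N' : Pn x N N' <= `|Phi x N N'| by rewrite ge_max -normrN ler_norm normr_ge0.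
have fin (Q : I -> fs I -> fs I -> R) : (forall x N N', 0 <= Q x N N') ->
   (forall x N N', Q x N N' <= `|Phi x N N'|) ->
   (psum (fun k : I * Omega => (a k.1 * P k.2 * Q k.1 (n1 k.2) (n2 k.2))%R) < +oo)%E /\
   (psum (fun k : J * Omega =>
      (q k.1 * P k.2 * Q (f1 k.1) (n1 k.2) (incr (n2 k.2) (f2 k.1)))%R) < +oo)%E.
  move=> Q0 QP; split; [apply: le_lt_trans s1|apply: le_lt_trans s2]; apply: le_psum => k.
    by rewrite normrM ger0_norm ?mulr_ge0// ler_wpM2l// mulr_ge0.
  by rewrite normrM ger0_norm ?mulr_ge0// ler_wpM2l// mulr_ge0.
have [p1 p2] := fin _ Pp0 Ppl; have [m1 m2] := fin _ Pn0 Pnl.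
have mp := mk Pp0; have mn := mk Pn0.
pose Fp o := \sum_(x <- finsupp (n1 o)) (n1 o x)%:R * Pp x (decr (n1 o) x) (n2 o).
pose Fn o := \sum_(x <- finsupp (n1 o)) (n1 o x)%:R * Pn x (decr (n1 o) x) (n2 o).
have FB o : P o * F o = P o * Fp o - P o * Fn o.
  by rewrite -mulrBr -sumrB; congr (_ * _); apply: eq_bigr => x _; rewrite PB mulrBr.
have Fp0 o : 0 <= P o * Fp o by rewrite mulr_ge0// sumr_ge0// => x _; rewrite mulr_ge0.
have Fn0 o : 0 <= P o * Fn o by rewrite mulr_ge0// sumr_ge0// => x _; rewrite mulr_ge0.
have Fpoo : (psum (fun o => P o * Fp o)%R < +oo)%E by rewrite mp lte_add_pinfty.
have Fnoo : (psum (fun o => P o * Fn o)%R < +oo)%E by rewrite mn lte_add_pinfty.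
split.
  apply: (eq_asummable (f := fun o => P o * Fp o - P o * Fn o)) => [z|]; first by rewrite FB.
  by apply: asummableD; [|apply: asummableN]; rewrite asummable_ge0.
rewrite (rsum_eq Fp0 Fn0 Fpoo Fnoo FB) mp mn.
rewrite (rsum_eq _ _ p1 m1 (f := fun k => a k.1 * P k.2 * Phi k.1 (n1 k.2) (n2 k.2))); last 3 first.
- by move=> k; rewrite !mulr_ge0.
- by move=> k; rewrite !mulr_ge0.
- by move=> k; rewrite PB mulrBr.
rewrite (rsum_eq _ _ p2 m2 (f := fun k => q k.1 * P k.2 * Phi (f1 k.1) (n1 k.2) (incr (n2 k.2) (f2 k.1)))); last 3 first.
- by move=> k; rewrite !mulr_ge0.
- by move=> k; rewrite !mulr_ge0.
- by move=> k; rewrite PB mulrBr.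
rewrite !fineD ?ge0_fin_numE ?psum_ge0//; try by move=> k; rewrite !mulr_ge0.
by ring.
Qed.

Definition pairing (h g : I -> R) : R := lam^-1 * rsum (fun k => q k * (h (f1 k) * g (f2 k))).

(** Integration by parts. Mecke's identity frees the point carrying [h]; where [wick v] does not see
    it, the compensator cancels the term, since [a] and [q] together have the intensity of
    [lam * pi]. There remains the increment of [wick v] at the matched point, expanded by
    [wick_incr]. *)
Lemma wick_pairing h w v :
  asummable (fun x => a x * h x) -> asummable (fun k => q k * h (f1 k)) ->
  rsum (fun x => a x * h x) + rsum (fun k => q k * h (f1 k)) = lam * mean h ->
  asummable (fun o => P o * (wick w (n1 o) * wick v (n2 o))) ->
  Pall (fun p => asummable (fun k => q k * (h (f1 k) * p.1 (f2 k))) /\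
    asummable (fun o => P o * (wick w (n1 o) * wick p.2 (n2 o)))) (splits v) ->
  rsum (fun o => P o * (wick (h :: w) (n1 o) * wick v (n2 o))) =
  \sum_(p <- splits v) pairing h p.1 * rsum (fun o => P o * (wick w (n1 o) * wick p.2 (n2 o))).
Proof.
move=> sa sq saq sP sv.
pose Phi x N N' := h x * wick w N * wick v N'.
pose E0 o := P o * (wick w (n1 o) * wick v (n2 o)).
have e1 k : a k.1 * P k.2 * Phi k.1 (n1 k.2) (n2 k.2) = a k.1 * h k.1 * E0 k.2.
  by rewrite /E0 /Phi; ring.
pose Ep (p : (I -> R) * seq (I -> R)) o := P o * (wick w (n1 o) * wick p.2 (n2 o)).
pose qp (p : (I -> R) * seq (I -> R)) (k : J) := q k * (h (f1 k) * p.1 (f2 k)).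
have e2 k : q k.1 * P k.2 * Phi (f1 k.1) (n1 k.2) (incr (n2 k.2) (f2 k.1)) =
    q k.1 * h (f1 k.1) * E0 k.2 + sg^-1 * \sum_(p <- splits v) qp p k.1 * Ep p k.2.
  rewrite /E0 /Phi wick_incr mulrDr [LHS]mulrDr; congr (_ + _); first by ring.
  by rewrite !mulr_sumr; apply: eq_bigr => p _; rewrite /qp /Ep; ring.
have [ssum Ssum] : asummable (fun k : J * Omega => \sum_(p <- splits v) qp p k.1 * Ep p k.2) /\
   rsum (fun k : J * Omega => \sum_(p <- splits v) qp p k.1 * Ep p k.2) =
   \sum_(p <- splits v) rsum (qp p) * rsum (Ep p).
  elim: (splits v) sv => [_|p r ih [[h1 h2] /ih[i1 i2]]].
    split; first by apply: eq_asummable (asummable0 _ _) => k; rewrite big_nil.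
    by rewrite big_nil -[RHS](rsum0 R (J * Omega)%type); apply: eq_rsum => k; rewrite big_nil.
  have e k : \sum_(j <- p :: r) qp j k.1 * Ep j k.2 = qp p k.1 * Ep p k.2 + \sum_(j <- r) qp j k.1 * Ep j k.2.
    by move: k => k; rewrite big_cons.
  have sp : asummable (fun k : J * Omega => qp p k.1 * Ep p k.2) by exact: asummable_prod.
  split; first by apply: (eq_asummable (fun k => esym (e k))); exact: asummableD.
  by rewrite (eq_rsum e) rsumD// i2 big_cons rsum_prod.
have sA : asummable (fun k : I * Omega => a k.1 * h k.1 * E0 k.2).
  exact: (asummable_prod (f := fun x => a x * h x)).
have sB : asummable (fun k : J * Omega => q k.1 * h (f1 k.1) * E0 k.2).
  exact: (asummable_prod (f := fun k => q k * h (f1 k))).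
have [//|//|s3 S3] := @mecke_rsum Phi.
- by apply: eq_asummable sA => k; rewrite e1.
- apply: eq_asummable (asummableD sB (asummableZ sg^-1 ssum)) => k; by rewrite e2.
pose F o := \sum_(x <- finsupp (n1 o)) (n1 o x)%:R * Phi x (decr (n1 o) x) (n2 o).
have e3 o : P o * (wick (h :: w) (n1 o) * wick v (n2 o)) = sg^-1 * (P o * F o - lam * mean h * E0 o).
  rewrite /= /creat -/sg /E0 /F.
  rewrite (_ : \sum_(x <- _) _ * Phi _ _ _ = (\sum_(x <- finsupp (n1 o)) (n1 o x)%:R * (h x * wick w (decr (n1 o) x))) * wick v (n2 o)).
    by ring.
  by rewrite mulr_suml; apply: eq_bigr => x _; rewrite /Phi; ring.
rewrite (eq_rsum e3) rsumZ; last by apply: asummableD => //; apply: asummableN; exact: asummableZ.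
rewrite rsumB//; last exact: asummableZ.
rewrite S3 rsumZ// (eq_rsum e1) (eq_rsum e2) rsumD//; last exact: asummableZ.
rewrite rsumZ// (rsum_prod (f := fun x => a x * h x))// (rsum_prod (f := fun k => q k * h (f1 k)))//.
(* One factor [sg^-1] comes from the creation operator and one from the increment; together they are
   the [lam^-1] of [pairing]. *)
rewrite -saq Ssum (_ : \sum_(p <- splits v) pairing h p.1 * _ = lam^-1 * \sum_(p <- splits v) rsum (qp p) * rsum (Ep p)).
  by rewrite -sg_sqr invfM; ring.
by rewrite mulr_sumr; apply: eq_bigr => p _; rewrite /pairing mulrA.
Qed.

End ChaosAlgebra.

Section Powers.
Variable R : realFieldType.

Lemma powD_le (x y : R) n : 0 <= x -> 0 <= y -> (x + y) ^+ n <= 2 ^+ n * (x ^+ n + y ^+ n).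
Proof.
wlog xy : x y / x <= y => [hw x0 y0|x0 y0].
  have [|/ltW yx] := leP x y; first by move=> ?; exact: hw.
  by rewrite addrC [X in _ <= _ * X]addrC; exact: hw.
apply: (@le_trans _ _ ((2 * y) ^+ n)).
  by rewrite lerXn2r ?nnegrE ?addr_ge0 ?mulr_ge0//; lra.
by rewrite exprMn ler_wpM2l ?exprn_ge0// lerDr exprn_ge0.
Qed.

Lemma powD_even (x y : R) k :
  (x + y) ^+ (2 * k) <= 2 ^+ (2 * k) * (x ^+ (2 * k) + y ^+ (2 * k)).
Proof.
have e (z : R) : z ^+ (2 * k) = `|z| ^+ (2 * k) by rewrite !exprM real_normK ?num_real.
rewrite (e (x + y)) (e x) (e y); apply: le_trans (powD_le _ _ _) => //.
by rewrite lerXn2r ?nnegrE ?addr_ge0// ler_normD.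
Qed.

Lemma pow_even_ge0 (x : R) k : 0 <= x ^+ (2 * k).
Proof. by rewrite exprM exprn_ge0// sqr_ge0. Qed.

Lemma mul_le_sqr (x y : R) : x * y <= x ^+ 2 + y ^+ 2.
Proof. by have := sqr_ge0 (x - y); have := sqr_ge0 x; have := sqr_ge0 y; nra. Qed.

Lemma abs_le_sqr (x : R) : `|x| <= 1 + x ^+ 2.
Proof.
rewrite -(real_normK (num_real x)); have := sqr_ge0 (`|x| - 1); have := normr_ge0 x; nra.
Qed.

(** A mean value bound linear in [u]: in [chaos1_step], the factor [u] is of order [1 / sqrt lam]
    and compensates the growing intensity. *)
Lemma powB_le (x u : R) k :
  `|(x + u) ^+ (2 * k).+1 - x ^+ (2 * k).+1| <=
  (2 * k).+1%:R * 2 ^+ (2 * k) * (`|u| * (x ^+ (2 * k) + u ^+ (2 * k))).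
Proof.
have e (z : R) : z ^+ (2 * k) = `|z| ^+ (2 * k) by rewrite !exprM real_normK ?num_real.
rewrite subrXX addrAC subrr add0r normrM mulrCA ler_wpM2l//.
apply: le_trans (ler_norm_sum _ _ _) _.
apply: (@le_trans _ _ (\sum_(i < (2 * k).+1) (`|x| + `|u|) ^+ (2 * k))).
  apply: ler_sum => i _; rewrite normrM !normrX.
  apply: (@le_trans _ _ ((`|x| + `|u|) ^+ ((2 * k).+1.-1 - i) * (`|x| + `|u|) ^+ i)).
    rewrite ler_pM ?exprn_ge0//; rewrite lerXn2r ?nnegrE ?addr_ge0//.
      exact: ler_normD.
    by rewrite lerDl.
  by rewrite -exprD subnK// -ltnS.
rewrite sumr_const card_ord -[leLHS]mulr_natl -[leRHS]mulrA ler_wpM2l// (e x) (e u).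
exact: powD_le.
Qed.

End Powers.

(** * Moment bounds uniform in the intensity *)

Section Tame.
Variables (R : realType) (L : R -> Prop).
Implicit Types Omega : choiceType.

(* Uniformity over [L] is what makes remainders of order [1 / lam] vanish as [lam] grows. *)
Definition tame Omega (P f : R -> Omega -> R) := forall k : nat, exists C : R,
  forall lam, L lam -> (psum (fun x => (P lam x * f lam x ^+ (2 * k))%R) <= C%:E)%E.

Definition isprob Omega (P : R -> Omega -> R) :=
  forall lam, L lam -> (forall x, 0 <= P lam x) /\ psum (P lam) = 1%E.

Section OneSpace.
Variables (Omega : choiceType) (P : R -> Omega -> R) (Pp : isprob P).
Implicit Types f g : R -> Omega -> R.

Lemma tame_ext f g : (forall lam, L lam -> f lam =1 g lam) -> tame P f -> tame P g.
Proof.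
move=> fg tf k; have [C hC] := tf k; exists C => lam ll.
by rewrite (eq_psum (g := fun x => P lam x * f lam x ^+ (2 * k))) ?hC// => x; rewrite fg.
Qed.

Lemma tame_bdd f (B : R) : (forall lam x, L lam -> `|f lam x| <= B) -> tame P f.
Proof.
move=> fB k; exists (`|B| ^+ (2 * k)) => lam ll; have [P0 P1] := Pp ll.
apply: (@le_trans _ _ (psum (fun x => `|B| ^+ (2 * k) * P lam x))); last first.
  by rewrite psumZ ?P1 ?mule1// exprn_ge0.
apply: le_psum => x; rewrite mulrC ler_wpM2r//.
rewrite !exprM -(real_normK (num_real (f lam x))) lerXn2r ?nnegrE ?sqr_ge0//.
by rewrite lerXn2r ?nnegrE// (le_trans (fB _ _ ll))// ler_norm.
Qed.

Lemma tame_cst (c : R -> R) (B : R) : (forall lam, L lam -> `|c lam| <= B) -> tame P (fun lam _ => c lam).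
Proof. by move=> h; apply: (tame_bdd (B := B)) => lam _; exact: h. Qed.

Lemma tameD f g : tame P f -> tame P g -> tame P (fun lam x => f lam x + g lam x).
Proof.
move=> tf tg k; have [C hC] := tf k; have [D hD] := tg k.
exists (2 ^+ (2 * k) * (C + D)) => lam ll; have [P0 P1] := Pp ll.
apply: (@le_trans _ _ (psum (fun x => 2 ^+ (2 * k) * (P lam x * f lam x ^+ (2 * k) + P lam x * g lam x ^+ (2 * k))))).
  apply: le_psum => x; rewrite -mulrDr mulrCA ler_wpM2l//; exact: powD_even.
have f0 x : 0 <= P lam x * f lam x ^+ (2 * k) by rewrite mulr_ge0// pow_even_ge0.
have g0 x : 0 <= P lam x * g lam x ^+ (2 * k) by rewrite mulr_ge0// pow_even_ge0.
rewrite psumZ ?exprn_ge0//; last by move=> x; rewrite addr_ge0.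
rewrite psumD// EFinM; apply: lee_wpmul2l; first by rewrite lee_fin exprn_ge0.
by rewrite EFinD; apply: leeD; [exact: hC|exact: hD].
Qed.

Lemma tameM f g : tame P f -> tame P g -> tame P (fun lam x => f lam x * g lam x).
Proof.
move=> tf tg k; have [C hC] := tf (2 * k)%N; have [D hD] := tg (2 * k)%N.
exists (C + D) => lam ll; have [P0 P1] := Pp ll.
apply: (@le_trans _ _ (psum (fun x => P lam x * f lam x ^+ (2 * (2 * k)) + P lam x * g lam x ^+ (2 * (2 * k))))).
  apply: le_psum => x; rewrite -mulrDr ler_wpM2l// exprMn.
  by apply: le_trans (mul_le_sqr _ _) _; rewrite -!exprM [(2 * k * 2)%N]mulnC.
have f0 x : 0 <= P lam x * f lam x ^+ (2 * (2 * k)) by rewrite mulr_ge0// pow_even_ge0.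
have g0 x : 0 <= P lam x * g lam x ^+ (2 * (2 * k)) by rewrite mulr_ge0// pow_even_ge0.
by rewrite psumD// EFinD; apply: leeD; [exact: hC|exact: hD].
Qed.

Lemma tameZ (c : R -> R) (B : R) f : (forall lam, L lam -> `|c lam| <= B) ->
  tame P f -> tame P (fun lam x => c lam * f lam x).
Proof. by move=> cB; apply: tameM; exact: tame_cst cB. Qed.

Lemma tameB f g : tame P f -> tame P g -> tame P (fun lam x => f lam x - g lam x).
Proof.
move=> tf tg; apply: tameD => //.
have := @tameZ (fun=> -1) 1 g; move=> /(_ _ tg)/wrap[]; first by move=> *; rewrite normrN1.
by apply: tame_ext => lam _ x; rewrite mulN1r.
Qed.

Lemma tame_sum T (r : seq T) (F : T -> R -> Omega -> R) : Pall (fun p => tame P (F p)) r ->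
  tame P (fun lam x => \sum_(p <- r) F p lam x).
Proof.
elim: r => [_|p r ih [/= hp /ih hr]].
  apply: (tame_ext (f := fun _ _ => 0)) => [lam _ x|]; first by rewrite big_nil.
  by apply: (tame_cst (B := 0)) => *; rewrite normr0.
by apply: tame_ext (tameD hp hr) => lam _ x; rewrite big_cons.
Qed.

Lemma tame_asummable f lam : L lam -> tame P f -> asummable (fun x => P lam x * f lam x).
Proof.
move=> ll tf; have [P0 P1] := Pp ll; have [C hC] := tf 1%N.
apply: (le_asummable (g := fun x => P lam x + P lam x * f lam x ^+ (2 * 1))).
  move=> x; rewrite normrM ger0_norm// -{2}[P lam x]mulr1 -mulrDr ler_wpM2l//.
  by rewrite muln1 abs_le_sqr.
rewrite psumD//; last by move=> x; rewrite mulr_ge0// pow_even_ge0.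
by rewrite P1 lte_add_pinfty ?ltry// (le_lt_trans (hC _ ll))// ltry.
Qed.

Lemma tame_meanB f : tame P f -> exists B, forall lam, L lam -> `|rsum (fun x => P lam x * f lam x)| <= B.
Proof.
move=> tf; have [C hC] := tf 1%N; exists (1 + C) => lam ll; have [P0 P1] := Pp ll.
have sf := tame_asummable ll tf.
apply: le_trans (abs_rsum sf) _; rewrite -lee_fin rsum_psum; [|by []|]; last first.
  by rewrite asummable_ge0.
apply: (@le_trans _ _ (psum (fun x => P lam x + P lam x * f lam x ^+ (2 * 1)))).
  apply: le_psum => x; rewrite normrM ger0_norm// -{2}[P lam x]mulr1 -mulrDr ler_wpM2l//.
  by rewrite muln1 abs_le_sqr.
rewrite psumD//; last by move=> x; rewrite mulr_ge0// pow_even_ge0.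
by rewrite P1 EFinD; apply: leeD => //; exact: hC.
Qed.

Lemma tame_pow f n : tame P f -> tame P (fun lam x => f lam x ^+ n).
Proof.
move=> tf; elim: n => [|n ih].
  by apply: (tame_bdd (B := 1)) => lam x _; rewrite expr0 normr1.
by apply: tame_ext (tameM tf ih) => lam _ x; rewrite exprS.
Qed.

Lemma tame_evenB f k : tame P f -> exists B, forall lam, L lam ->
  rsum (fun x => P lam x * f lam x ^+ (2 * k)) <= B.
Proof.
move=> tf; have [B hB] := tame_meanB (tame_pow (2 * k) tf).
by exists B => lam ll; apply: le_trans (ler_norm _) (hB _ ll).
Qed.

Lemma tame_of_rsum f : (forall lam n, L lam -> asummable (fun x => P lam x * f lam x ^+ n)) ->
  (forall k, exists C, forall lam, L lam -> rsum (fun x => P lam x * f lam x ^+ (2 * k)) <= C) ->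
  tame P f.
Proof.
move=> sf h k; have [C hC] := h k; exists C => lam ll; have [P0 P1] := Pp ll.
by rewrite -rsum_psum ?lee_fin ?hC// => [x|]; [rewrite mulr_ge0// pow_even_ge0|exact: sf].
Qed.

Lemma tame_comp (Omega' : choiceType) (P' : R -> Omega' -> R) (n : Omega' -> Omega) f :
  (forall lam (g : Omega -> R), L lam -> (forall x, 0 <= g x) ->
    psum (fun o => P' lam o * g (n o)) = psum (fun x => P lam x * g x)) ->
  tame P f -> tame P' (fun lam o => f lam (n o)).
Proof.
move=> h tf k; have [C hC] := tf k; exists C => lam ll.
rewrite (h lam (fun x => f lam x ^+ (2 * k)))// ?hC// => x; exact: pow_even_ge0.
Qed.

End OneSpace.

End Tame.

Section TameChaos.
Variables (R : realType) (I : choiceType).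

(** Finiteness only, with no uniformity in the rate: Mecke's identity removes one factor of the
    power, and the shifted statistic is bounded through [powD_le]. *)
Lemma lin_moment (r g : I -> R) k : (forall x, 0 <= r x) -> (forall x, 0 <= g x) ->
  (psum r < +oo)%E -> (forall n, (psum (fun x => (r x * g x ^+ n)%R) < +oo)%E) ->
  (psum (fun N => (pois r N * (\sum_(x <- finsupp N) (N x)%:R * g x) ^+ k)%R) < +oo)%E.
Proof.
move=> r0 g0 roo hg.
pose l (N : fs I) := \sum_(x <- finsupp N) (N x)%:R * g x.
have l0 N : 0 <= l N by rewrite sumr_ge0// => x _; rewrite mulr_ge0.
have p0 N : 0 <= pois r N by exact: pois_ge0.
have pl0 n N : 0 <= pois r N * l N ^+ n by rewrite mulr_ge0// exprn_ge0.
elim: k => [|k ih].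
  rewrite (eq_psum (g := pois r)) ?psum_pois ?ltry// => N; by rewrite expr0 mulr1.
rewrite (eq_psum (g := fun N => pois r N * \sum_(x <- finsupp N) (N x)%:R * (g x * l N ^+ k))); last first.
  move=> N; congr (_ * _); rewrite exprS -/(l N) {1}/l mulr_suml.
  by apply: eq_bigr => x _; rewrite mulrA.
rewrite (pois_mecke (Phi := fun x _ N => g x * l N ^+ k))//; last first.
  by move=> *; rewrite mulr_ge0// exprn_ge0.
apply: (@le_lt_trans _ _ (psum (fun k' : I * fs I => 2 ^+ k *
   ((r k'.1 * g k'.1) * (pois r k'.2 * l k'.2 ^+ k) + (r k'.1 * g k'.1 ^+ k.+1) * pois r k'.2)))).
  apply: le_psum => -[x N] /=; rewrite /l lin_incr -/(l N).
  apply: (@le_trans _ _ (r x * pois r N * (g x * (2 ^+ k * (l N ^+ k + g x ^+ k))))).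
    by apply: ler_wpM2l; [rewrite mulr_ge0|apply: ler_wpM2l => //; exact: powD_le].
  by rewrite le_eqVlt; apply/orP; left; apply/eqP; rewrite exprS; ring.
have t1 (z : I * fs I) : 0 <= r z.1 * g z.1 * (pois r z.2 * l z.2 ^+ k).
  by apply: mulr_ge0 => //; exact: mulr_ge0.
have t2 (z : I * fs I) : 0 <= r z.1 * g z.1 ^+ k.+1 * pois r z.2.
  by apply: mulr_ge0 => //; apply: mulr_ge0 => //; exact: exprn_ge0.
rewrite psumZ ?exprn_ge0//; last by move=> z; exact: addr_ge0.
rewrite psumD//.
rewrite (psum_prod (f := fun x => r x * g x) (g := fun N => pois r N * l N ^+ k))//; last first.
  by move=> x; rewrite mulr_ge0.
rewrite (psum_prod (f := fun x => r x * g x ^+ k.+1) (g := pois r))//; last 2 first.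
- by move=> x; rewrite mulr_ge0// exprn_ge0.
- by rewrite psum_pois// ltry.
have h1 : (psum (fun x => (r x * g x)%R) < +oo)%E := hg 1%N.
have rg0 n x : 0 <= r x * g x ^+ n by rewrite mulr_ge0// exprn_ge0.
have rg1 x : 0 <= r x * g x by rewrite mulr_ge0.
rewrite psum_pois// (psum_fin rg1 h1) (psum_fin (pl0 k) ih) (psum_fin (rg0 k.+1) (hg _)).
by rewrite mule1 -!EFinM ltry.
Qed.

Variables (L : R -> Prop) (pi : R -> I -> R).
Hypothesis L1 : forall lam, L lam -> 1 <= lam.
Hypothesis pip : isprob L pi.

Definition ppp (lam : R) : fs I -> R := pois (fun x => lam * pi lam x).

Lemma ppp_prob : isprob L ppp.
Proof.
move=> lam ll; have [p0 p1] := pip ll; have l0 : 0 <= lam by have := L1 ll; lra.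
have r0 x : 0 <= lam * pi lam x by rewrite mulr_ge0.
split; first by move=> N; exact: pois_ge0.
by apply: psum_pois => //; rewrite psumZ// p1 mule1 ltry.
Qed.

(** Domination by the linear statistic of [|h|]. The bound depends on [lam]; it only licenses the
    signed manipulations that lead to the uniform estimate. *)
Lemma chaos1_moments (h : R -> I -> R) : tame L pi h -> forall lam n, L lam ->
  asummable (fun N => ppp lam N * wick lam (pi lam) [:: h lam] N ^+ n).
Proof.
move=> th lam n ll; have [p0 p1] := pip ll; have l1 := L1 ll.
have [q0 q1] := ppp_prob ll.
have r0 x : 0 <= lam * pi lam x by rewrite mulr_ge0//; lra.
pose l (N : fs I) := \sum_(x <- finsupp N) (N x)%:R * `|h lam x|.
have l0 N : 0 <= l N by rewrite sumr_ge0// => x _; rewrite mulr_ge0.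
set c := lam * mean (pi lam) (h lam).
have sg1 : 1 <= Num.sqrt lam by rewrite -sqrtr1 ler_wsqrtr.
apply: (le_asummable (g := fun N => 2 ^+ n * (ppp lam N * l N ^+ n + `|c| ^+ n * ppp lam N))).
  move=> N; rewrite normrM normrX ger0_norm// wick1E -/c.
  apply: (@le_trans _ _ (ppp lam N * (l N + `|c|) ^+ n)).
    rewrite ler_wpM2l// lerXn2r ?nnegrE ?addr_ge0//.
    rewrite normrM; apply: (@le_trans _ _ `|\sum_(x <- finsupp N) (N x)%:R * h lam x - c|).
      by rewrite ler_piMr// normfV ger0_norm ?sqrtr_ge0// invf_le1//; lra.
    apply: le_trans (ler_normB _ _) _; rewrite lerD2r.
    apply: le_trans (ler_norm_sum _ _ _) _; apply: ler_sum => x _.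
    by rewrite normrM ger0_norm.
  apply: (@le_trans _ _ (ppp lam N * (2 ^+ n * (l N ^+ n + `|c| ^+ n)))).
    by rewrite ler_wpM2l// powD_le.
  by rewrite le_eqVlt; apply/orP; left; apply/eqP; ring.
have a1 N : 0 <= ppp lam N * l N ^+ n by rewrite mulr_ge0// exprn_ge0.
have a2 N : 0 <= `|c| ^+ n * ppp lam N by rewrite mulr_ge0// exprn_ge0.
rewrite psumZ ?exprn_ge0//; last by move=> N; rewrite addr_ge0.
have b1 : (psum (fun N => (ppp lam N * l N ^+ n)%R) < +oo)%E.
  apply: (lin_moment n r0 (g := fun x => `|h lam x|)) => //.
    by rewrite psumZ ?p1 ?mule1 ?ltry//; lra.
  move=> m; rewrite (eq_psum (g := fun x => lam * (pi lam x * `|h lam x| ^+ m))); last by move=> x; rewrite mulrA.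
  rewrite psumZ; [|lra|by move=> x; rewrite mulr_ge0// exprn_ge0].
  have := tame_asummable pip ll (tame_pow pip m th).
  rewrite /asummable (eq_psum (g := fun x => pi lam x * `|h lam x| ^+ m)); last first.
    by move=> x; rewrite normrM normrX ger0_norm.
  by move=> hf; rewrite (psum_fin _ hf) -?EFinM ?ltry// => x; rewrite mulr_ge0// exprn_ge0.
have -> : psum (fun N => ppp lam N * l N ^+ n + `|c| ^+ n * ppp lam N) =
    (fine (psum (fun N => ppp lam N * l N ^+ n)) + `|c| ^+ n)%:E.
  rewrite psumD// EFinD -(psum_fin a1 b1); congr (_ + _)%E.
  by rewrite (psumZ (f := ppp lam)) ?exprn_ge0// q1 mule1.
by rewrite -EFinM ltry.
Qed.

(** Write [y^(2k+2) = y * y^(2k+1)] and remove the first factor by Mecke's identity: this leaves the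
    increment of [y^(2k+1)] when [y] moves by [h / sqrt lam]. The intensity [lam], the scaling of
    [y] and the size of the increment cancel, so no power of [lam] remains. *)
Lemma chaos1_step (h : R -> I -> R) lam k (y := wick lam (pi lam) [:: h lam]) : tame L pi h -> L lam ->
  rsum (fun N => ppp lam N * y N ^+ (2 * k.+1)) <=
  (2 * k).+1%:R * 2 ^+ (2 * k) *
    (rsum (fun x => pi lam x * h lam x ^+ 2) * rsum (fun N => ppp lam N * y N ^+ (2 * k)) +
     rsum (fun x => pi lam x * h lam x ^+ (2 * k.+1))).
Proof.
move=> th ll; have [p0 p1] := pip ll; have l1 := L1 ll.
have l0 : 0 < lam by lra.
have [q0 q1] := ppp_prob ll.
have r0 x : 0 <= lam * pi lam x by rewrite mulr_ge0//; lra.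
have sgn0 := sg_neq0 l0; have sg2 := sg_sqr l0; have sg0 := sg_gt0 l0.
move: sgn0 sg2 sg0; set sg := Num.sqrt lam => sgn0 sg2 sg0.
have sg1 : 1 <= sg by rewrite -sqrtr1 ler_wsqrtr.
have ym n := chaos1_moments th n ll; rewrite -/y in ym.
have hm n := tame_asummable pip ll (tame_pow pip n th).
have h1 := tame_asummable pip ll th.
set c := (2 * k).+1%:R * 2 ^+ (2 * k).
have c0 : 0 <= c :> R by rewrite mulr_ge0// exprn_ge0.
pose G N := y N ^+ (2 * k).+1.
pose Phi x (M N : fs I) := h lam x * G N.
have yi N x : y (incr N x) = y N + h lam x / sg.
  by rewrite /y wick_incr [splits _]/= big_cons big_nil /= addr0 mulr1 mulrC.
pose D (z : I * fs I) := lam * pi lam z.1 * ppp lam z.2 * (h lam z.1 * (G (incr z.2 z.1) - G z.2)).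
pose B (z : I * fs I) := lam / sg * c * ((pi lam z.1 * h lam z.1 ^+ 2) * (ppp lam z.2 * y z.2 ^+ (2 * k)) +
    (pi lam z.1 * h lam z.1 ^+ (2 * k.+1)) * ppp lam z.2).
have lp x N : 0 <= lam * pi lam x * ppp lam N := mulr_ge0 (r0 x) (q0 N).
have DB z : `|D z| <= B z.
  case: z => x N; rewrite /D /B /= normrM ger0_norm; last exact: lp.
  rewrite normrM /G yi.
  apply: (@le_trans _ _ (lam * pi lam x * ppp lam N * (`|h lam x| * (c * (`|h lam x| / sg * (y N ^+ (2 * k) + h lam x ^+ (2 * k))))))).
    rewrite ler_wpM2l ?lp//.
    rewrite ler_wpM2l//; apply: le_trans (powB_le _ _ _) _; rewrite -/c ler_wpM2l//.
    rewrite normrM normfV (gtr0_norm sg0) ler_wpM2l//; first by rewrite divr_ge0// ltW.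
    (* Here [1 <= lam] enters: the leftover power [sg^(-2k)] is at most 1. *)
    rewrite lerD2l expr_div_n ler_piMr ?pow_even_ge0// invf_le1 ?exprn_gt0//.
    by rewrite exprn_ege1.
  rewrite le_eqVlt; apply/orP; left; apply/eqP.
  have e2 : h lam x ^+ (2 * k.+1) = `|h lam x| * `|h lam x| * h lam x ^+ (2 * k).
    by rewrite mulnS exprD -expr2 real_normK ?num_real.
  have e3 : h lam x ^+ 2 = `|h lam x| * `|h lam x| by rewrite -expr2 real_normK ?num_real.
  by rewrite e2 e3; ring.
have sB1 : asummable (fun z : I * fs I => (pi lam z.1 * h lam z.1 ^+ 2) * (ppp lam z.2 * y z.2 ^+ (2 * k))).
  exact: asummable_prod (hm 2%N) (ym (2 * k)%N).
have sP : asummable (ppp lam) by rewrite asummable_ge0// q1 ltry.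
have sB2 : asummable (fun z : I * fs I => (pi lam z.1 * h lam z.1 ^+ (2 * k.+1)) * ppp lam z.2).
  exact: asummable_prod (hm (2 * k.+1)%N) sP.
have sB : asummable B by apply: asummableZ; exact: asummableD.
have B0 z : 0 <= B z by apply: le_trans (DB z).
have sD : asummable D by apply: le_asummable DB _; rewrite -asummable_ge0.
pose D0 (z : I * fs I) := (lam * (pi lam z.1 * h lam z.1)) * (ppp lam z.2 * G z.2).
have sG : asummable (fun N => ppp lam N * G N) := ym (2 * k).+1.
have sh : asummable (fun x => lam * (pi lam x * h lam x)) := asummableZ lam h1.
have sD0 : asummable D0 := asummable_prod sh sG.
have rhs (z : I * fs I) : lam * pi lam z.1 * ppp lam z.2 * Phi z.1 z.2 (incr z.2 z.1) = D z + D0 z.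
  by rewrite /D /D0 /Phi; ring.
have z1 : asummable (fun z : I * fs I => 0 * ppp lam z.2 * Phi z.1 z.2 z.2).
  by apply: eq_asummable (asummable0 _ _) => z; rewrite !mul0r.
have z2 : asummable (fun z : I * fs I => lam * pi lam z.1 * ppp lam z.2 * Phi z.1 z.2 (incr z.2 z.1)).
  by apply: eq_asummable (asummableD sD sD0) => z; rewrite -rhs.
have z0 : rsum (fun z : I * fs I => 0 * ppp lam z.2 * Phi z.1 z.2 z.2) = 0.
  by rewrite (eq_rsum (g := fun=> 0)) ?rsum0// => z; rewrite !mul0r.
have [sL SL] := mecke_rsum q0 (fun=> lexx 0) r0 (mecke_pois r0) z1 z2.
have e1 N : ppp lam N * y N ^+ (2 * k.+1) = sg^-1 * (ppp lam N * (\sum_(x <- finsupp N) (N x)%:R * Phi x (decr N x) N)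
    - lam * mean (pi lam) (h lam) * (ppp lam N * G N)).
  rewrite /Phi /G mulnS addSn exprS {1}/y wick1E -/sg.
  rewrite (_ : \sum_(x <- finsupp N) (N x)%:R * (h lam x * _) = (\sum_(x <- finsupp N) (N x)%:R * h lam x) * y N ^+ (2 * k).+1).
    by rewrite add1n; ring.
  by rewrite mulr_suml; apply: eq_bigr => x _; rewrite mulrA.
have sGc := asummableZ (lam * mean (pi lam) (h lam)) sG.
rewrite (eq_rsum e1) (rsumZ _ (asummableD sL (asummableN sGc))) (rsumB sL sGc) SL z0.
rewrite add0r (eq_rsum rhs) (rsumD sD sD0) (rsumZ _ sG).
rewrite (rsum_prod sh sG).
(* The unshifted part [D0] integrates to exactly the compensator term, so only the increment part
   [D] is left. *)
rewrite (rsumZ _ h1) -/(mean _ _) addrK.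
apply: (@le_trans _ _ (sg^-1 * rsum B)).
  rewrite ler_wpM2l ?invr_ge0 ?(ltW sg0)// le_rsum// => z.
  by apply: le_trans (DB z); rewrite ler_norm.
rewrite rsumZ; last exact: asummableD.
rewrite rsumD// (rsum_prod (hm 2%N) (ym (2 * k)%N)) (rsum_prod (hm (2 * k.+1)%N) sP).
rewrite [rsum (ppp lam)]rsum_ge0E// q1 /= mulr1 -sg2 le_eqVlt; apply/orP; left; apply/eqP.
by field.
Qed.

Lemma tame_chaos1 (h : R -> I -> R) : tame L pi h ->
  tame L ppp (fun lam => wick lam (pi lam) [:: h lam]).
Proof.
move=> th; apply: (tame_of_rsum ppp_prob) => [lam n ll|k]; first exact: chaos1_moments.
elim: k => [|k [C hC]].
  exists 1 => lam ll; have [q0 q1] := ppp_prob ll.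
  rewrite (eq_rsum (g := ppp lam)); last by move=> N; rewrite muln0 expr0 mulr1.
  by rewrite rsum_ge0E// q1.
have [B2 hB2] := tame_evenB pip 1 th; have [Bk hBk] := tame_evenB pip k.+1 th.
exists ((2 * k).+1%:R * 2 ^+ (2 * k) * (B2 * C + Bk)) => lam ll.
apply: le_trans (chaos1_step k th ll) _; rewrite ler_wpM2l ?mulr_ge0 ?exprn_ge0//.
have [q0 q1] := ppp_prob ll; have [p0 p1] := pip ll.
apply: lerD; last exact: hBk.
apply: ler_pM; [| |by have := hB2 _ ll; rewrite muln1|exact: hC].
  by apply: rsum_ge0 => x; rewrite mulr_ge0// sqr_ge0.
by apply: rsum_ge0 => x; rewrite mulr_ge0// pow_even_ge0.
Qed.

Lemma splits_map T U (g : T -> U) (w : seq T) :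
  splits (map g w) = [seq (g p.1, map g p.2) | p <- splits w].
Proof. by elim: w => //= x w ->; rewrite -!map_comp. Qed.

Lemma Pall_splits T (Q : T -> Prop) (w : seq T) : Pall Q w ->
  Pall (fun p => [/\ Q p.1, Pall Q p.2 & (size p.2).+1 = size w]) (splits w).
Proof.
elim: w => [//|x w ih] /= [Qx /[dup] Qw /ih h]; split => //.
elim: (splits w) h => [//|p r ihr] /= [[h1 h2 h3] /ihr h]; split => //; split => //=.
by rewrite h3.
Qed.

Lemma Pall_impl T (Q Q' : T -> Prop) (w : seq T) : (forall x, Q x -> Q' x) -> Pall Q w -> Pall Q' w.
Proof. by move=> h; elim: w => //= x w ih [/h ? /ih]. Qed.

Lemma Pall_map T U (f : T -> U) (Q : U -> Prop) (w : seq T) : Pall Q (map f w) = Pall (Q \o f) w.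
Proof. by elim: w => //= x w ->. Qed.

(** By [wick_cons] a word is the product of a first chaos with a shorter word, corrected by shorter
    words in which two letters have merged. Tameness is stable under products, so induction on the
    length applies. *)
Lemma tame_wick (w : seq (R -> I -> R)) : Pall (tame L pi) w ->
  tame L ppp (fun lam => wick lam (pi lam) [seq h lam | h <- w]).
Proof.
have [n] := ubnP (size w); elim: n w => // n ih [_ _|h w] /=.
  by apply: (tame_bdd ppp_prob (B := 1)) => *; rewrite normr1.
rewrite ltnS => sw [th tw].
pose hp (p : (R -> I -> R) * seq (R -> I -> R)) lam x := h lam x * p.1 lam x.
(* The [sqrt lam] before the mean in [wick_cons] is absorbed by the outer [sg^-1], so all
   coefficients stay bounded in [lam]. *)
pose Y lam N := wick lam (pi lam) [:: h lam] N * wick lam (pi lam) [seq h lam | h <- w] N -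
   \sum_(p <- splits w) ((Num.sqrt lam)^-1 * wick lam (pi lam) [seq h lam | h <- hp p :: p.2] N +
       mean (pi lam) (hp p lam) * wick lam (pi lam) [seq h lam | h <- p.2] N).
apply: (tame_ext (f := Y)).
  move=> lam ll N; have l0 : 0 < lam by have := L1 ll; lra.
  rewrite -[RHS]/(wick lam (pi lam) (h lam :: [seq h lam | h <- w]) N) wick_cons// /Y splits_map big_map.
  congr (_ - _); rewrite mulr_sumr; apply: eq_bigr => p _; rewrite mulrDr; congr (_ + _).
  by rewrite !mulrA mulVf ?mul1r// sg_neq0.
apply: (tameB ppp_prob).
  by apply: (tameM ppp_prob); [exact: tame_chaos1|exact: ih].
apply: (tame_sum ppp_prob); apply: Pall_impl (Pall_splits tw) => p [t1 t2 s2].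
have thp : tame L pi (hp p) by exact: (tameM pip).
apply: (tameD ppp_prob).
  apply: (tameZ ppp_prob (B := 1)) => [lam ll|].
    have l1 := L1 ll; have : 1 <= Num.sqrt lam by rewrite -sqrtr1 ler_wsqrtr.
    by move=> sg1; rewrite normfV ger0_norm ?sqrtr_ge0// invf_le1//; lra.
  by apply: ih; rewrite /= ?s2.
have [B hB] := tame_meanB pip thp.
apply: (tameZ ppp_prob hB); apply: ih => //.
by apply: leq_trans sw; rewrite -s2.
Qed.

End TameChaos.

(** * Covariances of chaoses *)

Section WordMeans.
Variables (R : realType) (I : choiceType) (L : R -> Prop) (pi : R -> I -> R).
Hypotheses (L1 : forall lam, L lam -> 1 <= lam) (pip : isprob L pi).

Definition cword lam (w : seq (R -> I -> R)) : fs I -> R := wick lam (pi lam) [seq h lam | h <- w].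

Lemma tame_word w : Pall (tame L pi) w -> tame L (ppp pi) (fun lam => cword lam w).
Proof. exact: tame_wick. Qed.

(** Integration by parts against the empty word, which has no splits. *)
Lemma word_mean0 lam h w : L lam -> tame L pi h -> Pall (tame L pi) w ->
  rsum (fun N => ppp pi lam N * cword lam (h :: w) N) = 0.
Proof.
move=> ll th tw; have [p0 p1] := pip ll; have l1 := L1 ll; have l0 : 0 < lam by lra.
have [q0 q1] := ppp_prob L1 pip ll.
have r0 x : 0 <= lam * pi lam x by rewrite mulr_ge0// ltW.
have s1 : asummable (fun x : I => 0 * h lam x).
  by apply: eq_asummable (asummable0 _ _) => x; rewrite mul0r.
have s2 : asummable (fun x : I => lam * pi lam x * h lam x).
  by apply: eq_asummable (asummableZ lam (tame_asummable pip ll th)) => x; rewrite mulrA.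
have e : rsum (fun x : I => 0 * h lam x) + rsum (fun x : I => lam * pi lam x * h lam x) = lam * mean (pi lam) (h lam).
  rewrite (eq_rsum (g := fun=> 0)) ?rsum0 ?add0r; last by move=> x; rewrite mul0r.
  by rewrite -rsumZ ?(tame_asummable pip ll th)//; apply: eq_rsum => x; rewrite mulrA.
have s3 : asummable (fun N => ppp pi lam N * (wick lam (pi lam) [seq g lam | g <- w] N * wick lam (pi lam) [::] N)).
  by apply: eq_asummable (tame_asummable (ppp_prob L1 pip) ll (tame_word tw)) => N /=; rewrite mulr1.
have := wick_pairing l0 q0 (fun=> lexx 0) r0 (mecke_pois r0) s1 s2 e s3 Logic.I.
by rewrite /= big_nil => <-; apply: eq_rsum => N; rewrite mulr1.
Qed.

End WordMeans.

Section PairLaw.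
Variables (R : realType) (I : choiceType) (L : R -> Prop) (pi : R -> I -> R).
Hypotheses (L1 : forall lam, L lam -> 1 <= lam) (pip : isprob L pi).
Variables (Omega J : choiceType) (P : R -> Omega -> R) (n1 n2 : Omega -> fs I).
Variables (f1 f2 : J -> I) (a : R -> I -> R) (q : R -> J -> R).
Hypothesis Pp : isprob L P.
Hypothesis a0 : forall lam x, L lam -> 0 <= a lam x.
Hypothesis q0 : forall lam j, L lam -> 0 <= q lam j.
Hypothesis mk : forall lam, L lam -> mecke (P lam) n1 n2 (a lam) f1 f2 (q lam).
Hypothesis rate1 : forall lam (g : I -> R), L lam -> (forall x, 0 <= g x) ->
  (psum (fun x => (a lam x * g x)%R) + psum (fun j => (q lam j * g (f1 j))%R) =
   lam%:E * psum (fun x => (pi lam x * g x)%R))%E.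
(** An inequality, since [q] sees only the points of [n2] that are matched with a point of [n1]. *)
Hypothesis rate2 : forall lam (g : I -> R), L lam -> (forall x, 0 <= g x) ->
  (psum (fun j => (q lam j * g (f2 j))%R) <= lam%:E * psum (fun x => (pi lam x * g x)%R))%E.
Hypothesis marg1 : forall lam (g : fs I -> R), L lam -> (forall x, 0 <= g x) ->
  psum (fun o => P lam o * g (n1 o)) = psum (fun N => ppp pi lam N * g N).
Hypothesis marg2 : forall lam (g : fs I -> R), L lam -> (forall x, 0 <= g x) ->
  psum (fun o => P lam o * g (n2 o)) = psum (fun N => ppp pi lam N * g N).

Implicit Types (h g : R -> I -> R) (w v : seq (R -> I -> R)).

Definition pairingL lam h g : R := pairing lam f1 f2 (q lam) (h lam) (g lam).
Definition word_prod w v lam o := cword pi lam w (n1 o) * cword pi lam v (n2 o).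
Definition word_cov lam w v : R := rsum (fun o => P lam o * (cword pi lam w (n1 o) * cword pi lam v (n2 o))).

Lemma rates_fin lam (g : I -> R) : L lam -> (forall x, 0 <= g x) ->
  (psum (fun x => (pi lam x * g x)%R) < +oo)%E ->
  [/\ (psum (fun x => (a lam x * g x)%R) < +oo)%E,
      (psum (fun j => (q lam j * g (f1 j))%R) < +oo)%E &
      (psum (fun j => (q lam j * g (f2 j))%R) < +oo)%E].
Proof.
move=> ll g0 goo; have l1 := L1 ll; have [p0 p1] := pip ll.
have fin : (lam%:E * psum (fun x => (pi lam x * g x)%R) < +oo)%E.
  by rewrite psum_fin// ?ltry// => x; rewrite mulr_ge0.
split.
- apply: le_lt_trans fin; rewrite -rate1// leeDl// psum_ge0// => j; exact: mulr_ge0 (q0 _ ll) _.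
- apply: le_lt_trans fin; rewrite -rate1// leeDr// psum_ge0// => j; exact: mulr_ge0 (a0 _ ll) _.
- by apply: le_lt_trans fin; exact: rate2.
Qed.

Lemma rate1_rsum lam h : L lam -> tame L pi h ->
  [/\ asummable (fun x => a lam x * h lam x), asummable (fun j => q lam j * h lam (f1 j)) &
   rsum (fun x => a lam x * h lam x) + rsum (fun j => q lam j * h lam (f1 j)) = lam * mean (pi lam) (h lam)].
Proof.
move=> ll th; have l1 := L1 ll; have [p0 p1] := pip ll.
have sp := tame_asummable pip ll th.
have part (g : I -> R) : (forall x, 0 <= g x) -> (forall x, g x <= `|h lam x|) ->
   (psum (fun x => (pi lam x * g x)%R) < +oo)%E.
  move=> g0 gh; apply: le_lt_trans sp; apply: le_psum => x.
  by rewrite normrM ger0_norm// ler_wpM2l.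
have pl x : ppart (h lam) x <= `|h lam x| by rewrite abs_parts lerDl npart_ge0.
have nl x : npart (h lam) x <= `|h lam x| by rewrite abs_parts lerDr ppart_ge0.
have pf := part _ (@ppart_ge0 _ _ (h lam)) pl; have nf := part _ (@npart_ge0 _ _ (h lam)) nl.
have [pa pq _] := rates_fin ll (@ppart_ge0 _ _ (h lam)) pf.
have [na nq _] := rates_fin ll (@npart_ge0 _ _ (h lam)) nf.
have [ha hq _] := rates_fin ll (fun x => normr_ge0 (h lam x)) (part _ (fun x => normr_ge0 (h lam x)) (fun x => lexx _)).
split.
- by apply: le_asummable ha => x; rewrite normrM ger0_norm// a0.
- by apply: le_asummable hq => x; rewrite normrM ger0_norm// q0.
have m0 T (b : T -> R) (g : T -> R) : (forall x, 0 <= b x) -> (forall x, 0 <= g x) -> forall x, 0 <= b x * g x.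
  by move=> b0 g0 x; exact: mulr_ge0.
have A0 x := a0 x ll; have Q0 j := q0 j ll.
have pp0 := @ppart_ge0 _ _ (h lam); have np0 := @npart_ge0 _ _ (h lam).
rewrite (rsum_eq (m0 _ _ _ A0 pp0) (m0 _ _ _ A0 np0) pa na (f := fun x => a lam x * h lam x)); last first.
  by move=> x; rewrite -mulrBr -ppart_npart.
rewrite (rsum_eq (m0 _ _ _ Q0 (fun j => pp0 (f1 j))) (m0 _ _ _ Q0 (fun j => np0 (f1 j))) pq nq (f := fun j => q lam j * h lam (f1 j))); last first.
  by move=> x; rewrite -mulrBr -ppart_npart.
rewrite /mean (rsum_eq (m0 _ _ _ p0 pp0) (m0 _ _ _ p0 np0) pf nf (f := fun x => pi lam x * h lam x)); last first.
  by move=> x; rewrite -mulrBr -ppart_npart.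
have := rate1 ll pp0; have := rate1 ll np0.
rewrite (psum_fin (m0 _ _ _ A0 pp0) pa) (psum_fin (m0 _ _ _ A0 np0) na).
rewrite (psum_fin (m0 _ _ _ Q0 (fun j => pp0 (f1 j))) pq) (psum_fin (m0 _ _ _ Q0 (fun j => np0 (f1 j))) nq).
rewrite (psum_fin (m0 _ _ _ p0 pp0) pf) (psum_fin (m0 _ _ _ p0 np0) nf).
rewrite -!EFinD -!EFinM => -[e1] [e2]; rewrite mulrBr -e1 -e2 /=; ring.
Qed.

(** The product is dominated by [h^2 + g^2], and the two rate hypotheses bound each square
    separately. *)
Lemma rate12_asummable lam h g : L lam -> tame L pi h -> tame L pi g ->
  asummable (fun j => q lam j * (h lam (f1 j) * g lam (f2 j))).
Proof.
move=> ll th tg; have [p0 p1] := pip ll.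
have fin (k : R -> I -> R) : tame L pi k -> (psum (fun x => (pi lam x * k lam x ^+ 2)%R) < +oo)%E.
  move=> tk; rewrite -asummable_ge0; last by move=> x; rewrite mulr_ge0// sqr_ge0.
  exact: (tame_asummable pip (f := fun lam x => k lam x ^+ 2) ll (tame_pow pip 2 tk)).
have [_ h1 _] := rates_fin ll (fun x => sqr_ge0 (h lam x)) (fin _ th).
have [_ _ h2] := rates_fin ll (fun x => sqr_ge0 (g lam x)) (fin _ tg).
apply: (le_asummable (g := fun j => q lam j * h lam (f1 j) ^+ 2 + q lam j * g lam (f2 j) ^+ 2)).
  move=> j; rewrite normrM ger0_norm ?q0// -mulrDr ler_wpM2l ?q0// normrM.
  by rewrite -(real_normK (num_real (h _ _))) -(real_normK (num_real (g _ _))) mul_le_sqr.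
rewrite psumD; last 2 first.
- by move=> j; rewrite mulr_ge0 ?q0// sqr_ge0.
- by move=> j; rewrite mulr_ge0 ?q0// sqr_ge0.
exact: lte_add_pinfty.
Qed.

Lemma tame_n1 (F : R -> fs I -> R) : tame L (ppp pi) F -> tame L P (fun lam o => F lam (n1 o)).
Proof. exact: tame_comp. Qed.
Lemma tame_n2 (F : R -> fs I -> R) : tame L (ppp pi) F -> tame L P (fun lam o => F lam (n2 o)).
Proof. exact: tame_comp. Qed.

Lemma tame_word_prod w v : Pall (tame L pi) w -> Pall (tame L pi) v ->
  tame L P (word_prod w v).
Proof.
move=> tw tv; apply: (tameM Pp).
  by apply: (tame_n1 (F := fun lam => cword pi lam w)); exact: tame_word.
by apply: (tame_n2 (F := fun lam => cword pi lam v)); exact: tame_word.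
Qed.

Lemma word_cov_cons lam h w v : L lam -> tame L pi h -> Pall (tame L pi) w -> Pall (tame L pi) v ->
  word_cov lam (h :: w) v = \sum_(p <- splits v) pairingL lam h p.1 * word_cov lam w p.2.
Proof.
move=> ll th tw tv; have [r1 r2 r3] := rate1_rsum ll th.
have l0 : 0 < lam by have := L1 ll; lra.
have [P0 P1] := Pp ll.
rewrite /word_cov /cword /= (wick_pairing l0 P0 (fun x => a0 x ll) (fun j => q0 j ll) (mk ll) r1 r2 r3).
- by rewrite splits_map big_map.
- exact: (tame_asummable Pp ll (tame_word_prod tw tv)).
- rewrite splits_map Pall_map; apply: Pall_impl (Pall_splits tv) => p [t1 t2 _] /=.
  split; first exact: rate12_asummable.
  exact: (tame_asummable Pp ll (tame_word_prod tw t2)).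
Qed.

Lemma rsum_marg2 lam (F : R -> fs I -> R) : L lam -> tame L (ppp pi) F ->
  rsum (fun o => P lam o * F lam (n2 o)) = rsum (fun N => ppp pi lam N * F lam N).
Proof.
move=> ll tF; have [P0 P1] := Pp ll; have [p0 p1] := ppp_prob L1 pip ll.
have e := marg2 ll (@ppart_ge0 _ _ (F lam)); have e' := marg2 ll (@npart_ge0 _ _ (F lam)).
have sP := tame_asummable Pp ll (tame_n2 tF).
have m0 T (b : T -> R) (g : T -> R) : (forall x, 0 <= b x) -> (forall x, 0 <= g x) -> forall x, 0 <= b x * g x.
  by move=> b0 g0 x; exact: mulr_ge0.
have fp : (psum (fun o => (P lam o * ppart (F lam) (n2 o))%R) < +oo)%E.
  apply: le_lt_trans sP; apply: le_psum => o; rewrite normrM ger0_norm// ler_wpM2l//.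
  by rewrite abs_parts lerDl npart_ge0.
have fn : (psum (fun o => (P lam o * npart (F lam) (n2 o))%R) < +oo)%E.
  apply: le_lt_trans sP; apply: le_psum => o; rewrite normrM ger0_norm// ler_wpM2l//.
  by rewrite abs_parts lerDr ppart_ge0.
have pp0 := @ppart_ge0 _ _ (F lam); have np0 := @npart_ge0 _ _ (F lam).
rewrite (rsum_eq (m0 _ _ _ P0 (fun j => pp0 (n2 j))) (m0 _ _ _ P0 (fun j => np0 (n2 j))) fp fn
   (f := fun o => P lam o * F lam (n2 o))); last first.
  by move=> z; rewrite -mulrBr -ppart_npart.
rewrite e in fp *; rewrite e' in fn *.
rewrite (rsum_eq (m0 _ _ _ p0 pp0) (m0 _ _ _ p0 np0) fp fn (f := fun N => ppp pi lam N * F lam N))//.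
by move=> z; rewrite -mulrBr -ppart_npart.
Qed.

Lemma word_cov_nil_cons lam g v : L lam -> tame L pi g -> Pall (tame L pi) v -> word_cov lam [::] (g :: v) = 0.
Proof.
move=> ll tg tv; rewrite -(word_mean0 L1 pip ll tg tv) -(rsum_marg2 (F := fun lam => cword pi lam (g :: v)))//; last exact: tame_word.
by apply: eq_rsum => z; rewrite mul1r.
Qed.

Lemma word_cov_nil lam : L lam -> word_cov lam [::] [::] = 1.
Proof.
move=> ll; have [P0 P1] := Pp ll.
rewrite /word_cov (eq_rsum (g := P lam)); last by move=> z; rewrite !mulr1.
by rewrite rsum_ge0E// P1.
Qed.

Lemma word_cov_one lam h g : L lam -> tame L pi h -> tame L pi g -> word_cov lam [:: h] [:: g] = pairingL lam h g.
Proof. by move=> ll th tg; rewrite word_cov_cons//= big_cons big_nil addr0 word_cov_nil// mulr1. Qed.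

Lemma word_cov_cons_nil lam h w : L lam -> tame L pi h -> Pall (tame L pi) w -> word_cov lam (h :: w) [::] = 0.
Proof. by move=> ll th tw; rewrite word_cov_cons//= big_nil. Qed.

Definition mulf h g : R -> I -> R := fun lam x => h lam x * g lam x.

(** Each product of two first chaoses splits into orders 2, 1 and 0, and chaoses of different orders
    are uncorrelated. Order 0 gives the means, order 2 the two ways of matching the letters, order 1
    the remainder in [lam^-1]. *)
Lemma four_point lam h1 h2 g1 g2 : L lam ->
  tame L pi h1 -> tame L pi h2 -> tame L pi g1 -> tame L pi g2 ->
  rsum (fun o => P lam o * ((cword pi lam [:: h1] (n1 o) * cword pi lam [:: h2] (n1 o)) *
                         (cword pi lam [:: g1] (n2 o) * cword pi lam [:: g2] (n2 o)))) =
  mean (pi lam) (mulf h1 h2 lam) * mean (pi lam) (mulf g1 g2 lam) +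
  pairingL lam h1 g1 * pairingL lam h2 g2 + pairingL lam h1 g2 * pairingL lam h2 g1 +
  lam^-1 * pairingL lam (mulf h1 h2) (mulf g1 g2).
Proof.
move=> ll t1 t2 u1 u2.
have l0 : 0 < lam by have := L1 ll; lra.
have sgE := sg_sqr l0; have sn0 := sg_neq0 l0; move: sgE sn0; set sg := Num.sqrt lam => sgE sn0.
have t12 : tame L pi (mulf h1 h2) by exact: (tameM pip).
have u12 : tame L pi (mulf g1 g2) by exact: (tameM pip).
set m := mean _ _; set m' := mean _ _.
have prod x y N : cword pi lam [:: x] N * cword pi lam [:: y] N =
    cword pi lam [:: x; y] N + sg^-1 * cword pi lam [:: mulf x y] N + mean (pi lam) (mulf x y lam).
  exact: wick_pair_prod.
pose e w v o := P lam o * (cword pi lam w (n1 o) * cword pi lam v (n2 o)).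
have se w v : Pall (tame L pi) w -> Pall (tame L pi) v -> asummable (e w v).
  by move=> tw tv; exact: (tame_asummable Pp ll (tame_word_prod tw tv)).
have T0 : Pall (tame L pi) [::] by [].
have Tw2 : Pall (tame L pi) [:: h1; h2] by [].
have Tw1 : Pall (tame L pi) [:: mulf h1 h2] by [].
have Tv2 : Pall (tame L pi) [:: g1; g2] by [].
have Tv1 : Pall (tame L pi) [:: mulf g1 g2] by [].
rewrite (eq_rsum (g := fun o => (e [:: h1; h2] [:: g1; g2] o + sg^-1 * e [:: h1; h2] [:: mulf g1 g2] o + m' * e [:: h1; h2] [::] o) +
  (sg^-1 * (e [:: mulf h1 h2] [:: g1; g2] o) + sg^-1 * sg^-1 * e [:: mulf h1 h2] [:: mulf g1 g2] o + sg^-1 * m' * e [:: mulf h1 h2] [::] o) +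
  (m * e [::] [:: g1; g2] o + m * sg^-1 * e [::] [:: mulf g1 g2] o + m * m' * e [::] [::] o))); last first.
  have c0 N : cword pi lam [::] N = 1 by [].
  by move=> z; rewrite !prod -/m -/m' /e !c0; ring.
have Z c w v : Pall (tame L pi) w -> Pall (tame L pi) v -> asummable (fun o => c * e w v o).
  by move=> tw tv; apply: asummableZ; exact: se.
have A (x y z : Omega -> R) : asummable x -> asummable y -> asummable z -> asummable (fun o : Omega => x o + y o + z o).
  by move=> sx sy sz; apply: asummableD => //; exact: asummableD.
have SA (x y z : Omega -> R) : asummable x -> asummable y -> asummable z -> rsum (fun o : Omega => x o + y o + z o) = rsum x + rsum y + rsum z.
  by move=> sx sy sz; rewrite rsumD ?rsumD//; exact: asummableD.
have b1 := A _ _ _ (se _ _ Tw2 Tv2) (Z sg^-1 _ _ Tw2 Tv1) (Z m' _ _ Tw2 T0).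
have b2 := A _ _ _ (Z sg^-1 _ _ Tw1 Tv2) (Z (sg^-1 * sg^-1) _ _ Tw1 Tv1) (Z (sg^-1 * m') _ _ Tw1 T0).
have b3 := A _ _ _ (Z m _ _ T0 Tv2) (Z (m * sg^-1) _ _ T0 Tv1) (Z (m * m') _ _ T0 T0).
rewrite (SA _ _ _ b1 b2 b3).
rewrite (SA _ _ _ (se _ _ Tw2 Tv2) (Z sg^-1 _ _ Tw2 Tv1) (Z m' _ _ Tw2 T0)).
rewrite (SA _ _ _ (Z sg^-1 _ _ Tw1 Tv2) (Z (sg^-1 * sg^-1) _ _ Tw1 Tv1) (Z (sg^-1 * m') _ _ Tw1 T0)).
rewrite (SA _ _ _ (Z m _ _ T0 Tv2) (Z (m * sg^-1) _ _ T0 Tv1) (Z (m * m') _ _ T0 T0)).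
have SE' c w v : Pall (tame L pi) w -> Pall (tame L pi) v -> rsum (fun o => c * e w v o) = c * word_cov lam w v.
  by move=> tw tv; rewrite rsumZ//; exact: se.
rewrite !SE'// -[rsum (e _ _)]/(word_cov lam [:: h1; h2] [:: g1; g2]).
rewrite (word_cov_cons_nil ll t1 (w := [:: h2]))// (word_cov_cons_nil ll t12 (w := [::]))//.
rewrite (word_cov_nil_cons ll u1 (v := [:: g2]))// (word_cov_nil_cons ll u12 (v := [::]))// word_cov_nil//.
rewrite (word_cov_cons ll t1 (w := [:: h2]) (v := [:: g1; g2]))//= !big_cons big_nil /= !word_cov_one//.
rewrite (word_cov_cons ll t1 (w := [:: h2]) (v := [:: mulf g1 g2]))//= big_cons big_nil /= word_cov_cons_nil//.
rewrite (word_cov_cons ll t12 (w := [::]) (v := [:: g1; g2]))//= !big_cons big_nil /= !word_cov_nil_cons//.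
by rewrite -sgE invfM; ring.
Qed.

(** The product of the factorials of the multiplicities of the letters, that is, the number of
    permutations of positions fixing the word. *)
Fixpoint wfact (B : eqType) (w : seq B) : nat :=
  if w is b :: w' then ((count_mem b w').+1 * wfact w')%N else 1%N.

Lemma splits_perm (B : eqType) (v : seq B) p : p \in splits v -> perm_eq v (p.1 :: p.2).
Proof.
elim: v p => [//|x v ih] p /=; rewrite inE => /orP[/eqP -> //|/mapP[p' /ih h ->]] /=.
by rewrite -(perm_cons x) in h; apply: perm_trans h _; apply/permP => P' /=; rewrite addnCA.
Qed.

Lemma splits_count (B : eqType) (v : seq B) b :
  (\sum_(p <- splits v) (p.1 == b) = count_mem b v)%N.
Proof.
by elim: v => [|x v ih] /=; rewrite ?big_nil// big_cons big_map /= ih.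
Qed.

(** Iterated integration by parts sums over all matchings of the letters of [w] with those of [v];
    orthogonality keeps those matching equal letters. When [v] permutes [b :: w], the head [b] has
    [count_mem b w + 1] partners, whence [wfact]. *)
Lemma word_cov_orth (B : eqType) (e : B -> R -> I -> R) (sigma : R -> B -> R) lam (w v : seq B) : L lam ->
  (forall b, tame L pi (e b)) ->
  (forall b c, pairingL lam (e b) (e c) = (b == c)%:R * sigma lam b) ->
  word_cov lam (map e w) (map e v) = (perm_eq w v)%:R * (wfact w)%:R * \prod_(b <- w) sigma lam b.
Proof.
move=> ll te Qe.
have Tm u : Pall (tame L pi) (map e u) by elim: u => //= x u ih; split.
elim: w v => [|b w ih] v.
  rewrite big_nil mulr1 /= mulr1; case: v => [|c v] /=; first by rewrite word_cov_nil.
  rewrite word_cov_nil_cons// (_ : perm_eq [::] (c :: v) = false)//.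
  by apply/negP => /perm_size.
rewrite map_cons word_cov_cons// splits_map big_map big_cons [wfact _]/=.
transitivity (\sum_(p <- splits v) (p.1 == b)%:R * ((perm_eq (b :: w) v)%:R * (wfact w)%:R * (sigma lam b * \prod_(j <- w) sigma lam j))).
  apply: eq_big_seq => -[c u] /splits_perm /= h.
  rewrite Qe ih eq_sym; case: eqP => [e'|_]; last by rewrite !mul0r.
  rewrite !mul1r (_ : perm_eq (b :: w) v = perm_eq w u); first by ring.
  rewrite -e' in h *; rewrite -(perm_cons c w u); apply/idP/idP => hh.
    exact: perm_trans hh h.
  by apply: perm_trans hh _; rewrite perm_sym.
rewrite -mulr_suml -natr_sum splits_count.
have [h|_] := boolP (perm_eq (b :: w) v); last by rewrite !mul0r mulr0.
by rewrite -(permP h) /= eqxx add1n natrM; ring.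
Qed.

End PairLaw.

(** The depth is put before [lam], so that a law is a family indexed by [lam], as [tame] and
    [isprob] expect. *)
Definition gwf {R : realType} (d : nat) (lam : R) : X d -> R := @gw R lam d.
Definition cmf {R : realType} (s : R) (d : nat) (lam : R) : X d * X d -> R := @cm R lam s d.
Arguments gwf {R} d lam _.
Arguments cmf {R} s d lam _.

(** * The Galton-Watson and correlated laws as instances of the abstract pair law *)

Section Instances.
Variable R : realType.

Definition Lge1 (lam : R) : Prop := 1 <= lam.

Lemma Lge1P (lam : R) : Lge1 lam -> 1 <= lam. Proof. by []. Qed.
Lemma Lge1_gt0 (lam : R) : Lge1 lam -> 0 < lam. Proof. by rewrite /Lge1 => h; lra. Qed.

Lemma gwf_prob d : isprob Lge1 (gwf d).
Proof.
move=> lam /Lge1_gt0 l0; split; first by move=> t; exact: gw_ge0.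
exact: psum_gw.
Qed.

Section GWLaw.
Variable d : nat.
(** A single tree is paired with itself: every point is matched, so the unmatched intensity is zero
    and the pairing becomes the scalar product of L^2. *)
Let a (lam : R) (x : X d) : R := 0.
Let q (lam : R) (x : X d) : R := lam * gwf d lam x.

Lemma gwl_a0 lam (x : X d) : Lge1 lam -> 0 <= a lam x. Proof. by []. Qed.
Lemma gwl_q0 lam (x : X d) : Lge1 lam -> 0 <= q lam x.
Proof. by move=> /Lge1_gt0 l0; rewrite mulr_ge0 ?gw_ge0// ltW. Qed.
Lemma gwl_mk lam : Lge1 lam -> mecke (gwf d.+1 lam) id id (a lam) id id (q lam).
Proof. by move=> /Lge1_gt0 l0; exact: gw_mecke. Qed.
Lemma gwl_rate1 lam (g : X d -> R) : Lge1 lam -> (forall x, 0 <= g x) ->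
  (psum (fun x => (a lam x * g x)%R) + psum (fun j => (q lam j * g (id j))%R) =
   lam%:E * psum (fun x => (gwf d lam x * g x)%R))%E.
Proof.
move=> /Lge1_gt0 l0 g0; rewrite (eq_psum (g := fun=> 0)) ?psum0 ?add0e; last by move=> x; rewrite mul0r.
rewrite -psumZ ?ltW//; last by move=> x; rewrite mulr_ge0 ?gw_ge0.
by apply: eq_psum => x; rewrite /q mulrA.
Qed.
Lemma gwl_rate2 lam (g : X d -> R) : Lge1 lam -> (forall x, 0 <= g x) ->
  (psum (fun j => (q lam j * g (id j))%R) <= lam%:E * psum (fun x => (gwf d lam x * g x)%R))%E.
Proof.
move=> ll g0; rewrite -gwl_rate1// (eq_psum (f := fun x => a lam x * g x) (g := fun=> 0)) ?psum0 ?add0e//.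
by move=> x; rewrite mul0r.
Qed.

Lemma gw_pairing lam (h g : R -> X d -> R) : Lge1 lam -> tame Lge1 (gwf d) h -> tame Lge1 (gwf d) g ->
  pairingL id id q lam h g = mean (gwf d lam) (mulf h g lam).
Proof.
move=> ll th tg; have l0 := Lge1_gt0 ll.
rewrite /pairingL /pairing /mean (eq_rsum (g := fun x => lam * (gwf d lam x * mulf h g lam x))); last first.
  by move=> x; rewrite /q /mulf /=; ring.
rewrite rsumZ ?mulrA ?mulVf ?mul1r ?gt_eqF//.
exact: (tame_asummable (gwf_prob d) (f := mulf h g) ll (tameM (gwf_prob d) th tg)).
Qed.

Lemma gw_four lam (h1 h2 g1 g2 : R -> X d -> R) : Lge1 lam ->
  tame Lge1 (gwf d) h1 -> tame Lge1 (gwf d) h2 -> tame Lge1 (gwf d) g1 -> tame Lge1 (gwf d) g2 ->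
  let m x y := mean (gwf d lam) (mulf x y lam) in
  rsum (fun N => gwf d.+1 lam N * ((cword (gwf d) lam [:: h1] N * cword (gwf d) lam [:: h2] N) *
                         (cword (gwf d) lam [:: g1] N * cword (gwf d) lam [:: g2] N))) =
  m h1 h2 * m g1 g2 + m h1 g1 * m h2 g2 + m h1 g2 * m h2 g1 +
  lam^-1 * m (mulf h1 h2) (mulf g1 g2).
Proof.
move=> ll t1 t2 u1 u2 m.
rewrite (four_point Lge1P (gwf_prob d) (gwf_prob d.+1) gwl_a0 gwl_q0 gwl_mk gwl_rate1 gwl_rate2)//.
by rewrite !gw_pairing//; exact: (tameM (gwf_prob d)).
Qed.

Lemma gw_word_cov_one lam (h g : R -> X d -> R) : Lge1 lam ->
  tame Lge1 (gwf d) h -> tame Lge1 (gwf d) g ->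
  rsum (fun N => gwf d.+1 lam N * (cword (gwf d) lam [:: h] N * cword (gwf d) lam [:: g] N)) =
  mean (gwf d lam) (mulf h g lam).
Proof.
move=> ll th tg; rewrite -gw_pairing//.
exact: (word_cov_one Lge1P (gwf_prob d) (gwf_prob d.+1) gwl_a0 gwl_q0 gwl_mk gwl_rate1 gwl_rate2).
Qed.

Lemma gw_word_cov_orth (e : X d -> R -> X d -> R) lam (w v : seq (X d)) : Lge1 lam ->
  (forall b, tame Lge1 (gwf d) (e b)) ->
  (forall b c, mean (gwf d lam) (mulf (e b) (e c) lam) = (b == c)%:R) ->
  rsum (fun N => gwf d.+1 lam N * (cword (gwf d) lam (map e w) N * cword (gwf d) lam (map e v) N)) =
  (perm_eq w v)%:R * (wfact w)%:R.
Proof.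
move=> ll te he.
have := @word_cov_orth _ _ _ _ Lge1P (gwf_prob d) _ _ _ _ _ _ _ _ _ (gwf_prob d.+1) gwl_a0 gwl_q0 gwl_mk gwl_rate1 gwl_rate2 _ _ _ e (fun _ _ => 1) lam w v ll te.
rewrite big1_eq mulr1; apply => // b c.
by rewrite gw_pairing// he mulr1.
Qed.

End GWLaw.

Section CMLaw.
Variable s : R.
Hypotheses (s0 : 0 <= s) (s1 : s <= 1).

Lemma cmf_prob d : isprob Lge1 (cmf s d).
Proof.
move=> lam /Lge1_gt0 l0; split; first by move=> t; exact: cm_ge0.
exact: psum_cm.
Qed.

Lemma cmf_fst d lam (g : X d -> R) : Lge1 lam -> (forall x, 0 <= g x) ->
  psum (fun k => cmf s d lam k * g k.1) = psum (fun x => gwf d lam x * g x).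
Proof. by move=> /Lge1_gt0 l0 g0; exact: psum_cm_fst. Qed.
Lemma cmf_snd d lam (g : X d -> R) : Lge1 lam -> (forall x, 0 <= g x) ->
  psum (fun k => cmf s d lam k * g k.2) = psum (fun x => gwf d lam x * g x).
Proof. by move=> /Lge1_gt0 l0 g0; exact: psum_cm_snd. Qed.

Variable d : nat.
Let a (lam : R) (x : X d) : R := lam * (1 - s) * gwf d lam x.
Let q (lam : R) (k : X d * X d) : R := lam * s * cmf s d lam k.

Lemma cml_a0 lam (x : X d) : Lge1 lam -> 0 <= a lam x.
Proof. by move=> /Lge1_gt0 l0; rewrite mulr_ge0 ?gw_ge0// mulr_ge0 ?subr_ge0// ltW. Qed.
Lemma cml_q0 lam (x : X d * X d) : Lge1 lam -> 0 <= q lam x.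
Proof. by move=> /Lge1_gt0 l0; rewrite mulr_ge0 ?cm_ge0// mulr_ge0// ltW. Qed.
Lemma cml_mk lam : Lge1 lam -> mecke (cmf s d.+1 lam) fst snd (a lam) fst snd (q lam).
Proof. by move=> /Lge1_gt0 l0; exact: cm_mecke1. Qed.

Lemma cml_qpsum lam (g : X d * X d -> R) : Lge1 lam -> (forall x, 0 <= g x) ->
  psum (fun j => q lam j * g j) = ((lam * s)%:E * psum (fun k => (cmf s d lam k * g k)%R))%E.
Proof.
move=> /Lge1_gt0 l0 g0; rewrite -psumZ; last 2 first.
- by rewrite mulr_ge0// ltW.
- by move=> k; rewrite mulr_ge0// cm_ge0.
by apply: eq_psum => k; rewrite /q mulrA.
Qed.

Lemma cml_rate1 lam (g : X d -> R) : Lge1 lam -> (forall x, 0 <= g x) ->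
  (psum (fun x => (a lam x * g x)%R) + psum (fun j => (q lam j * g j.1)%R) =
   lam%:E * psum (fun x => (gwf d lam x * g x)%R))%E.
Proof.
move=> ll g0; have l0 := Lge1_gt0 ll.
rewrite (cml_qpsum ll (g := fun j => g j.1))// cmf_fst//.
rewrite (eq_psum (g := fun x => lam * (1 - s) * (gwf d lam x * g x))); last by move=> x; rewrite /a mulrA.
rewrite psumZ; last 2 first.
- by rewrite mulr_ge0 ?subr_ge0// ltW.
- by move=> x; rewrite mulr_ge0 ?gw_ge0.
rewrite -ge0_muleDl ?lee_fin ?mulr_ge0 ?subr_ge0 ?(ltW l0)//.
by rewrite -EFinD; congr (_%:E * _)%E; ring.
Qed.

Lemma cml_rate2 lam (g : X d -> R) : Lge1 lam -> (forall x, 0 <= g x) ->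
  (psum (fun j => (q lam j * g j.2)%R) <= lam%:E * psum (fun x => (gwf d lam x * g x)%R))%E.
Proof.
move=> ll g0; have l0 := Lge1_gt0 ll.
rewrite (cml_qpsum ll (g := fun j => g j.2))// cmf_snd//.
apply: lee_wpmul2r.
  by apply: psum_ge0 => x; rewrite mulr_ge0 ?gw_ge0.
by rewrite lee_fin ler_piMr// ltW.
Qed.

Definition pair_cov (lam : R) (h g : R -> X d -> R) : R :=
  rsum (fun k => cmf s d lam k * (h lam k.1 * g lam k.2)).

Lemma tame_fst dd (h : R -> X dd -> R) : tame Lge1 (gwf dd) h -> tame Lge1 (cmf s dd) (fun lam k => h lam k.1).
Proof. by apply: tame_comp => lam g ll g0; exact: cmf_fst. Qed.
Lemma tame_snd dd (h : R -> X dd -> R) : tame Lge1 (gwf dd) h -> tame Lge1 (cmf s dd) (fun lam k => h lam k.2).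
Proof. by apply: tame_comp => lam g ll g0; exact: cmf_snd. Qed.

(** The factor [s] is the fraction of matched children; the covariance one level below accounts for
    the rest. *)
Lemma cm_pairing lam (h g : R -> X d -> R) : Lge1 lam -> tame Lge1 (gwf d) h -> tame Lge1 (gwf d) g ->
  pairingL fst snd q lam h g = s * pair_cov lam h g.
Proof.
move=> ll th tg; have l0 := Lge1_gt0 ll.
rewrite /pairingL /pairing /pair_cov (eq_rsum (g := fun k => lam * s * (cmf s d lam k * (h lam k.1 * g lam k.2)))); last first.
  by move=> x; rewrite /q -!mulrA.
rewrite rsumZ; first by rewrite -mulrA mulKf// gt_eqF.
exact: (tame_asummable (cmf_prob d) (f := fun lam k => h lam k.1 * g lam k.2) ll
  (tameM (cmf_prob d) (tame_fst th) (tame_snd tg))).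
Qed.

Lemma cm_four lam (h1 h2 g1 g2 : R -> X d -> R) : Lge1 lam ->
  tame Lge1 (gwf d) h1 -> tame Lge1 (gwf d) h2 -> tame Lge1 (gwf d) g1 -> tame Lge1 (gwf d) g2 ->
  let m x y := mean (gwf d lam) (mulf x y lam) in
  rsum (fun t => cmf s d.+1 lam t * ((cword (gwf d) lam [:: h1] t.1 * cword (gwf d) lam [:: h2] t.1) *
                         (cword (gwf d) lam [:: g1] t.2 * cword (gwf d) lam [:: g2] t.2))) =
  m h1 h2 * m g1 g2 + (s * pair_cov lam h1 g1) * (s * pair_cov lam h2 g2) + (s * pair_cov lam h1 g2) * (s * pair_cov lam h2 g1) +
  lam^-1 * (s * pair_cov lam (mulf h1 h2) (mulf g1 g2)).
Proof.
move=> ll t1 t2 u1 u2 m.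
rewrite (four_point Lge1P (gwf_prob d) (cmf_prob d.+1) cml_a0 cml_q0 cml_mk cml_rate1 cml_rate2 (@cmf_fst d.+1) (@cmf_snd d.+1))//.
by rewrite !cm_pairing//; exact: (tameM (gwf_prob d)).
Qed.

Lemma cm_word_cov_one lam (h g : R -> X d -> R) : Lge1 lam ->
  tame Lge1 (gwf d) h -> tame Lge1 (gwf d) g ->
  rsum (fun t => cmf s d.+1 lam t * (cword (gwf d) lam [:: h] t.1 * cword (gwf d) lam [:: g] t.2)) =
  s * pair_cov lam h g.
Proof.
move=> ll th tg; rewrite -cm_pairing//.
exact: (word_cov_one Lge1P (gwf_prob d) (cmf_prob d.+1) cml_a0 cml_q0 cml_mk cml_rate1 cml_rate2 (@cmf_fst d.+1) (@cmf_snd d.+1)).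
Qed.

Lemma cm_word_cov_orth (e : X d -> R -> X d -> R) (sigma : X d -> R) lam (w v : seq (X d)) : Lge1 lam ->
  (forall b, tame Lge1 (gwf d) (e b)) ->
  (forall b c, s * pair_cov lam (e b) (e c) = (b == c)%:R * sigma b) ->
  rsum (fun t => cmf s d.+1 lam t * (cword (gwf d) lam (map e w) t.1 * cword (gwf d) lam (map e v) t.2)) =
  (perm_eq w v)%:R * (wfact w)%:R * \prod_(b <- w) sigma b.
Proof.
move=> ll te he.
have := @word_cov_orth _ _ _ _ Lge1P (gwf_prob d) _ _ _ _ _ _ _ _ _ (cmf_prob d.+1) cml_a0 cml_q0 cml_mk cml_rate1 cml_rate2 (@cmf_fst d.+1) (@cmf_snd d.+1) _ e (fun _ => sigma) lam w v ll te.
by apply => b c; rewrite cm_pairing// he.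
Qed.

End CMLaw.

End Instances.

Section Words.
Variable I : choiceType.

(** The children of the root listed with multiplicity; the order comes from the enumeration of the
    support. *)
Definition word (N : fs I) : seq I := flatten [seq nseq (N x) x | x <- finsupp N].

Lemma count_word N x : count_mem x (word N) = N x.
Proof.
rewrite /word count_flatten -map_comp sumnE big_map.
rewrite (eq_bigr (fun y => (N y * (y == x))%N)); last by move=> y _; rewrite /= count_nseq mulnC.
case: (boolP (x \in finsupp N)) => xN.
  rewrite (big_fsetD1 _ xN)/= eqxx muln1 big1_fset ?addn0// => y; rewrite !inE => /andP[/negbTE -> _] _.
  by rewrite muln0.
rewrite big_seq big1 ?fsfun_dflt// => y yN.
by case: eqP => [e|_]; rewrite ?muln0//; rewrite -e yN in xN.
Qed.

(** Turns the [perm_eq] of [word_cov_orth] into equality of trees, so that orthogonality can be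
    iterated along the depth. *)
Lemma word_perm N N' : perm_eq (word N) (word N') = (N == N').
Proof.
apply/idP/eqP => [/permP h|->//]; apply/fsfunP => x.
by rewrite -!count_word h.
Qed.

Lemma big_word (T : Type) (idx : T) (op : Monoid.law idx) (F : I -> T) N :
  \big[op/idx]_(x <- word N) F x = \big[op/idx]_(x <- finsupp N) iterop (N x) op (F x) idx.
Proof.
by rewrite /word big_flatten big_map; apply: eq_bigr => x _; rewrite big_nseq -Monoid.iteropE.
Qed.

End Words.

(** * The Fock basis and the base test *)

Section FockBasis.
Variable R : realType.

(** By [word_cov_orth] the chaos of an orthonormal word has squared norm [wfact], hence the
    divisor. *)
Fixpoint fock (d : nat) : X d -> R -> X d -> R :=
  match d return X d -> R -> X d -> R with
  | 0 => fun _ _ _ => 1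
  | d'.+1 => fun b lam N =>
      cword (gwf d') lam (map (@fock d') (word b)) N / Num.sqrt (wfact (word b))%:R
  end.

Lemma wfact_gt0 (B : eqType) (w : seq B) : (0 < wfact w)%N.
Proof. by elim: w => //= b w ih; rewrite muln_gt0. Qed.

Lemma nodes_gt0 d (t : X d) : (0 < nodes t)%N.
Proof. by case: d t. Qed.

Lemma Pall_mapT (T U : Type) (Q : U -> Prop) (f : T -> U) w : (forall x, Q (f x)) -> Pall Q (map f w).
Proof. by move=> h; elim: w => //= x w ih; split. Qed.

Lemma tame_fock d (b : X d) : tame (@Lge1 R) (gwf d) (fock b).
Proof.
elim: d b => [|d ih] b.
  by apply: (tame_bdd (gwf_prob 0) (B := 1)) => lam x _ /=; rewrite normr1.
have h := tameZ (gwf_prob d.+1) (c := fun=> (Num.sqrt (wfact (word b))%:R)^-1 : R)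
  (fun _ _ => lexx _) (tame_word (@Lge1P R) (gwf_prob d) (Pall_mapT (word b) ih)).
by apply: tame_ext h => lam _ N /=; rewrite mulrC.
Qed.

Lemma fock_scale (c c' : R) (T : choiceType) (P f g : T -> R) :
  asummable (fun x => P x * (f x * g x)) ->
  rsum (fun x => P x * ((f x / c) * (g x / c'))) = rsum (fun x => P x * (f x * g x)) / (c * c').
Proof.
move=> h; rewrite mulrC -rsumZ//; apply: eq_rsum => x; rewrite invfM; ring.
Qed.

Lemma fock_norm (d : nat) (b c : X d.+1) :
  (b == c)%:R * (wfact (word b))%:R / (Num.sqrt (wfact (word b))%:R * Num.sqrt (wfact (word c))%:R) = (b == c)%:R :> R.
Proof.
case: eqP => [<-|_]; last by rewrite !mul0r.
by rewrite -expr2 sqr_sqrtr// mul1r divff// pnatr_eq0 -lt0n wfact_gt0.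
Qed.

Lemma fock_orth_gw d lam (b c : X d) : Lge1 lam ->
  mean (gwf d lam) (mulf (fock b) (fock c) lam) = (b == c)%:R.
Proof.
move=> ll; elim: d b c => [|d ih] b c.
  rewrite /mean rsum_ge0E; last by move=> x; rewrite /mulf /= !mul1r.
  rewrite (@psum_single _ _ tt); [|by rewrite /mulf /= !mul1r|by case].
  by rewrite /mulf /= !mul1r; case: b c => -[].
pose cw (u : X d.+1) := cword (gwf d) lam (map (@fock d) (word u)).
pose nf (u : X d.+1) : R := Num.sqrt (wfact (word u))%:R.
transitivity (rsum (fun N => gwf d.+1 lam N * ((cw b N / nf b) * (cw c N / nf c)))); first by [].
rewrite (@fock_scale _ _ _ (gwf d.+1 lam) (cw b) (cw c)).
  by rewrite (gw_word_cov_orth _ _ ll (@tame_fock d) ih) word_perm fock_norm.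
apply: (tame_asummable (gwf_prob d.+1) (f := fun lam x => cword (gwf d) lam (map (@fock d) (word b)) x * cword (gwf d) lam (map (@fock d) (word c)) x) ll).
by apply: (tameM (gwf_prob d.+1)); apply: (tame_word (@Lge1P R) (gwf_prob d)); exact: Pall_mapT (@tame_fock d).
Qed.

(** A child [b'] contributes [s * s^(nodes b' - 1) = s^(nodes b')]; the product over the children
    has as exponent the number of nodes other than the root. *)
Lemma fock_orth_cm s d lam (b c : X d) : 0 <= s -> s <= 1 -> Lge1 lam ->
  pair_cov s lam (fock b) (fock c) = (b == c)%:R * s ^+ (nodes b).-1.
Proof.
move=> s0 s1 ll; elim: d b c => [|d ih] b c.
  rewrite /pair_cov rsum_ge0E; last by move=> x; rewrite /= !mul1r.
  rewrite (@psum_single _ _ (tt, tt)); [|by rewrite /= !mul1r|by case=> -[] []].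
  by rewrite /= !mul1r; case: b c => -[].
have te := @tame_fock d.
pose cw (u : X d.+1) := cword (gwf d) lam (map (@fock d) (word u)).
pose nf (u : X d.+1) : R := Num.sqrt (wfact (word u))%:R.
transitivity (rsum (fun t => cmf s d.+1 lam t * ((cw b t.1 / nf b) * (cw c t.2 / nf c)))); first by [].
rewrite (@fock_scale _ _ _ (cmf s d.+1 lam) (fun t => cw b t.1) (fun t => cw c t.2)).
  rewrite (cm_word_cov_orth s0 s1 (sigma := fun b => s ^+ nodes b) _ _ ll te); last first.
    move=> b' c'; rewrite ih mulrCA; congr (_ * _).
    by rewrite -exprS prednK// nodes_gt0.
  rewrite word_perm big_word (eq_bigr (fun x => s ^+ (b x * nodes x))); last first.
    by move=> x _; rewrite mulnC exprM.
  by rewrite prodrXr mulrAC /nf fock_norm.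
apply: (tame_asummable (cmf_prob s0 s1 d.+1) (f := fun lam t => cword (gwf d) lam (map (@fock d) (word b)) t.1 * cword (gwf d) lam (map (@fock d) (word c)) t.2) ll).
apply: (tameM (cmf_prob s0 s1 d.+1)).
  apply: (tame_fst s0 s1 (dd := d.+1) (h := fun lam => cword (gwf d) lam (map (@fock d) (word b)))).
  by apply: (tame_word (@Lge1P R) (gwf_prob d)); exact: Pall_mapT te.
apply: (tame_snd s0 s1 (dd := d.+1) (h := fun lam => cword (gwf d) lam (map (@fock d) (word c)))).
by apply: (tame_word (@Lge1P R) (gwf_prob d)); exact: Pall_mapT te.
Qed.

End FockBasis.

(** * Test statistics and their moments *)

Section Moments.
Variable R : realType.

Lemma markov_even (T : choiceType) (P W : T -> R) k (c : R) : (forall x, 0 <= P x) -> 0 < c ->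
  (psum P < +oo)%E -> asummable (fun x => P x * W x ^+ (2 * k)) ->
  rsum (fun x => P x * (c <= W x)%R%:R) <= rsum (fun x => P x * W x ^+ (2 * k)) / c ^+ (2 * k).
Proof.
move=> P0 c0 Poo sW; rewrite ler_pdivlMr ?exprn_gt0// mulrC -rsumZ; last first.
  apply: le_asummable Poo => x; rewrite ger0_norm ?mulr_ge0// ler_piMr//.
  by rewrite lern1 leq_b1.
apply: le_rsum => [|//|x].
  apply: asummableZ; apply: le_asummable Poo => x; rewrite ger0_norm ?mulr_ge0// ler_piMr//.
  by rewrite lern1 leq_b1.
rewrite mulrCA ler_wpM2l//.
case: (leP c (W x)) => h; last by rewrite mulr0 pow_even_ge0.
by rewrite mulr1; apply: lerXn2r => //; rewrite nnegrE ltW// (lt_le_trans c0).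
Qed.

(** Falling below [m / 2] is a deviation of at least half the mean, which produces the factor 4. *)
Lemma chebyshev_lower (T : choiceType) (P W : T -> R) (m := rsum (fun x => P x * W x)) : (forall x, 0 <= P x) -> psum P = 1%E ->
  asummable (fun x => P x * W x) -> asummable (fun x => P x * W x ^+ 2) ->
  0 < m ->
  1 - 4 * (rsum (fun x => P x * W x ^+ 2) - m ^+ 2) / m ^+ 2 <= rsum (fun x => P x * (m / 2 <= W x)%R%:R).
Proof.
move=> P0 P1 s1 s2 m0.
have Poo : (psum P < +oo)%E by rewrite P1 ltry.
have sP : asummable P by rewrite asummable_ge0.
have SP : rsum P = 1 by rewrite rsum_ge0E// P1.
have si : asummable (fun x => P x * (m / 2 <= W x)%R%:R).
  apply: le_asummable Poo => x; rewrite ger0_norm ?mulr_ge0// ler_piMr//.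
  by rewrite lern1 leq_b1.
rewrite lerBlDr -[leLHS]SP.
(* The expanded form of [4 (W - m)^2 / m^2], which dominates the indicator of [W < m / 2]. *)
pose V x := 4 / m ^+ 2 * (P x * W x ^+ 2 + (m ^+ 2 * P x - 2 * m * (P x * W x))).
have sV1 : asummable (fun x => m ^+ 2 * P x - 2 * m * (P x * W x)).
  by apply: asummableD; [exact: asummableZ|apply: asummableN; exact: asummableZ].
have sV : asummable V by apply: asummableZ; exact: asummableD.
have SV : rsum V = 4 * (rsum (fun x => P x * W x ^+ 2) - m ^+ 2) / m ^+ 2.
  rewrite rsumZ; last exact: asummableD.
  rewrite rsumD// rsumB; [|exact: asummableZ|exact: asummableZ].
  by rewrite !rsumZ// SP -/m; ring.
rewrite -SV -rsumD//; apply: le_rsum => //; first exact: asummableD.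
move=> x; have -> : V x = P x * (4 / m ^+ 2 * (W x - m) ^+ 2) by rewrite /V; ring.
rewrite -mulrDr -{1}[P x]mulr1 ler_wpM2l//.
have q0 : 0 <= 4 / m ^+ 2 * (W x - m) ^+ 2.
  by rewrite mulr_ge0 ?sqr_ge0// divr_ge0// sqr_ge0.
case: (leP (m / 2) (W x)) => h; first by rewrite lerDl.
rewrite add0r mulrAC ler_pdivlMr ?exprn_gt0// mul1r; nra.
Qed.

Definition lin_chaos d (h : R -> X d -> R) (lam : R) : X d.+1 -> R := cword (gwf d) lam [:: h].

(** Two families and an arbitrary index type, so that one set of moment formulas serves both stages:
    the Fock basis indexed by trees, and indicators indexed by pairs. *)
Definition stat d (T : Type) (r : seq T) (u v : T -> R -> X d -> R) (lam : R) (t : X d.+1 * X d.+1) : R :=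
  \sum_(j <- r) lin_chaos (u j) lam t.1 * lin_chaos (v j) lam t.2.

Definition null_pmf d (lam : R) (t : X d * X d) : R := gwf d lam t.1 * gwf d lam t.2.

Lemma null_prob d : isprob (@Lge1 R) (@null_pmf d).
Proof.
move=> lam ll; have [p0 p1] := gwf_prob d ll.
split; first by move=> t; exact: mulr_ge0.
by rewrite (psum_prod (f := gwf d lam) (g := gwf d lam))// p1 ?mule1// ltry.
Qed.

Lemma null_fst d lam (g : X d -> R) : Lge1 lam -> (forall x, 0 <= g x) ->
  psum (fun k => null_pmf lam k * g k.1) = psum (fun x => gwf d lam x * g x).
Proof.
move=> ll g0; have [p0 p1] := gwf_prob d ll.
rewrite (eq_psum (g := fun k => (gwf d lam k.1 * g k.1) * gwf d lam k.2)); last by move=> k; rewrite /null_pmf; ring.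
rewrite (psum_prod (f := fun x => gwf d lam x * g x) (g := gwf d lam))// ?p1 ?mule1 ?ltry//.
by move=> x; exact: mulr_ge0.
Qed.

Lemma null_snd d lam (g : X d -> R) : Lge1 lam -> (forall x, 0 <= g x) ->
  psum (fun k => null_pmf lam k * g k.2) = psum (fun x => gwf d lam x * g x).
Proof.
move=> ll g0; rewrite psum_swap (eq_psum (g := fun k => null_pmf lam k * g k.1)) ?null_fst//.
by move=> k; rewrite /null_pmf; ring.
Qed.

Section Statistic.
Variables (d : nat) (T : Type) (r : seq T) (u v : T -> R -> X d -> R).
Hypotheses (tu : forall j, tame (@Lge1 R) (gwf d) (u j)) (tv : forall j, tame (@Lge1 R) (gwf d) (v j)).
Variable lam : R.
Hypothesis ll : Lge1 lam.

Lemma tame_lin_chaos h : tame (@Lge1 R) (gwf d) h -> tame (@Lge1 R) (gwf d.+1) (lin_chaos h).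
Proof. by move=> th; apply: (tame_word (@Lge1P R) (gwf_prob d)) => /=. Qed.

Lemma Pall_all (U : Type) (Q : U -> Prop) (w : seq U) : (forall x, Q x) -> Pall Q w.
Proof. by move=> h; elim: w. Qed.

Lemma tame_stat (P : R -> X d.+1 * X d.+1 -> R) : isprob (@Lge1 R) P ->
  (forall lam' (g : X d.+1 -> R), Lge1 lam' -> (forall x, 0 <= g x) ->
    psum (fun k => P lam' k * g k.1) = psum (fun x => gwf d.+1 lam' x * g x)) ->
  (forall lam' (g : X d.+1 -> R), Lge1 lam' -> (forall x, 0 <= g x) ->
    psum (fun k => P lam' k * g k.2) = psum (fun x => gwf d.+1 lam' x * g x)) ->
  tame (@Lge1 R) P (stat r u v).
Proof.
move=> Pp h1 h2; apply: (tame_sum Pp (F := fun j lam t => lin_chaos (u j) lam t.1 * lin_chaos (v j) lam t.2)).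
apply: Pall_all => j; apply: (tameM Pp).
  exact: (tame_comp (n := fst) h1 (tame_lin_chaos (tu j))).
exact: (tame_comp (n := snd) h2 (tame_lin_chaos (tv j))).
Qed.

Let mm (h g : R -> X d -> R) := mean (gwf d lam) (mulf h g lam).

Lemma stat_null2 : rsum (fun t => null_pmf lam t * stat r u v lam t ^+ 2) =
  \sum_(j <- r) \sum_(k <- r) mm (u j) (u k) * mm (v j) (v k).
Proof.
have ty j k : tame (@Lge1 R) (gwf d.+1) (fun lam x => lin_chaos (u j) lam x * lin_chaos (u k) lam x).
  by apply: (tameM (gwf_prob d.+1)); exact: tame_lin_chaos.
have tz j k : tame (@Lge1 R) (gwf d.+1) (fun lam x => lin_chaos (v j) lam x * lin_chaos (v k) lam x).
  by apply: (tameM (gwf_prob d.+1)); exact: tame_lin_chaos.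
pose F j k (t : X d.+1 * X d.+1) := (gwf d.+1 lam t.1 * (lin_chaos (u j) lam t.1 * lin_chaos (u k) lam t.1)) *
  (gwf d.+1 lam t.2 * (lin_chaos (v j) lam t.2 * lin_chaos (v k) lam t.2)).
have sF j k : asummable (F j k).
  exact: asummable_prod (tame_asummable (gwf_prob d.+1) ll (ty j k)) (tame_asummable (gwf_prob d.+1) ll (tz j k)).
rewrite (eq_rsum (g := fun t => \sum_(j <- r) \sum_(k <- r) F j k t)); last first.
  move=> t; rewrite expr2 /stat mulr_suml mulr_sumr; apply: eq_bigr => j _.
  by rewrite mulr_sumr mulr_sumr; apply: eq_bigr => k _; rewrite /F /null_pmf; ring.
rewrite rsum_sum; last by move=> j _; exact: asummable_sum.
apply: eq_bigr => j _; rewrite rsum_sum//; apply: eq_bigr => k _.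
rewrite (rsum_prod (tame_asummable (gwf_prob d.+1) ll (ty j k)) (tame_asummable (gwf_prob d.+1) ll (tz j k))).
by rewrite /lin_chaos !gw_word_cov_one.
Qed.

Variable s : R.
Hypotheses (s0 : 0 <= s) (s1 : s <= 1).

Lemma stat_cm1 : rsum (fun t => cmf s d.+1 lam t * stat r u v lam t) = \sum_(j <- r) s * pair_cov s lam (u j) (v j).
Proof.
have h j : tame (@Lge1 R) (cmf s d.+1) (fun lam t => lin_chaos (u j) lam t.1 * lin_chaos (v j) lam t.2).
  apply: (tameM (cmf_prob s0 s1 d.+1)).
    by apply: (tame_fst s0 s1 (h := lin_chaos (u j))); exact: tame_lin_chaos.
  by apply: (tame_snd s0 s1 (h := lin_chaos (v j))); exact: tame_lin_chaos.
rewrite (eq_rsum (g := fun t => \sum_(j <- r) cmf s d.+1 lam t * (lin_chaos (u j) lam t.1 * lin_chaos (v j) lam t.2))); last first.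
  by move=> t; rewrite /stat mulr_sumr.
rewrite rsum_sum => [|j _]; last exact: (tame_asummable (cmf_prob s0 s1 d.+1) ll (h j)).
by apply: eq_bigr => j _; rewrite /lin_chaos cm_word_cov_one.
Qed.

Lemma stat_cm2 : rsum (fun t => cmf s d.+1 lam t * stat r u v lam t ^+ 2) =
  \sum_(j <- r) \sum_(k <- r)
   (mm (u j) (u k) * mm (v j) (v k) + (s * pair_cov s lam (u j) (v j)) * (s * pair_cov s lam (u k) (v k)) +
    (s * pair_cov s lam (u j) (v k)) * (s * pair_cov s lam (u k) (v j)) +
    lam^-1 * (s * pair_cov s lam (mulf (u j) (u k)) (mulf (v j) (v k)))).
Proof.
pose F j k lam (t : X d.+1 * X d.+1) := (lin_chaos (u j) lam t.1 * lin_chaos (u k) lam t.1) * (lin_chaos (v j) lam t.2 * lin_chaos (v k) lam t.2).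
have tF j k : tame (@Lge1 R) (cmf s d.+1) (F j k).
  apply: (tameM (cmf_prob s0 s1 d.+1)).
    apply: (tame_fst s0 s1 (h := fun lam x => lin_chaos (u j) lam x * lin_chaos (u k) lam x)).
    by apply: (tameM (gwf_prob d.+1)); exact: tame_lin_chaos.
  apply: (tame_snd s0 s1 (h := fun lam x => lin_chaos (v j) lam x * lin_chaos (v k) lam x)).
  by apply: (tameM (gwf_prob d.+1)); exact: tame_lin_chaos.
have sF j k := tame_asummable (cmf_prob s0 s1 d.+1) ll (tF j k).
rewrite (eq_rsum (g := fun t => \sum_(j <- r) \sum_(k <- r) cmf s d.+1 lam t * F j k lam t)); last first.
  move=> t; rewrite expr2 /stat mulr_suml mulr_sumr; apply: eq_bigr => j _.
  by rewrite mulr_sumr mulr_sumr; apply: eq_bigr => k _; rewrite /F; ring.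
rewrite rsum_sum; last by move=> j _; apply: asummable_sum => k _; exact: sF.
apply: eq_bigr => j _; rewrite rsum_sum; last by move=> k _; exact: sF.
by apply: eq_bigr => k _; rewrite /F /lin_chaos cm_four.
Qed.

End Statistic.

End Moments.

Section Base.
Variable R : realType.

Definition null_mass d (lam : R) (T : X d * X d -> bool) : R := rsum (fun t => null_pmf lam t * (T t)%:R).
Definition corr_mass d (s lam : R) (T : X d * X d -> bool) : R := rsum (fun t => cmf s d lam t * (T t)%:R).

Lemma sum_bound T (r : seq T) (L : R -> Prop) (f : T -> R -> R) :
  (forall j, exists C, forall lam, L lam -> f j lam <= C) ->
  exists C, forall lam, L lam -> \sum_(j <- r) f j lam <= C.
Proof.
move=> h; elim: r => [|j r [C hC]]; first by exists 0 => lam _; rewrite big_nil.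
by have [D hD] := h j; exists (D + C) => lam ll; rewrite big_cons lerD ?hC ?hD.
Qed.

Lemma sum_eqop (T : eqType) (r : seq T) (f : T -> R) b : uniq r -> b \in r ->
  \sum_(c <- r) (b == c)%:R * f c = f b.
Proof.
move=> ur br; rewrite (bigD1_seq b)//= eqxx mul1r big1 ?addr0// => c.
by rewrite eq_sym => /negbTE ->; rewrite mul0r.
Qed.

(** With [A] trees and [q = s^(d+1)], Markov's inequality bounds the null mass by [4 / (A q^2)], and
    Chebyshev's loses at most [4 * 3 A / (A q)^2 = 12 / (A q^2)]. The two lower bounds on [A q^2]
    make these at most [eps] and 1/4. *)
Lemma base_test (s : R) d (B : seq (X d)) (eps : R) : 0 < s -> s <= 1 -> uniq B ->
  (forall b, b \in B -> nodes b = d.+1) ->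
  0 < eps -> 4 / eps <= (size B)%:R * s ^+ (2 * d.+1) -> 64 <= (size B)%:R * s ^+ (2 * d.+1) ->
  exists lam1 : R, forall lam, 1 <= lam -> lam1 <= lam ->
  exists T : X d.+1 * X d.+1 -> bool, null_mass lam T <= eps /\ 3 / 4 <= corr_mass s lam T.
Proof.
move=> s0 s1 uB nB e0; set A := (size B)%:R => hA1 hA2.
have s0' := ltW s0.
have A1 : 1 <= A.
  rewrite /A ler1n lt0n; apply/eqP => B0; move: hA2; rewrite /A B0 mul0r; lra.
have te := @tame_fock R d.
have tm b c : tame (@Lge1 R) (gwf d) (mulf (fock b) (fock c)) by apply: (tameM (gwf_prob d)).
(* The only part of the variance that is not explicit. Since [B] is fixed, tameness bounds it
   uniformly in [lam], and its prefactor [lam^-1] then makes it negligible. *)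
have [C hC] : exists C, forall lam, Lge1 lam ->
   \sum_(b <- B) \sum_(c <- B) pair_cov s lam (mulf (fock b) (fock c)) (mulf (fock b) (fock c)) <= C.
  apply: (@sum_bound _ B (@Lge1 R) (fun b lam => \sum_(c <- B) pair_cov s lam (mulf (fock b) (fock c)) (mulf (fock b) (fock c)))) => b.
  apply: (@sum_bound _ B (@Lge1 R) (fun c lam => pair_cov s lam (mulf (fock b) (fock c)) (mulf (fock b) (fock c)))) => c.
  have [D hD] := tame_meanB (cmf_prob s0' s1 d) (f := fun lam t => mulf (fock b) (fock c) lam t.1 * mulf (fock b) (fock c) lam t.2)
    (tameM (cmf_prob s0' s1 d) (tame_fst s0' s1 (tm b c)) (tame_snd s0' s1 (tm b c))).
  by exists D => lam ll; apply: le_trans (hD _ ll); rewrite ler_norm.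
exists (`|C| + 1) => lam l1 lC.
have ll : Lge1 lam by [].
have l0 := Lge1_gt0 ll.
set q := s ^+ d.+1.
have q0 : 0 < q by rewrite exprn_gt0.
have qq : s ^+ (2 * d.+1) = q ^+ 2 by rewrite mulnC exprM.
have q1 : q <= 1 by rewrite exprn_ile1.
rewrite qq in hA1 hA2.
have sumc (z : R) : \sum_(b <- B) z = A * z.
  by rewrite big_const_seq count_predT iter_addr_0 mulr_natl.
have Eq b c : b \in B -> s * pair_cov s lam (fock b) (fock c) = (b == c)%:R * q.
  by move=> bB; rewrite fock_orth_cm// nB// mulrCA -exprS.
have m1 : rsum (fun t => cmf s d.+1 lam t * stat B (@fock R d) (@fock R d) lam t) = A * q.
  rewrite (stat_cm1 _ te te ll s0' s1) -sumc; apply: eq_big_seq => b bB.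
  by rewrite Eq// eqxx mul1r.
have n2 : rsum (fun t => null_pmf lam t * stat B (@fock R d) (@fock R d) lam t ^+ 2) = A.
  rewrite (stat_null2 _ te te ll) -[RHS]mulr1 -sumc; apply: eq_big_seq => b bB.
  under eq_bigr do rewrite fock_orth_gw//.
  by rewrite (sum_eqop (fun c => (b == c)%:R))// eqxx.
set D := \sum_(b <- B) \sum_(c <- B) pair_cov s lam (mulf (fock b) (fock c)) (mulf (fock b) (fock c)).
have m2 : rsum (fun t => cmf s d.+1 lam t * stat B (@fock R d) (@fock R d) lam t ^+ 2) =
   A + (A * q) ^+ 2 + A * q ^+ 2 + lam^-1 * s * D.
  rewrite (stat_cm2 _ te te ll s0' s1).
  (* By orthogonality, the four terms of [cm_four] give the diagonal, the square of the mean, the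
     crossed matching (diagonal again) and the remainder. *)
  transitivity (\sum_(b <- B) (1 + A * q ^+ 2 + q ^+ 2 + lam^-1 * s * \sum_(c <- B) pair_cov s lam (mulf (fock b) (fock c)) (mulf (fock b) (fock c)))).
    apply: eq_big_seq => b bB; rewrite 3!big_split/=; congr (_ + _ + _ + _).
    - under eq_bigr do rewrite fock_orth_gw//.
      by rewrite (sum_eqop (fun c => (b == c)%:R))// eqxx.
    - rewrite -sumc; apply: eq_big_seq => c cB.
      by rewrite !Eq// !eqxx !mul1r expr2.
    - transitivity (\sum_(c <- B) (b == c)%:R * q ^+ 2); last by rewrite (sum_eqop (fun=> q ^+ 2)).
      apply: eq_big_seq => c cB; rewrite !Eq// [c == b]eq_sym.
      by case: (b == c); rewrite ?mul0r// !mul1r expr2.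
    - by rewrite mulr_sumr; apply: eq_bigr => c _; rewrite mulrA.
  rewrite 3!big_split/= !sumc -mulr_sumr -/D; ring.
have DC : D <= `|C| by apply: le_trans (hC _ ll) (ler_norm _).
have Aq0 : 0 < A * q by rewrite mulr_gt0//; lra.
have [N0 N1] := null_prob d.+1 ll; have [P0 P1] := cmf_prob s0' s1 d.+1 ll.
have tWn := tame_stat B te te (@null_prob R d.+1) (@null_fst R d.+1) (@null_snd R d.+1).
have tWc := tame_stat B te te (cmf_prob s0' s1 d.+1) (cmf_fst s0' s1 (d := d.+1)) (cmf_snd s0' s1 (d := d.+1)).
have sn2 := tame_asummable (@null_prob R d.+1) ll (tame_pow (@null_prob R d.+1) 2 tWn).
have sc1 := tame_asummable (cmf_prob s0' s1 d.+1) ll tWc.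
have sc2 := tame_asummable (cmf_prob s0' s1 d.+1) ll (tame_pow (cmf_prob s0' s1 d.+1) 2 tWc).
have Aq2 : 0 < A * q ^+ 2 by rewrite mulr_gt0 ?exprn_gt0//; lra.
exists (fun t => A * q / 2 <= stat B (@fock R d) (@fock R d) lam t); split.
  apply: le_trans (markov_even (k := 1) N0 _ _ sn2) _.
  - by rewrite divr_gt0.
  - by rewrite N1 ltry.
  rewrite muln1 n2 (_ : A / (A * q / 2) ^+ 2 = 4 / (A * q ^+ 2)); last first.
    by field; rewrite !gt_eqF//; lra.
  by rewrite ler_pdivrMr// mulrC -ler_pdivrMr.
have := chebyshev_lower P0 P1 sc1 sc2; rewrite m1 => /(_ Aq0); apply: le_trans.
rewrite m2 (_ : A + _ + _ + _ - _ = A + A * q ^+ 2 + lam^-1 * s * D); last by ring.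
suff : 4 * (A + A * q ^+ 2 + lam^-1 * s * D) / (A * q) ^+ 2 <= 1 / 4 by lra.
have q2 : q ^+ 2 <= 1 by rewrite exprn_ile1// ltW.
have h3 : lam^-1 * s * D <= A.
  apply: (@le_trans _ _ (lam^-1 * `|C|)).
    rewrite -mulrA ler_wpM2l ?invr_ge0 ?(ltW l0)//.
    apply: (@le_trans _ _ (s * `|C|)); first by rewrite ler_wpM2l.
    by rewrite ler_piMl.
  by apply: (@le_trans _ _ 1) => //; rewrite mulrC ler_pdivrMr//; lra.
have h4 : A + A * q ^+ 2 + lam^-1 * s * D <= 3 * A.
  have : A * q ^+ 2 <= A by rewrite ler_piMr//; lra.
  by lra.
rewrite ler_pdivrMr ?exprn_gt0// exprMn.
(* The numerator is at most [12 A], and [A q^2 >= 64] leaves [12 / 64 <= 1 / 4]. *)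
have h5 : 64 * A <= A ^+ 2 * q ^+ 2 by rewrite expr2 -mulrA mulrC ler_wpM2l//; lra.
by lra.
Qed.

End Base.

(** * The bootstrap *)

Section Boot.
Variable R : realType.

Lemma sum_le_psum (T : choiceType) (F : seq T) (f : T -> R) : uniq F -> (forall x, 0 <= f x) ->
  ((\sum_(k <- F) f k)%:E <= psum f)%E.
Proof.
move=> uF f0; apply: esum_ge; exists [set` [fset x in F]%fset]; first by split.
rewrite fsbig_finite//= set_fsetK sumEFin lee_fin.
rewrite le_eqVlt; apply/orP; left; apply/eqP.
rewrite [RHS](perm_big F)//=.
by apply: uniq_perm => // x; rewrite inE.
Qed.

Lemma rsum_single (T : choiceType) (x0 : T) (f : T -> R) : (forall x, x != x0 -> f x = 0) -> rsum f = f x0.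
Proof.
move=> h; rewrite rsumE.
have [p|n] := leP 0 (f x0).
  rewrite (@psum_single _ _ x0)/=; [|exact: ppart_ge0|by move=> x /h; rewrite /ppart => ->; rewrite maxxx].
  rewrite (@psum_single _ _ x0)/=; [|exact: npart_ge0|by move=> x /h; rewrite /npart => ->; rewrite oppr0 maxxx].
  by rewrite -ppart_npart.
rewrite (@psum_single _ _ x0)/=; [|exact: ppart_ge0|by move=> x /h; rewrite /ppart => ->; rewrite maxxx].
rewrite (@psum_single _ _ x0)/=; [|exact: npart_ge0|by move=> x /h; rewrite /npart => ->; rewrite oppr0 maxxx].
by rewrite -ppart_npart.
Qed.

Definition ind d (a : X d) : R -> X d -> R := fun _ x => (x == a)%:R.

Lemma tame_ind d (a : X d) : tame (@Lge1 R) (gwf d) (ind a).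
Proof.
apply: (tame_bdd (gwf_prob d) (B := 1)) => lam x _.
by rewrite ger0_norm// /ind lern1 leq_b1.
Qed.

Lemma mean_ind d lam (a : X d) (g : X d -> R) : mean (gwf d lam) (fun x => (x == a)%:R * g x) = gwf d lam a * g a.
Proof.
rewrite /mean (rsum_single (x0 := a)); first by rewrite eqxx mul1r.
by move=> x /negbTE ->; rewrite mul0r mulr0.
Qed.

Lemma mm_ind d lam (a b : X d) : mean (gwf d lam) (mulf (ind a) (ind b) lam) = (a == b)%:R * gwf d lam a.
Proof. by rewrite /mulf /ind mean_ind mulrC. Qed.

Lemma pair_cov_single s d lam (a b : X d) (g h : X d -> R) (u v : R -> X d -> R) :
  (forall x, u lam x = (x == a)%:R * g x) -> (forall x, v lam x = (x == b)%:R * h x) ->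
  pair_cov s lam u v = cmf s d lam (a, b) * (g a * h b).
Proof.
move=> hu hv; rewrite /pair_cov (rsum_single (x0 := (a, b))) /=; first by rewrite hu hv !eqxx !mul1r.
case=> x y; rewrite xpair_eqE negb_and /= hu hv => /orP[] /negbTE ->.
  by rewrite !mul0r mulr0.
by rewrite mul0r !mulr0.
Qed.

Lemma pair_cov_ind s d lam (a b : X d) : pair_cov s lam (ind a) (ind b) = cmf s d lam (a, b).
Proof.
rewrite (@pair_cov_single s d lam a b (fun=> 1) (fun=> 1)) ?mulr1// => x; by rewrite mulr1.
Qed.

Lemma pair_cov_ind2 s d lam (j k : X d * X d) :
  pair_cov s lam (mulf (ind j.1) (ind k.1)) (mulf (ind j.2) (ind k.2)) = (j == k)%:R * cmf s d lam j.
Proof.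
rewrite (@pair_cov_single s d lam j.1 j.2 (fun x => (x == k.1)%:R) (fun x => (x == k.2)%:R))//.
rewrite -natrM mulnb mulrC; case: j k => [j1 j2] [k1 k2]; rewrite xpair_eqE //.
Qed.

Section Step.
Variables (s lam : R) (d : nat) (F : seq (X d * X d)).
Hypotheses (s0 : 0 < s) (s1 : s <= 1) (ll : Lge1 lam) (uF : uniq F).

Let u (k : X d * X d) := ind k.1.
Let v (k : X d * X d) := ind k.2.
Let e : R := \sum_(k <- F) gwf d lam k.1 * gwf d lam k.2.
Let p : R := \sum_(k <- F) cmf s d lam k.
Definition boot_stat := stat F u v lam.

Let tu k : tame (@Lge1 R) (gwf d) (u k). Proof. exact: tame_ind. Qed.
Let tv k : tame (@Lge1 R) (gwf d) (v k). Proof. exact: tame_ind. Qed.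
Let s0' : 0 <= s. Proof. exact: ltW. Qed.
Let g0 x : 0 <= gwf d lam x. Proof. by have [] := gwf_prob d ll. Qed.
Let c0 x : 0 <= cmf s d lam x. Proof. by have [] := cmf_prob s0' s1 d ll. Qed.

Lemma boot_cm1 : rsum (fun t => cmf s d.+1 lam t * boot_stat t) = s * p.
Proof.
rewrite (stat_cm1 _ tu tv ll s0' s1) mulr_sumr; apply: eq_bigr => k _.
by rewrite pair_cov_ind -surjective_pairing.
Qed.

(** Extended from [F] to all pairs, the sum factorises into the two marginals of the correlated
    law. *)
Lemma cross_le (j : X d * X d) :
  \sum_(k <- F) cmf s d lam (j.1, k.2) * cmf s d lam (k.1, j.2) <= gwf d lam j.1 * gwf d lam j.2.
Proof.
rewrite -lee_fin; apply: le_trans (sum_le_psum (f := fun k => cmf s d lam (j.1, k.2) * cmf s d lam (k.1, j.2)) uF _) _.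
  by move=> k; rewrite mulr_ge0.
have [_ _ m1 m2] := cm_facts (Lge1_gt0 ll) s0' s1 d.
rewrite psum_swap (psum_prod (f := fun y => cmf s d lam (j.1, y)) (g := fun x => cmf s d lam (x, j.2)))//.
  by rewrite /cmf m1 m2.
by rewrite /cmf m2 ltry.
Qed.

(** The diagonal contributes [e], the crossed matching at most [e] by [cross_le], and the remainder
    [lam^-1 * s * p], because products of indicators collapse to the diagonal. *)
Lemma boot_cm2 : rsum (fun t => cmf s d.+1 lam t * boot_stat t ^+ 2) - (s * p) ^+ 2 <= 2 * e + lam^-1.
Proof.
have l0 := Lge1_gt0 ll.
rewrite (stat_cm2 _ tu tv ll s0' s1).
rewrite (_ : \sum_(j <- F) _ = \sum_(j <- F) (gwf d lam j.1 * gwf d lam j.2 + s * cmf s d lam j * (s * p) +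
   s ^+ 2 * (\sum_(k <- F) cmf s d lam (j.1, k.2) * cmf s d lam (k.1, j.2)) + lam^-1 * s * cmf s d lam j)); last first.
  apply: eq_big_seq => j jF; rewrite 3!big_split/=; congr (_ + _ + _ + _).
  - transitivity (\sum_(k <- F) (j == k)%:R * (gwf d lam j.1 * gwf d lam j.2)); last first.
      by rewrite (sum_eqop (fun=> gwf d lam j.1 * gwf d lam j.2)).
    apply: eq_bigr => k _; rewrite !mm_ind (_ : (j == k) = (j.1 == k.1) && (j.2 == k.2)); last first.
      by case: j {jF} k => [? ?] [? ?]; rewrite xpair_eqE.
    by rewrite -mulnb natrM; ring.
  - rewrite /p !mulr_sumr; apply: eq_bigr => k _.
    by rewrite !pair_cov_ind -!surjective_pairing.
  - rewrite mulr_sumr; apply: eq_bigr => k _; rewrite !pair_cov_ind; ring.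
  - transitivity (\sum_(k <- F) (j == k)%:R * (lam^-1 * s * cmf s d lam j)); last first.
      by rewrite (sum_eqop (fun=> lam^-1 * s * cmf s d lam j)).
    by apply: eq_bigr => k _; rewrite pair_cov_ind2; ring.
rewrite 3!big_split/= -/e.
have -> : \sum_(j <- F) s * cmf s d lam j * (s * p) = (s * p) ^+ 2.
  by rewrite -mulr_suml -mulr_sumr -/p expr2.
have -> : \sum_(j <- F) lam^-1 * s * cmf s d lam j = lam^-1 * s * p by rewrite -mulr_sumr.
have p1 : p <= 1.
  rewrite -lee_fin; apply: le_trans (sum_le_psum (f := cmf s d lam) uF c0) _.
  by have [_ ->] := cmf_prob s0' s1 d ll.
have p0 : 0 <= p by apply: sumr_ge0 => k _; exact: c0.
have h1 : \sum_(j <- F) s ^+ 2 * (\sum_(k <- F) cmf s d lam (j.1, k.2) * cmf s d lam (k.1, j.2)) <= e.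
  apply: ler_sum => j _; apply: (@le_trans _ _ (1 * (gwf d lam j.1 * gwf d lam j.2))); last by rewrite mul1r.
  apply: ler_pM.
  - exact: sqr_ge0.
  - by apply: sumr_ge0 => k _; rewrite mulr_ge0.
  - by rewrite exprn_ile1.
  - exact: cross_le.
have h2 : lam^-1 * s * p <= lam^-1.
  rewrite -mulrA ler_piMr ?invr_ge0 ?(ltW l0)//.
  by rewrite -[1](mulr1 1) ler_pM.
lra.
Qed.

(** Nonnegativity of the quadratic polynomial [C - 2 c B + c^2 A] at its minimum [c = B / A]; if
    [A = 0], all the weights [P] vanish along [r]. *)
Lemma cauchy_weighted (T : eqType) (r : seq T) (P w x : T -> R) :
  (forall a, 0 <= P a) -> (forall a, 0 < w a) ->
  (\sum_(a <- r) P a * x a) ^+ 2 <= (\sum_(a <- r) P a * w a) * (\sum_(a <- r) P a * (x a ^+ 2 / w a)).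
Proof.
move=> P0 w0; set A := \sum_(a <- r) P a * w a; set B := \sum_(a <- r) _; set C := \sum_(a <- r) _.
have A0 : 0 <= A by apply: sumr_ge0 => a _; rewrite mulr_ge0// ltW.
have q c : 0 <= C - 2 * c * B + c ^+ 2 * A.
  rewrite /A /B /C !mulr_sumr -sumrB -big_split/=; apply: sumr_ge0 => a _.
  have -> : P a * (x a ^+ 2 / w a) - 2 * c * (P a * x a) + c ^+ 2 * (P a * w a) = P a * ((x a - c * w a) ^+ 2 / w a).
    by field; rewrite gt_eqF.
  by rewrite mulr_ge0// divr_ge0 ?sqr_ge0// ltW.
have [A1|] := ltP 0 A; last first.
  move=> A1; have Az : A = 0 by apply/eqP; rewrite eq_le A1.
  have Pz a : a \in r -> P a = 0.
    move=> ar; have : P a * w a = 0.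
      apply/eqP; move/eqP: Az; rewrite /A psumr_eq0; last by move=> b _; rewrite mulr_ge0// ltW.
      by move=> /allP /(_ a ar).
    by move/eqP; rewrite mulf_eq0 (gt_eqF (w0 a)) orbF => /eqP.
  rewrite Az mul0r (_ : B = 0) ?expr0n// /B big_seq big1// => a /Pz ->; by rewrite mul0r.
have := q (B / A).
have -> : C - 2 * (B / A) * B + (B / A) ^+ 2 * A = C - B ^+ 2 / A by field; rewrite gt_eqF.
by rewrite subr_ge0 ler_pdivrMr// mulrC.
Qed.

Lemma lin_chaos_sum (T : Type) (r : seq T) (c : T -> R) (h : T -> R -> X d -> R) (N : X d.+1) :
  (forall j, tame (@Lge1 R) (gwf d) (h j)) ->
  lin_chaos (fun lam' x => \sum_(j <- r) c j * h j lam' x) lam N = \sum_(j <- r) c j * lin_chaos (h j) lam N.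
Proof.
move=> th; have l0 := Lge1_gt0 ll.
rewrite /lin_chaos /cword /= -/(wick lam (gwf d lam) [:: _]).
rewrite -[LHS]/(wick lam (gwf d lam) [:: fun x => \sum_(j <- r) c j * h j lam x] N) wick1E.
rewrite (eq_bigr (fun j => c j * ((\sum_(x <- finsupp N) (N x)%:R * h j lam x - lam * mean (gwf d lam) (h j lam)) / Num.sqrt lam))); last first.
  by move=> j _; rewrite -wick1E.
rewrite (_ : mean _ _ = \sum_(j <- r) c j * mean (gwf d lam) (h j lam)); last first.
  rewrite /mean (eq_rsum (g := fun x => \sum_(j <- r) c j * (gwf d lam x * h j lam x))); last first.
    by move=> x; rewrite mulr_sumr; apply: eq_bigr => j _; ring.
  rewrite rsum_sum; last by move=> j _; apply: asummableZ; exact: (tame_asummable (gwf_prob d) ll (th j)).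
  by apply: eq_bigr => j _; rewrite rsumZ//; exact: (tame_asummable (gwf_prob d) ll (th j)).
rewrite (_ : \sum_(x <- finsupp N) _ = \sum_(j <- r) c j * \sum_(x <- finsupp N) (N x)%:R * h j lam x); last first.
  under eq_bigr do rewrite mulr_sumr.
  rewrite exchange_big/=; apply: eq_bigr => j _; rewrite mulr_sumr; apply: eq_bigr => x _; ring.
rewrite mulr_sumr -sumrB mulr_suml; apply: eq_bigr => j _; ring.
Qed.

Let A1 := undup [seq k.1 | k <- F].
(** Indicator of the section of [F] above [a]. The coefficient [1] gives it the shape required by
    [lin_chaos_sum]. *)
Let V (a : X d) : R -> X d -> R := fun lam' y => \sum_(k <- [seq k <- F | k.1 == a]) 1 * ind k.2 lam' y.
Let al (a : X d) : R := \sum_(k <- F | k.1 == a) gwf d lam k.2.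

Let tV a : tame (@Lge1 R) (gwf d) (V a).
Proof.
apply: (tame_sum (gwf_prob d) (F := fun (k : X d * X d) lam' y => 1 * ind k.2 lam' y)); apply: Pall_all => k.
by apply: tame_ext (tame_ind k.2) => lam' _ y; rewrite mul1r.
Qed.

(** [F] has no duplicates, so [V a] takes the values 0 and 1; its even moments are therefore all
    equal to its mean [al a]. *)
Lemma V_idem a y : V a lam y * V a lam y = V a lam y.
Proof.
suff [->|->] : V a lam y = 0 \/ V a lam y = 1 by rewrite ?mul0r ?mulr1.
rewrite /V; have [h|h] := boolP ((a, y) \in F).
  right; rewrite (bigD1_seq (a, y)) /=; last 2 first.
  - by rewrite mem_filter /= eqxx.
  - exact: filter_uniq.
  rewrite /ind eqxx mulr1 big_seq_cond big1 ?addr0// => -[b z]; rewrite mem_filter /= => /andP[/andP[/eqP -> _]].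
  by rewrite xpair_eqE eqxx /= eq_sym => /negbTE ->; rewrite mulr0.
left; rewrite big_seq big1// => -[b z]; rewrite mem_filter /= => /andP[/eqP ba bzF].
rewrite /ind; case: eqP => [yz|]; last by rewrite mulr0.
by rewrite -ba yz bzF in h.
Qed.

Lemma mean_V a : mean (gwf d lam) (V a lam) = al a.
Proof.
rewrite /mean (eq_rsum (g := fun x => \sum_(k <- F | k.1 == a) gwf d lam x * ind k.2 lam x)); last first.
  by move=> x; rewrite /V big_filter mulr_sumr; apply: eq_bigr => k _; rewrite mul1r.
rewrite rsum_sum; last by move=> k _; exact: (tame_asummable (gwf_prob d) ll (tame_ind k.2)).
apply: eq_bigr => k _; rewrite (rsum_single (x0 := k.2)) /ind ?eqxx ?mulr1// => x /negbTE ->.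
by rewrite mulr0.
Qed.

Lemma fst_sum (G : X d * X d -> R) : \sum_(k <- F) G k = \sum_(a <- A1) \sum_(k <- F | k.1 == a) G k.
Proof.
rewrite (exchange_big_dep xpredT)//= big_seq [RHS]big_seq; apply: eq_bigr => k kF.
have kA : k.1 \in A1 by rewrite mem_undup; apply/mapP; exists k.
rewrite big_mkcond; transitivity (\sum_(a <- A1) (k.1 == a)%:R * G k).
  by rewrite (sum_eqop (fun=> G k))// undup_uniq.
by apply: eq_bigr => a _; case: eqP; rewrite ?mul1r ?mul0r.
Qed.

Lemma sum_pi_al : \sum_(a <- A1) gwf d lam a * al a = e.
Proof.
rewrite /e fst_sum; apply: eq_bigr => a _; rewrite mulr_sumr.
by apply: eq_bigr => k /eqP ->.
Qed.

Lemma al_le1 a : al a <= 1.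
Proof.
rewrite /al -big_filter.
have un : uniq [seq k.2 | k <- [seq k <- F | k.1 == a]].
  rewrite map_inj_in_uniq ?filter_uniq// => -[x y] [x' y']; rewrite !mem_filter /=.
  by move=> /andP[/eqP -> _] /andP[/eqP -> _] ->.
rewrite -(big_map snd xpredT (gwf d lam)) -lee_fin; apply: le_trans (sum_le_psum un g0) _.
by have [_ ->] := gwf_prob d ll.
Qed.

Lemma al_ge0 a : 0 <= al a. Proof. by apply: sumr_ge0 => k _. Qed.

(** Grouping by the first coordinate exhibits the statistic, for a fixed second tree, as a linear
    combination of first chaoses of the first tree. *)
Lemma boot_stat_rows t : boot_stat t = \sum_(a <- A1) lin_chaos (V a) lam t.2 * lin_chaos (ind a) lam t.1.
Proof.
rewrite /boot_stat /stat fst_sum; apply: eq_bigr => a _.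
rewrite (lin_chaos_sum _ (fun=> 1) (h := fun k : X d * X d => ind k.2)); last by move=> k; exact: tame_ind.
rewrite big_filter mulr_suml; apply: eq_bigr => k /eqP <-; rewrite /u /v; ring.
Qed.

(** The Gaussian value [3 sigma^4] from the three pairings of four letters, plus a Poisson
    correction of order [1 / lam]. *)
Lemma lin_chaos_four h : tame (@Lge1 R) (gwf d) h ->
  rsum (fun N => gwf d.+1 lam N * lin_chaos h lam N ^+ 4) =
  3 * mean (gwf d lam) (fun x => h lam x ^+ 2) ^+ 2 + lam^-1 * mean (gwf d lam) (fun x => h lam x ^+ 4).
Proof.
move=> th; have := gw_four ll th th th th; rewrite /= -/(lin_chaos h lam) => e4.
transitivity (rsum (fun N => gwf d.+1 lam N * (lin_chaos h lam N * lin_chaos h lam N * (lin_chaos h lam N * lin_chaos h lam N)))).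
  by apply: eq_rsum => N; congr (_ * _); ring.
rewrite [LHS]e4.
rewrite (_ : mean _ (mulf h h lam) = mean (gwf d lam) (fun x => h lam x ^+ 2)); last first.
  by congr mean; apply/funext => x; rewrite /mulf expr2.
rewrite (_ : mean _ (mulf (mulf h h) (mulf h h) lam) = mean (gwf d lam) (fun x => h lam x ^+ 4)); last first.
  by congr mean; apply/funext => x; rewrite /mulf; ring.
by ring.
Qed.

(** The indicators have disjoint supports, so powers act on the coefficients. The exponent is
    positive because the combination vanishes off [A1], where a zeroth power would be 1. *)
Lemma mean_rows (c : X d -> R) n : mean (gwf d lam) (fun x => (\sum_(a <- A1) c a * ind a lam x) ^+ n.+1) =
  \sum_(a <- A1) gwf d lam a * c a ^+ n.+1.
Proof.
have ec x : (\sum_(a <- A1) c a * ind a lam x) ^+ n.+1 = \sum_(a <- A1) c a ^+ n.+1 * ind a lam x.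
  have [xA|xA] := boolP (x \in A1).
    have pick (g : X d -> R) : \sum_(a <- A1) g a * ind a lam x = g x.
      transitivity (\sum_(a <- A1) (x == a)%:R * g a); first by apply: eq_bigr => a _; rewrite mulrC.
      by rewrite sum_eqop// undup_uniq.
    by rewrite !pick.
  have zero (g : X d -> R) : \sum_(a <- A1) g a * ind a lam x = 0.
    rewrite big_seq big1// => a aA; rewrite /ind; case: eqP => [xa|]; last by rewrite mulr0.
    by rewrite xa aA in xA.
  by rewrite !zero expr0n.
rewrite /mean (eq_rsum (g := fun x => \sum_(a <- A1) c a ^+ n.+1 * (gwf d lam x * ind a lam x))); last first.
  by move=> x; rewrite ec mulr_sumr; apply: eq_bigr => a _; ring.
have sb a : asummable (fun x => gwf d lam x * ind a lam x) by exact: (tame_asummable (gwf_prob d) ll (tame_ind a)).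
rewrite rsum_sum; last by move=> a _; exact: asummableZ.
apply: eq_bigr => a _; rewrite rsumZ// (rsum_single (x0 := a)) /ind ?eqxx ?mulr1 1?mulrC// => x /negbTE ->.
by rewrite mulr0.
Qed.

(** [lin_chaos_four] is used twice, in the first tree for a fixed second one and then for each row
    chaos. In between, the square of the sum over rows is linearised by the weighted Cauchy
    inequality; since [3 al^2 + al / lam <= 3 al w], the result is
    [3 (e + 1/lam) (3 e) + 4 e / lam]. *)
Lemma boot_nul4 : rsum (fun t => null_pmf lam t * boot_stat t ^+ 4) <= 9 * e ^+ 2 + 13 * e * lam^-1.
Proof.
have l0 := Lge1_gt0 ll; have li : lam^-1 <= 1 by rewrite invf_le1//; exact: ll.
have li0 : 0 < lam^-1 by rewrite invr_gt0.
have [q0 q1] := gwf_prob d.+1 ll.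
pose y a t := lin_chaos (V a) lam t.
pose H t := 3 * (\sum_(a <- A1) gwf d lam a * y a t ^+ 2) ^+ 2 + lam^-1 * \sum_(a <- A1) gwf d lam a * y a t ^+ 4.
have H0 t : 0 <= H t.
  rewrite /H addr_ge0// mulr_ge0 ?sqr_ge0// ?(ltW li0)// sumr_ge0// => a _.
  by rewrite mulr_ge0// (pow_even_ge0 _ 2).
(* Integration over the first tree: the coefficients [y a t2] are constants here. *)
have inner t2 : psum (fun t1 => gwf d.+1 lam t1 * boot_stat (t1, t2) ^+ 4) = (H t2)%:E.
  have tG : tame (@Lge1 R) (gwf d) (fun lam' x => \sum_(a <- A1) y a t2 * ind a lam' x).
    apply: (tame_sum (gwf_prob d) (F := fun a lam' x => y a t2 * ind a lam' x)); apply: Pall_all => a.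
    exact: (tameZ (gwf_prob d) (c := fun=> y a t2) (fun _ _ => lexx _) (tame_ind a)).
  rewrite (eq_psum (g := fun t1 => gwf d.+1 lam t1 * lin_chaos (fun lam' x => \sum_(a <- A1) y a t2 * ind a lam' x) lam t1 ^+ 4)); last first.
    move=> t1; rewrite boot_stat_rows lin_chaos_sum//= => a; exact: tame_ind.
  rewrite -rsum_psum; last 2 first.
  - by move=> t1; rewrite mulr_ge0// (pow_even_ge0 _ 2).
  - exact: (tame_asummable (gwf_prob d.+1) (f := fun lam' t1 => lin_chaos (fun lam' x => \sum_(a <- A1) y a t2 * ind a lam' x) lam' t1 ^+ 4) ll
      (tame_pow (gwf_prob d.+1) 4 (tame_lin_chaos tG))).
  by rewrite lin_chaos_four// (mean_rows (fun a => y a t2) 1) (mean_rows (fun a => y a t2) 3).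
have outer a : asummable (fun t => gwf d.+1 lam t * y a t ^+ 4) /\
   rsum (fun t => gwf d.+1 lam t * y a t ^+ 4) = 3 * al a ^+ 2 + lam^-1 * al a.
  split.
    exact: (tame_asummable (gwf_prob d.+1) (f := fun lam' t => lin_chaos (V a) lam' t ^+ 4) ll
      (tame_pow (gwf_prob d.+1) 4 (tame_lin_chaos (tV a)))).
  rewrite /y lin_chaos_four// -mean_V.
  have V2 x : V a lam x ^+ 2 = V a lam x by rewrite expr2 V_idem.
  have -> : (fun x => V a lam x ^+ 2) = V a lam by apply/funext.
  have -> // : (fun x => V a lam x ^+ 4) = V a lam.
  by apply/funext => x; rewrite (exprM _ 2 2) !V2.
(* This weight balances the two terms of the fourth moment of [y a]. *)
pose w a := al a + lam^-1.
have w0 a : 0 < w a by rewrite ltr_wpDl// al_ge0.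
pose H' t := 3 * ((\sum_(a <- A1) gwf d lam a * w a) * \sum_(a <- A1) (gwf d lam a / w a) * y a t ^+ 4)
   + lam^-1 * \sum_(a <- A1) gwf d lam a * y a t ^+ 4.
have HH t : H t <= H' t.
  rewrite lerD2r ler_wpM2l//.
  apply: le_trans (cauchy_weighted A1 (fun a => y a t ^+ 2) g0 w0) _.
  rewrite le_eqVlt; apply/orP; left; apply/eqP; congr (_ * _); apply: eq_bigr => a _.
  by rewrite -exprM; ring.
pose K := 3 * ((\sum_(a <- A1) gwf d lam a * w a) * \sum_(a <- A1) (gwf d lam a / w a) * (3 * al a ^+ 2 + lam^-1 * al a))
   + lam^-1 * \sum_(a <- A1) gwf d lam a * (3 * al a ^+ 2 + lam^-1 * al a).
have sH' : asummable (fun t => gwf d.+1 lam t * H' t) /\ rsum (fun t => gwf d.+1 lam t * H' t) = K.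
  have lin (c : X d -> R) : asummable (fun t => \sum_(a <- A1) c a * (gwf d.+1 lam t * y a t ^+ 4)) /\
     rsum (fun t => \sum_(a <- A1) c a * (gwf d.+1 lam t * y a t ^+ 4)) = \sum_(a <- A1) c a * (3 * al a ^+ 2 + lam^-1 * al a).
    split; first by apply: asummable_sum => a _; apply: asummableZ; have [] := outer a.
    rewrite rsum_sum; last by move=> a _; apply: asummableZ; have [] := outer a.
    by apply: eq_bigr => a _; have [sa <-] := outer a; rewrite rsumZ.
  have [b1 e1] := lin (fun a => gwf d lam a / w a); have [b2 e2] := lin (gwf d lam).
  have eH t : gwf d.+1 lam t * H' t = 3 * (\sum_(a <- A1) gwf d lam a * w a) * (\sum_(a <- A1) (gwf d lam a / w a) * (gwf d.+1 lam t * y a t ^+ 4))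
    + lam^-1 * (\sum_(a <- A1) gwf d lam a * (gwf d.+1 lam t * y a t ^+ 4)).
    have pull (c : X d -> R) : \sum_(a <- A1) c a * (gwf d.+1 lam t * y a t ^+ 4) = gwf d.+1 lam t * \sum_(a <- A1) c a * y a t ^+ 4.
      by rewrite mulr_sumr; apply: eq_bigr => a _; ring.
    by rewrite !pull /H'; ring.
  split.
    by apply: (eq_asummable (fun t => esym (eH t))); apply: asummableD; exact: asummableZ.
  rewrite (eq_rsum eH) rsumD ?rsumZ//; [|exact: asummableZ|exact: asummableZ].
  by rewrite e1 e2 /K mulrA.
have [sK SK] := sH'.
have H'0 t : 0 <= H' t by apply: le_trans (H0 t) (HH t).
have nul4 t : 0 <= null_pmf lam t * boot_stat t ^+ 4.
  by rewrite mulr_ge0 ?(pow_even_ge0 _ 2)//; have [h _] := null_prob d.+1 ll.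
have step1 : psum (fun t => null_pmf lam t * boot_stat t ^+ 4) = psum (fun t2 => gwf d.+1 lam t2 * H t2).
  rewrite psum_swap (psum_pair (f := fun t2 t1 => null_pmf lam (t1, t2) * boot_stat (t1, t2) ^+ 4)); last first.
    by move=> *; exact: nul4.
  apply: eq_esum => t2 _.
  rewrite (eq_psum (g := fun t1 => gwf d.+1 lam t2 * (gwf d.+1 lam t1 * boot_stat (t1, t2) ^+ 4))); last first.
    by move=> t1; rewrite /null_pmf /=; ring.
  by rewrite psumZ ?inner// => t1; rewrite mulr_ge0// (pow_even_ge0 _ 2).
have gH t : 0 <= gwf d.+1 lam t * H t := mulr_ge0 (q0 t) (H0 t).
have gH' t : 0 <= gwf d.+1 lam t * H' t := mulr_ge0 (q0 t) (H'0 t).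
have step2 : rsum (fun t => null_pmf lam t * boot_stat t ^+ 4) <= K.
  rewrite rsum_ge0E// step1 -lee_fin -psum_fin; last 2 first.
  - exact: gH.
  - apply: le_lt_trans sK; apply: le_psum => t; rewrite ger0_norm ?gH'//.
    by apply: ler_wpM2l.
  rewrite -SK (rsum_psum gH')//.
  by apply: le_psum => t; apply: ler_wpM2l.
apply: le_trans step2 _.
have b1 : \sum_(a <- A1) gwf d lam a <= 1.
  rewrite -lee_fin; apply: le_trans (sum_le_psum (undup_uniq _) g0) _.
  by have [_ ->] := gwf_prob d ll.
have b2 : \sum_(a <- A1) gwf d lam a * w a <= e + lam^-1.
  rewrite /w; under eq_bigr do rewrite mulrDr.
  rewrite big_split/= sum_pi_al lerD2l -mulr_suml mulrC ler_piMr// ltW//.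
have e0 : 0 <= e by apply: sumr_ge0 => k _; rewrite mulr_ge0.
have b3 : \sum_(a <- A1) (gwf d lam a / w a) * (3 * al a ^+ 2 + lam^-1 * al a) <= 3 * e.
  rewrite -sum_pi_al mulr_sumr; apply: ler_sum => a _.
  rewrite -[leLHS]mulrA [leRHS]mulrCA; apply: ler_wpM2l => //.
  rewrite [leLHS]mulrC ler_pdivrMr// /w.
  by have := mulr_ge0 (al_ge0 a) (ltW li0); nra.
have b4 : \sum_(a <- A1) gwf d lam a * (3 * al a ^+ 2 + lam^-1 * al a) <= 4 * e.
  rewrite -sum_pi_al mulr_sumr; apply: ler_sum => a _; rewrite [leRHS]mulrCA; apply: ler_wpM2l => //.
  by have := al_ge0 a; have := al_le1 a; nra.
have b5 : (\sum_(a <- A1) gwf d lam a * w a) * (\sum_(a <- A1) (gwf d lam a / w a) * (3 * al a ^+ 2 + lam^-1 * al a)) <= (e + lam^-1) * (3 * e).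
  apply: ler_pM => //.
    by apply: sumr_ge0 => a _; rewrite mulr_ge0// ltW.
  apply: sumr_ge0 => a _; rewrite mulr_ge0 ?divr_ge0 ?(ltW (w0 a))//.
  by rewrite addr_ge0 ?mulr_ge0 ?sqr_ge0 ?al_ge0 ?(ltW li0).
rewrite /K; apply: (@le_trans _ _ (3 * ((e + lam^-1) * (3 * e)) + lam^-1 * (4 * e))).
  by apply: lerD; apply: ler_wpM2l => //; exact: ltW.
by rewrite le_eqVlt; apply/orP; left; apply/eqP; ring.
Qed.

End Step.

End Boot.

(** * Iterating the bootstrap and the growth of the number of trees *)

Section Final.
Variable R : realType.

(** The mass of [T] is a supremum over finite sets, so some finite part of [T] exceeds 1/2; passing
    to a part of [T] can only decrease the null mass. *)
Lemma finite_subtest (s lam : R) d (T : X d * X d -> bool) : 0 < s -> s <= 1 -> Lge1 lam ->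
  3 / 4 <= corr_mass s lam T ->
  exists F : seq (X d * X d), [/\ uniq F, 1 / 2 <= \sum_(k <- F) cmf s d lam k &
     \sum_(k <- F) gwf d lam k.1 * gwf d lam k.2 <= null_mass lam T].
Proof.
move=> s0 s1 ll hp; have [c0 c1] := cmf_prob (ltW s0) s1 d ll; have [n0 n1] := null_prob d ll.
have ti (P : X d * X d -> R) : (forall t, 0 <= P t) -> psum P = 1%E -> asummable (fun t => P t * (T t)%:R).
  move=> P0 P1; apply: (le_asummable (g := P)); last by rewrite P1 ltry.
  by move=> t; rewrite ger0_norm ?mulr_ge0// ler_piMr// lern1 leq_b1.
have ct t : 0 <= cmf s d lam t * (T t)%:R by exact: mulr_ge0.
have nt t : 0 <= null_pmf lam t * (T t)%:R by exact: mulr_ge0.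
have : ((1 / 2)%:E < psum (fun t => (cmf s d lam t * (T t)%:R)%R))%E.
  by rewrite -rsum_psum ?lte_fin//; [rewrite /corr_mass in hp; lra|exact: ti].
move=> /ereal_sup_gt[_ [Y [finY _] <-]]; rewrite fsbig_finite//= sumEFin lte_fin => hY.
have bf (P : X d * X d -> R) : \sum_(k <- [seq k <- fset_set Y | T k]) P k = \sum_(k <- fset_set Y) P k * (T k)%:R.
  by rewrite big_filter big_mkcond; apply: eq_bigr => k _; case: (T k); rewrite ?mulr1 ?mulr0.
exists [seq k <- fset_set Y | T k]; split.
- exact/filter_uniq/fset_uniq.
- by rewrite bf ltW.
- rewrite (bf (fun k => gwf d lam k.1 * gwf d lam k.2)).
  rewrite -lee_fin; apply: le_trans (sum_le_psum (fset_uniq _) nt) _.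
  by rewrite -rsum_psum//; exact: ti.
Qed.

(** As [p >= 1/2], the threshold is at least [s / 4], so Markov's inequality requires the fourth
    moment to be at most [eps / 2 * s^4 / 256]. The conditions on [lam] and [eps] do not mention
    [d], so one [lam] serves all depths. *)
Lemma boot_step (s lam eps : R) d (F : seq (X d * X d)) : 0 < s -> s <= 1 -> Lge1 lam ->
  120 * 120 / s ^+ 4 <= lam -> 0 <= eps -> eps <= s ^+ 4 / (100 * 100) ->
  uniq F -> 1 / 2 <= \sum_(k <- F) cmf s d lam k ->
  \sum_(k <- F) gwf d lam k.1 * gwf d lam k.2 <= eps ->
  exists T : X d.+1 * X d.+1 -> bool, null_mass lam T <= eps / 2 /\ 3 / 4 <= corr_mass s lam T.
Proof.
move=> s0 s1 ll hl e0 he uF hp hn; have s0' := ltW s0; have l0 := Lge1_gt0 ll.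
have [P0 P1] := cmf_prob s0' s1 d.+1 ll; have [N0 N1] := null_prob d.+1 ll.
have c1 := boot_cm1 F s0 s1 ll; have c2 := boot_cm2 s0 s1 ll uF; have n4 := boot_nul4 ll uF.
move: hp hn c1 c2 n4.
set p := \sum_(k <- F) cmf s d lam k; set e := \sum_(k <- F) _ => hp hn c1 c2 n4.
set W := boot_stat lam F in c1 c2 n4.
have tu (k : X d * X d) : tame (@Lge1 R) (gwf d) (ind k.1) by exact: tame_ind.
have tv (k : X d * X d) : tame (@Lge1 R) (gwf d) (ind k.2) by exact: tame_ind.
have tWn := tame_stat F tu tv (@null_prob R d.+1) (@null_fst R d.+1) (@null_snd R d.+1).
have tWc := tame_stat F tu tv (cmf_prob s0' s1 d.+1) (cmf_fst s0' s1 (d := d.+1)) (cmf_snd s0' s1 (d := d.+1)).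
have sn4 := tame_asummable (@null_prob R d.+1) ll (tame_pow (@null_prob R d.+1) (2 * 2) tWn).
have sc1 := tame_asummable (cmf_prob s0' s1 d.+1) ll tWc.
have sc2 := tame_asummable (cmf_prob s0' s1 d.+1) ll (tame_pow (cmf_prob s0' s1 d.+1) 2 tWc).
have m0 : s / 2 <= s * p by rewrite ler_wpM2l//; lra.
have mp : 0 < s * p by apply: lt_le_trans m0; lra.
have s4 : 0 < s ^+ 4 by rewrite exprn_gt0.
have e0' : 0 <= e.
  have [g0 _] := gwf_prob d ll.
  by apply: sumr_ge0 => k _; rewrite mulr_ge0.
have li : lam^-1 <= s ^+ 4 / (120 * 120).
  have h := invf_div (120 * 120) (s ^+ 4); rewrite -h lef_pV2 ?posrE//.
  by apply: divr_gt0 => //; lra.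
have es4 : 0 <= eps * s ^+ 4 by apply: mulr_ge0 => //; exact: ltW.
have li0 : 0 < lam^-1 by rewrite invr_gt0.
exists (fun t => s * p / 2 <= W t); split.
  apply: le_trans (markov_even (k := 2) N0 _ _ sn4) _.
  - by rewrite divr_gt0.
  - by rewrite N1 ltry.
  have m4 : s ^+ 4 / 256 <= (s * p / 2) ^+ 4.
    have -> : s ^+ 4 / 256 = (s / 4) ^+ 4 by field.
    rewrite lerXn2r ?nnegrE ?divr_ge0 ?(ltW mp)//.
    by move: m0; lra.
  rewrite ler_pdivrMr ?exprn_gt0 ?divr_gt0//; apply: le_trans n4 _.
  apply: (@le_trans _ _ (eps / 2 * (s ^+ 4 / 256))); last by rewrite ler_wpM2l ?divr_ge0.
  (* Each of the two terms gets half of [eps * s^4 / 512]; the constants suit since [9 / 100^2] and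
     [13 / 120^2] are both below [1 / 1024]. *)
  have h1 : 9 * e ^+ 2 <= eps * (s ^+ 4 / 1024).
    apply: (@le_trans _ _ (9 * (eps * (s ^+ 4 / (100 * 100))))); last by lra.
    by rewrite ler_wpM2l// expr2 ler_pM//; lra.
  have h2 : 13 * e * lam^-1 <= eps * (s ^+ 4 / 1024).
    apply: (@le_trans _ _ (13 * eps * (s ^+ 4 / (120 * 120)))); last by lra.
    by rewrite ler_pM ?mulr_ge0 ?(ltW li0)// ler_wpM2l.
  by lra.
have := chebyshev_lower P0 P1 sc1 sc2; rewrite c1 => /(_ mp); apply: le_trans.
set V := rsum _ - _ in c2 *.
suff : 4 * V / (s * p) ^+ 2 <= 1 / 4 by lra.
rewrite ler_pdivrMr ?exprn_gt0//.
have h5 : s ^+ 2 / 4 <= (s * p) ^+ 2.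
  have -> : s ^+ 2 / 4 = (s / 2) ^+ 2 by field.
  by rewrite lerXn2r ?nnegrE ?(ltW mp)//; lra.
have h6 : s ^+ 4 <= s ^+ 2.
  have -> : s ^+ 4 = s ^+ 2 * s ^+ 2 by ring.
  by rewrite ler_piMr ?sqr_ge0// exprn_ile1.
by lra.
Qed.

Lemma bernoulli (x : R) n : 0 <= x -> 1 + n%:R * x <= (1 + x) ^+ n.
Proof.
move=> x0; elim: n => [|n ih]; first by rewrite expr0 mul0r addr0.
rewrite exprS; apply: (@le_trans _ _ ((1 + x) * (1 + n%:R * x))).
  rewrite -natr1; have : 0 <= n%:R * x * x by rewrite !mulr_ge0.
  by nra.
by rewrite ler_wpM2l//; lra.
Qed.

(** Bernoulli's inequality applied to a fourth root: growth of order [n^4] is enough to absorb the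
    polynomial factor of Otter's asymptotics. *)
Lemma quartic_growth (x : R) n : 1 < x -> n%:R ^+ 4 * (x - 1) ^+ 4 <= (x ^+ 4) ^+ n.
Proof.
move=> x1; rewrite -exprM mulnC exprM -exprMn.
have := @bernoulli (x - 1) n; rewrite [1 + (x - 1)]addrC subrK subr_ge0 => /(_ (ltW x1)) h.
have h0 : 0 <= n%:R * (x - 1) by rewrite mulr_ge0// subr_ge0 ltW.
have hx : 0 <= x ^+ n by apply: exprn_ge0; lra.
by apply: lerXn2r; rewrite ?nnegrE//; lra.
Qed.

(** For large [n], [A n] is at least half its equivalent, hence at least
    [D / 2 * n^(-2) * alpha^(-n)]. Multiplying by [s^(2n)] gives the power [(s^2 / alpha)^n], which
    exceeds a multiple of [n^4]. *)
Lemma otter_growth (alpha s M : R) : is_otter_constant alpha -> 0 < s -> alpha < s ^+ 2 ->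
  exists d, exists B : seq (X d), [/\ uniq B, (forall b, b \in B -> nodes b = d.+1) &
    M <= (size B)%:R * s ^+ (2 * d.+1)].
Proof.
move=> [a0 [A [hA [D [D0 hD]]]]] s0 sa.
pose rho := s ^+ 2 / alpha.
have rho1 : 1 < rho by rewrite ltr_pdivlMr// mul1r.
pose sig := Num.sqrt (Num.sqrt rho).
have sq1 : 1 < Num.sqrt rho by rewrite -sqrtr1 ltr_sqrt//; lra.
have sig1 : 1 < sig by rewrite /sig -sqrtr1 ltr_sqrt//; lra.
have sig4 : sig ^+ 4 = rho.
  rewrite (exprM sig 2 2) /sig sqr_sqrtr; last by lra.
  by rewrite sqr_sqrtr//; lra.
pose c := D / 2 * (sig - 1) ^+ 4.
have c0 : 0 < c by rewrite mulr_gt0 ?exprn_gt0//; [lra|rewrite subr_gt0].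
have [N _ hN] : \forall n \near \oo, 1 / 2 <= (A n)%:R / (D * (n%:R `^ (-(3/2))) * alpha ^- n).
  have h12 : (1 / 2 : R) < 1 by lra.
  near=> n; apply: ltW; near: n.
  exact: (cvgr_gt (1 : R) hD _ h12).
(* Beyond [N] the asymptotics hold up to the factor 1/2; the second term makes [n * c] exceed
   [|M|]. *)
pose n := maxn N (Num.truncn (`|M| / c)).+1.
have n0 : (0 < n)%N by rewrite leq_max orbT.
have nM : `|M| <= n%:R * c.
  rewrite -ler_pdivrMr//; apply: le_trans (ltW (truncnS_gt _)) _.
  by rewrite ler_nat leq_max leqnn orbT.
have [d nd] : exists d, n = d.+1 by exists n.-1; rewrite prednK.
have nn0 : 0 < n%:R :> R by rewrite ltr0n.
have n1 : 1 <= n%:R :> R by rewrite ler1n.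
have grow : M <= (A n)%:R * s ^+ (2 * n).
  have := hN n; rewrite /= leq_maxl => /(_ isT) hn.
  have pw : n%:R ^- 2 <= n%:R `^ (-(3/2)) :> R.
    by rewrite -powR_invn ?ler_powR//; lra.
  have an0 : 0 < alpha ^- n by rewrite invr_gt0 exprn_gt0.
  have pw0 : 0 < n%:R `^ (-(3/2)) :> R by rewrite powR_gt0.
  have A1 : D / 2 * n%:R ^- 2 * alpha ^- n <= (A n)%:R.
    move: hn; rewrite ler_pdivlMr; last by rewrite mulr_gt0// mulr_gt0.
    apply: le_trans.
    have -> : 1 / 2 * (D * n%:R `^ (- (3 / 2)) * alpha ^- n) = D / 2 * n%:R `^ (- (3 / 2)) * alpha ^- n by ring.
    by rewrite ler_wpM2r ?(ltW an0)// ler_wpM2l//; lra.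
  have sn0 : 0 < s ^+ (2 * n) by rewrite exprn_gt0.
  apply: (@le_trans _ _ (D / 2 * n%:R ^- 2 * alpha ^- n * s ^+ (2 * n))); last first.
    by rewrite ler_wpM2r// ltW.
  have -> : D / 2 * n%:R ^- 2 * alpha ^- n * s ^+ (2 * n) = D / 2 * n%:R ^- 2 * rho ^+ n.
    by rewrite /rho expr_div_n -exprM -!mulrA [alpha ^- n * _]mulrC.
  have rn : n%:R ^+ 4 * (sig - 1) ^+ 4 <= rho ^+ n.
    rewrite -sig4; exact: quartic_growth.
  apply: (@le_trans _ _ (n%:R * c)); first by apply: le_trans nM; rewrite ler_norm.
  apply: (@le_trans _ _ (D / 2 * n%:R ^- 2 * (n%:R ^+ 4 * (sig - 1) ^+ 4))); last first.
    by apply: ler_wpM2l rn; apply: mulr_ge0; rewrite ?invr_ge0 ?exprn_ge0 ?divr_ge0 ?(ltW D0).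
  have -> : D / 2 * n%:R ^- 2 * (n%:R ^+ 4 * (sig - 1) ^+ 4) = n%:R ^+ 2 * c.
    by rewrite /c; field; rewrite gt_eqF.
  by rewrite ler_wpM2r ?(ltW c0)// expr2 ler_peMr// ltW.
have := hA n n0; rewrite nd in grow *; rewrite /= => hc.
have hc' : ([set t : X d | nodes t = d.+1] #= `I_(A d.+1))%card by rewrite (card_eqr card_II).
have fB : finite_set [set t : X d | nodes t = d.+1] by exists (A d.+1).
exists d, (fset_set [set t : X d | nodes t = d.+1]); split.
- exact: fset_uniq.
- by move=> b; rewrite in_fset_set// inE.
- by rewrite -[size _]/(#|` fset_set _|)%fset (card_fset_set hc').
Unshelve. all: by end_near.
Qed.

Lemma prob_event_null (lam : R) d (T : X d * X d -> bool) : 0 < lam -> Lge1 lam ->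
  prob_event (null_model lam d) T = (null_mass lam T)%:E.
Proof.
move=> l0 ll; have [n0 n1] := null_prob d ll.
have nt t : 0 <= null_pmf lam t * (T t)%:R by exact: mulr_ge0.
rewrite /null_mass rsum_psum//; last first.
  apply: (le_asummable (g := @null_pmf R d lam)); last by rewrite n1 ltry.
  by move=> t; rewrite ger0_norm; [apply: ler_piMr => //; rewrite lern1 leq_b1|exact: nt].
rewrite /prob_event esum_mkcond; apply: eq_esum => t _.
rewrite (_ : (t \in [set x | T x]) = T t); last by apply/idP/idP; rewrite inE.
by case: (T t); rewrite ?mulr0// mulr1 /null_model !gwE// -EFinM.
Qed.

Lemma prob_event_corr (s lam : R) d (T : X d * X d -> bool) : 0 <= s -> s <= 1 -> Lge1 lam ->
  prob_event (corr_model lam s d) T = (corr_mass s lam T)%:E.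
Proof.
move=> s0 s1 ll; have l0 := Lge1_gt0 ll; have [n0 n1] := cmf_prob s0 s1 d ll.
have nt t : 0 <= cmf s d lam t * (T t)%:R by exact: mulr_ge0.
rewrite /corr_mass rsum_psum//; last first.
  apply: (le_asummable (g := cmf s d lam)); last by rewrite n1 ltry.
  by move=> t; rewrite ger0_norm; [apply: ler_piMr => //; rewrite lern1 leq_b1|exact: nt].
rewrite /prob_event esum_mkcond; apply: eq_esum => t _.
rewrite (_ : (t \in [set x | T x]) = T t); last by apply/idP/idP; rewrite inE.
by case: (T t); rewrite ?mulr0// mulr1 corrE.
Qed.

Lemma limn_einf_ge (u : nat -> \bar R) (c : \bar R) N : (forall n, (N <= n)%N -> (c <= u n)%E) ->
  (c <= limn_einf u)%E.
Proof.
move=> h; rewrite limn_einf_lim (cvg_lim _ (cvg_einfs_sup (u := u)))//.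
apply: (@le_trans _ _ (einfs u N)); last by apply: ereal_sup_ubound; exists N.
by apply: le_ereal_inf_tmp => _ [k /= Nk <-]; exact: h.
Qed.

End Final.

Theorem theorem3 (R : realType) (alpha : R) :
  is_otter_constant alpha ->
  forall s : R, Num.sqrt alpha < s <= 1 ->
  exists lam0 : R, 0 < lam0 /\
    forall lam : R, lam0 <= lam ->
      exists T : forall d : nat, X d * X d -> bool,
        prob_event (null_model lam d) (T d) @[d --> \oo] --> 0%E /\
        (0 < limn_einf (fun d : nat => prob_event (corr_model lam s d) (T d)))%E.
Proof.
move=> otter s /andP[sa s1].
have a0 : 0 < alpha by case: otter.
have s0 : 0 < s by apply: le_lt_trans sa; rewrite sqrtr_ge0.
have s0' := ltW s0.
have s2 : alpha < s ^+ 2.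
  by rewrite -(sqr_sqrtr (ltW a0)) ltrXn2r// nnegrE ?sqrtr_ge0.
have s4 : 0 < s ^+ 4 by rewrite exprn_gt0.
pose eps := s ^+ 4 / (100 * 100).
have e0 : 0 < eps by rewrite /eps; lra.
have e0' := ltW e0.
(* The sum covers both lower bounds asked by [base_test]. *)
have [d [B [uB nB MB]]] := otter_growth (4 / eps + 64) otter s0 s2.
have h4 : 0 < 4 / eps by apply: divr_gt0 => //; lra.
have [||lam1 base] := base_test s0 s1 uB nB e0; [lra|lra|].
have h13 : 0 < 120 * 120 / s ^+ 4 by apply: divr_gt0 => //; lra.
(* Adds up the three demands on [lam]: at least 1 for the moment bounds, [lam1] for the base test,
   and the bootstrap threshold. *)
exists (1 + `|lam1| + 120 * 120 / s ^+ 4); split; first by have := normr_ge0 lam1; lra.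
move=> lam hlam; have nl := normr_ge0 lam1; have nl' := ler_norm lam1.
have ll : Lge1 lam by rewrite /Lge1; lra.
have l0 := Lge1_gt0 ll.
have hl : 120 * 120 / s ^+ 4 <= lam by lra.
have tests k : exists T : X (k + d.+1)%N * X (k + d.+1)%N -> bool,
    null_mass lam T <= eps / 2 ^+ k /\ 3 / 4 <= corr_mass s lam T.
  elim: k => [|k [T [hT0 hT1]]].
    by rewrite expr0 divr1; apply: base => //; lra.
  have [F [uF F1 F0]] := finite_subtest s0 s1 ll hT1.
  (* The bound [eps / 2^k] stays below [eps = s^4 / 100^2], so the smallness condition of
     [boot_step] holds at every step. *)
  rewrite exprSr invfM mulrA; apply: (boot_step s0 s1 ll hl _ _ uF F1 (le_trans F0 hT0)).
    by rewrite divr_ge0// exprn_ge0.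
  by rewrite ler_pdivrMr ?exprn_gt0// ler_peMr// exprn_ege1//; lra.
(* Below depth [d+1] the test never accepts, which does not affect the limits. *)
have testd n : exists T : X n * X n -> bool, (d.+1 <= n)%N ->
    null_mass lam T <= eps / 2 ^+ (n - d.+1) /\ 3 / 4 <= corr_mass s lam T.
  have [dn|dn] := leqP d.+1 n; last by exists (fun=> false).
  by have := tests (n - d.+1)%N; rewrite subnK// => -[T hT]; exists T.
exists (fun n => sval (cid (testd n))); split.
  rewrite (_ : (fun n => _) = fun n => (null_mass lam (sval (cid (testd n))))%:E); last first.
    by apply/funext => n; rewrite prob_event_null.
  apply: cvg_EFin; first exact: nearW.
  (* For [n >= d+1] the bound [eps / 2^(n-d-1)] equals [eps * 2^(d+1) * 2^(-n)], a geometric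
     sequence in [n] itself. *)
  apply: (@squeeze_cvgr _ _ _ _ (fun=> 0) (geometric (eps * 2 ^+ d.+1) (2^-1))).
  - near=> n; apply/andP; split.
      by apply: rsum_ge0 => t; rewrite mulr_ge0//; have [h _] := null_prob n ll.
    have dn : (d.+1 <= n)%N by near: n; exact: nbhs_infty_ge.
    have [h _] := svalP (cid (testd n)) dn; apply: le_trans h _.
    have -> : geometric (eps * 2 ^+ d.+1) 2^-1 n = eps * 2 ^+ d.+1 * 2^-1 ^+ (n - d.+1 + d.+1) by rewrite subnK.
    rewrite exprD !exprVn le_eqVlt; apply/orP; left; apply/eqP.
    have : (2 : R) ^+ (n - d.+1) != 0 by rewrite expf_neq0.
    have : (2 : R) ^+ d.+1 != 0 by rewrite expf_neq0.
    by move: (2 ^+ (n - d.+1)) (2 ^+ d.+1) => x y y0 x0; field; rewrite x0 y0.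
  - exact: cvg_cst.
  - by apply: cvg_geometric; rewrite ger0_norm ?invr_ge0//; lra.
apply: (@lt_le_trans _ _ (3 / 4)%:E); first by rewrite lte_fin; lra.
apply: (limn_einf_ge (N := d.+1)) => n dn; rewrite prob_event_corr// lee_fin.
by have [_] := svalP (cid (testd n)) dn.
Unshelve. all: by end_near.
Qed.
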